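(* Let $\alpha,\beta,\gamma>0$. Let $[\Gamma(\alpha s+\beta)]^\gamma$ denote the branch, holomorphic in $s\in\mathbb{C}\setminus(-\infty,-\beta/\alpha]$, which is positive for real $s>-\beta/\alpha$. For $z\in\mathbb{C}\setminus(-\infty,0]$ fix a value $\theta$ of the argument of $-z$ and set $(-z)^s=\exp\{s(\log|z|+i\theta)\}$. Let $\mathcal{L}_{+\infty}$ be a right loop lying in a horizontal strip, starting at $+\infty+i\varphi_1$ and ending at $+\infty+i\varphi_2$ with $-\infty<\varphi_1<0<\varphi_2<+\infty$, and crossing the real axis at exactly one point $c$ with $0<c<1$ (so it encloses the points $s=1,2,\dots$ and leaves $s=0,-1,-2,\dots$ outside). Then the integral below converges and $$F_{\alpha,\beta}^{(\gamma)}(z)=\frac{1}{2\pi i}\int_{\mathcal{L}_{+\infty}}\frac{\Gamma(-s)\Gamma(1+s)}{[\Gamma(\alpha s+\beta)]^{\gamma}}(-z)^s\,ds+\frac{1}{[\Gamma(\beta)]^{\gamma}},\qquad z\in\mathbb{C}\setminus(-\infty,0].$$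
   Context: For $\alpha,\beta,\gamma>0$ the Le Roy type function is $F_{\alpha,\beta}^{(\gamma)}(z)=\sum_{k=0}^{\infty}\frac{z^k}{[\Gamma(\alpha k+\beta)]^{\gamma}}$, $z\in\mathbb{C}$, where $[\Gamma(\alpha k+\beta)]^\gamma$ is the positive real power of the positive number $\Gamma(\alpha k+\beta)$. *)

(* Defs.v *)
From Stdlib Require Import Reals List Factorial.
From Coquelicot Require Import Coquelicot.
Open Scope R_scope.

Definition Cexp (s : C) : C :=
  (exp (Re s) * cos (Im s), exp (Re s) * sin (Im s)).

(* Complex Gamma function, via Gauss/Euler's product limit
     Gamma(s) = lim_{n -> oo} n! n^s / (s (s+1) ... (s+n)),
   valid for every s not in {0,-1,-2,...}; here n^s := exp (s ln n).
   The limit is taken componentwise (C = R * R). *)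
Definition Gamma_seq (s : C) (n : nat) : C :=
  Cdiv (Cmult (RtoC (INR (fact n))) (Cexp (Cmult s (RtoC (ln (INR n))))))
       (fold_right Cmult (RtoC 1) (map (fun k => Cplus s (RtoC (INR k))) (seq 0 (S n)))).

Definition CGamma (s : C) : C :=
  (real (Lim_seq (fun n => Re (Gamma_seq s n))),
   real (Lim_seq (fun n => Im (Gamma_seq s n)))).

Definition GammaPow (x g : R) : R := Rpower (Re (CGamma (RtoC x))) g.

Definition LeRoy_term (a b g : R) (z : C) (k : nat) : C :=
  Cdiv (Cpow z k) (RtoC (GammaPow (a * INR k + b) g)).

(* The series sum_k LeRoy_term a b g z k defines F_{a,b}^{(g)}(z); in the
   theorem we assert (with [is_series]) that it converges to the right-hand side. *)

Definition cut_plane (r : R) (s : C) : Prop := ~ (Im s = 0 /\ Re s <= r).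

(* Main.v *)
Require Import Defs.
From Stdlib Require Import Reals List Factorial.
From Stdlib Require Import Lra Lia ClassicalEpsilon.
From Coquelicot Require Import Coquelicot.
Open Scope R_scope.

(* By Euler's reflection formula the integrand is [- PI / sin (PI s) * q s] with
   [q s = (-z)^s / Gamma(a s + b)^g], whose pole at an integer [k >= 1] has residue
   [- (-1)^k q k = - z^k / Gamma(a k + b)^g]. Iterating [Gamma(s+1) = s Gamma(s)] with step [1/a] shows
   that [q] decays faster than any exponential in a horizontal strip. The loop meets the real axis only
   inside (0,1), so it stays in the plane cut along (-oo,0] and [1,+oo), where the integrand has a
   primitive; hence the integral only depends on the ends of the loop and can be compared with the
   boundary integral of the rectangle [c, n+1/2] x [phi1, phi2], which the residues at 1..n compute.
   As [LG] is only assumed differentiable, Cauchy's theorem is obtained by Goursat's bisection.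
   The reflection formula comes from Euler's sine product, itself read off the recurrence in [n] of
   the integrals of [cos^n t cos (2 s t)] over [0, PI/2]. *)

(** * Complex differentiability *)

(** The loop is an arbitrary C^1 curve, possibly crossing itself above or below the axis, so it is
    not deformed piece by piece: all geometry is moved into a primitive, of which only the values
    near the two ends of the loop matter. The loop runs clockwise around the poles (leftwards below
    the axis, rightwards above it), so minus the residues are summed and the series comes with a
    plus sign. The right sides of the rectangles sit at half-integers because |sin(PI s)| >= 1 there
    at every height, also on the axis; near the heights phi1 and phi2 the sine is bounded below by
    the distance to the axis. Decay of [q] like exp(-x) suffices, the slope of the growth of Re [LG]
    being chosen to absorb |z|^x. This growth is insensitive to the branch, since Re [LG] is the
    logarithm of |Gamma|; the branch matters at the integers, where [LG] is real. As [CGamma] is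
    built from total limits, the convergence of Gauss's product has to come before any identity for
    Gamma. *)

Local Notation ccont := (continuous (T := C_UniformSpace) (U := C_UniformSpace)) (only parsing).

Lemma RtoC_neq0 (x : R) : x <> 0 -> RtoC x <> RtoC 0.
Proof. intros H E; apply H; now apply RtoC_inj. Qed.

Lemma Cexp_plus (u v : C) : Cexp (u + v) = (Cexp u * Cexp v)%C.
Proof.
  destruct u as [a b], v as [c d]; unfold Cexp; cbn.
  rewrite exp_plus, cos_plus, sin_plus; unfold Cmult; cbn; f_equal; ring.
Qed.

Lemma Cexp_0 : Cexp 0 = 1.
Proof. unfold Cexp; cbn; rewrite exp_0, cos_0, sin_0; unfold RtoC; f_equal; ring. Qed.

Lemma Cmod_Cexp (s : C) : Cmod (Cexp s) = exp (Re s).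
Proof.
  unfold Cmod, Cexp; cbn [fst snd].
  replace (_ + _) with ((exp (Re s))^2 * ((sin (Im s))² + (cos (Im s))²)) by (unfold Rsqr; ring).
  rewrite sin2_cos2, Rmult_1_r. apply sqrt_pow2. left; apply exp_pos.
Qed.

Lemma Cexp_neq0 (s : C) : Cexp s <> 0.
Proof.
  apply Cmod_gt_0. rewrite Cmod_Cexp. apply exp_pos.
Qed.

Lemma Cexp_opp (s : C) : Cexp (- s) = (/ Cexp s)%C.
Proof.
  assert (H : (Cexp (- s) * Cexp s)%C = 1).
  { rewrite <- Cexp_plus, <- Cexp_0. f_equal. ring. }
  rewrite <- (Cmult_1_l (/ Cexp s)), <- H. field. apply Cexp_neq0.
Qed.

Lemma Cexp_nat (n : nat) (s : C) : Cexp (INR n * s) = (Cexp s ^ n)%C.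
Proof.
  induction n as [|n IH].
  - cbn [Cpow INR]. rewrite Cmult_0_l. apply Cexp_0.
  - rewrite S_INR, RtoC_plus, Cpow_S, <- IH, <- Cexp_plus. f_equal. ring.
Qed.

Lemma Cexp_real (x : R) : Cexp (RtoC x) = RtoC (exp x).
Proof. unfold Cexp, RtoC; cbn. rewrite cos_0, sin_0; f_equal; ring. Qed.

Lemma Cmod_le_sum (s : C) : Cmod s <= Rabs (Re s) + Rabs (Im s).
Proof.
  destruct s as [x y].
  replace (x, y) with (RtoC x + Ci * RtoC y)%C
    by (unfold RtoC, Cplus, Cmult, Ci; cbn; f_equal; ring).
  eapply Rle_trans; [apply Cmod_triangle|].
  rewrite Cmod_mult, !Cmod_R, Cmod_Ci.
  unfold Re, Im, RtoC, Cplus, Cmult, Ci; cbn.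
  replace (x + (0 * y - 1 * 0)) with x by ring.
  replace (0 + (0 * 0 + 1 * y)) with y by ring. lra.
Qed.

Lemma im_le_Cmod (s : C) : Rabs (Im s) <= Cmod s.
Proof. eapply Rle_trans; [apply Rmax_r | apply Rmax_Cmod]. Qed.

Lemma Cmod_minus_sym (u v : C) : Cmod (u - v) = Cmod (v - u).
Proof. rewrite <- Cmod_opp. f_equal. ring. Qed.

Lemma Cmod_triangle_minus (u v : C) : Cmod u <= Cmod v + Cmod (u - v).
Proof.
  replace u with (v + (u - v))%C at 1 by ring. apply Cmod_triangle.
Qed.

(** [C_UniformSpace] is a product structure whose balls are squares; discs and squares contain each
    other up to the factor [sqrt 2]. From here on limits can be handled with the modulus. *)
Lemma locally_Cmod (s : C) (P : C -> Prop) :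
  locally (T := C_UniformSpace) s P <->
  exists d, 0 < d /\ forall w, Cmod (w - s) < d -> P w.
Proof.
  split.
  - intros [d Hd]. exists d; split; [apply cond_pos|].
    intros w Hw. apply Hd. apply C_NormedModule_mixin_compat1. exact Hw.
  - intros (d & Hd & H).
    assert (Hd2 : 0 < d / sqrt 2) by (apply Rdiv_lt_0_compat; [lra | apply Rlt_sqrt2_0]).
    exists (mkposreal _ Hd2). intros w Hw. apply H.
    apply C_NormedModule_mixin_compat2 in Hw. cbn in Hw.
    replace (sqrt 2 * (d / sqrt 2)) with d in Hw; [exact Hw|].
    field. apply Rgt_not_eq, Rlt_sqrt2_0.
Qed.

Lemma filterlim_Cmod {T : Type} {F : (T -> Prop) -> Prop} {FF : Filter F} (f : T -> C) (l : C) :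
  filterlim f F (locally (T := C_UniformSpace) l) <->
  forall eps, 0 < eps -> F (fun x => Cmod (f x - l) < eps).
Proof.
  split.
  - intros H eps He. apply (H (fun w => Cmod (w - l) < eps)).
    apply locally_Cmod. exists eps; auto.
  - intros H P HP. apply locally_Cmod in HP. destruct HP as (d & Hd & HP).
    unfold filtermap. eapply filter_imp; [|apply (H d Hd)]. intros x; apply HP.
Qed.

Lemma ccont_Cmod (f : C -> C) (s : C) :
  ccont f s <-> forall eps, 0 < eps ->
    exists d, 0 < d /\ forall w, Cmod (w - s) < d -> Cmod (f w - f s) < eps.
Proof.
  unfold continuous. rewrite filterlim_Cmod.
  split; intros H eps He; [apply locally_Cmod | apply (locally_Cmod s)]; auto.
Qed.

Lemma continuous_C_pair {U : UniformSpace} (f : U -> C) (s : U) :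
  continuous (U := R_UniformSpace) (fun x => Re (f x)) s ->
  continuous (U := R_UniformSpace) (fun x => Im (f x)) s ->
  continuous (U := C_UniformSpace) f s.
Proof.
  intros H1 H2. apply filterlim_Cmod. intros eps He.
  pose proof (proj1 (filterlim_locally (F := locally s) (U := R_UniformSpace) (fun x => Re (f x)) (Re (f s))) H1) as K1.
  pose proof (proj1 (filterlim_locally (F := locally s) (U := R_UniformSpace) (fun x => Im (f x)) (Im (f s))) H2) as K2.
  assert (He2 : 0 < eps / 2) by lra.
  specialize (K1 (mkposreal _ He2)). specialize (K2 (mkposreal _ He2)).
  generalize (filter_and _ _ K1 K2). apply filter_imp. intros x [A B].
  eapply Rle_lt_trans; [apply Cmod_le_sum|].
  unfold ball in A, B; cbn in A, B; unfold AbsRing_ball, abs, minus, plus, opp in A, B; cbn in A, B.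
  unfold Cminus. rewrite re_plus, im_plus, re_opp, im_opp. lra.
Qed.

Lemma continuous_Re {U : UniformSpace} (f : U -> C) (s : U) :
  continuous (U := C_UniformSpace) f s -> continuous (U := R_UniformSpace) (fun x => Re (f x)) s.
Proof.
  intros H. apply (continuous_comp (V := C_UniformSpace) f (fun p : C => Re p)); auto.
  apply (continuous_fst (U := R_UniformSpace) (V := R_UniformSpace)).
Qed.

Lemma continuous_Im {U : UniformSpace} (f : U -> C) (s : U) :
  continuous (U := C_UniformSpace) f s -> continuous (U := R_UniformSpace) (fun x => Im (f x)) s.
Proof.
  intros H. apply (continuous_comp (V := C_UniformSpace) f (fun p : C => Im p)); auto.
  apply (continuous_snd (U := R_UniformSpace) (V := R_UniformSpace)).
Qed.

Lemma continuous_Cplus {U : UniformSpace} (f g : U -> C) (s : U) :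
  continuous (U := C_UniformSpace) f s -> continuous (U := C_UniformSpace) g s ->
  continuous (U := C_UniformSpace) (fun x => f x + g x)%C s.
Proof.
  intros Hf Hg. apply continuous_C_pair.
  - apply (continuous_plus (V := R_NormedModule) (fun x => Re (f x)) (fun x => Re (g x))); now apply continuous_Re.
  - apply (continuous_plus (V := R_NormedModule) (fun x => Im (f x)) (fun x => Im (g x))); now apply continuous_Im.
Qed.

Lemma continuous_Copp {U : UniformSpace} (f : U -> C) (s : U) :
  continuous (U := C_UniformSpace) f s -> continuous (U := C_UniformSpace) (fun x => - f x)%C s.
Proof.
  intros Hf. apply continuous_C_pair.
  - apply (continuous_opp (V := R_NormedModule) (fun x => Re (f x))); now apply continuous_Re.
  - apply (continuous_opp (V := R_NormedModule) (fun x => Im (f x))); now apply continuous_Im.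
Qed.

Lemma continuous_Cminus {U : UniformSpace} (f g : U -> C) (s : U) :
  continuous (U := C_UniformSpace) f s -> continuous (U := C_UniformSpace) g s ->
  continuous (U := C_UniformSpace) (fun x => f x - g x)%C s.
Proof.
  intros Hf Hg. apply (continuous_Cplus f (fun x => - g x)%C); auto. now apply continuous_Copp.
Qed.

Lemma continuous_Cmult {U : UniformSpace} (f g : U -> C) (s : U) :
  continuous (U := C_UniformSpace) f s -> continuous (U := C_UniformSpace) g s ->
  continuous (U := C_UniformSpace) (fun x => f x * g x)%C s.
Proof.
  intros Hf Hg.
  pose proof (continuous_Re _ _ Hf). pose proof (continuous_Im _ _ Hf).
  pose proof (continuous_Re _ _ Hg). pose proof (continuous_Im _ _ Hg).
  apply continuous_C_pair.
  - apply (continuous_minus (V := R_NormedModule) (fun x => Re (f x) * Re (g x)) (fun x => Im (f x) * Im (g x)));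
    now apply (continuous_mult (K := R_AbsRing)).
  - apply (continuous_plus (V := R_NormedModule) (fun x => Re (f x) * Im (g x)) (fun x => Im (f x) * Re (g x)));
    now apply (continuous_mult (K := R_AbsRing)).
Qed.

Lemma ccont_Cinv (s : C) : s <> 0 -> ccont Cinv s.
Proof.
  intros Hs. apply ccont_Cmod. intros eps He.
  assert (Hp : 0 < Cmod s) by now apply Cmod_gt_0.
  (* The first bound keeps |w| above |s| / 2, the second then controls |w - s| / (|w| |s|). *)
  exists (Rmin (Cmod s / 2) (eps * Cmod s ^ 2 / 2)). split.
  { apply Rmin_pos; [lra|]. apply Rdiv_lt_0_compat; [|lra]. apply Rmult_lt_0_compat; auto. now apply pow_lt. }
  intros w Hw.
  assert (H1 := Rlt_le_trans _ _ _ Hw (Rmin_l _ _)).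
  assert (H2 := Rlt_le_trans _ _ _ Hw (Rmin_r _ _)).
  assert (H3 : Cmod s / 2 < Cmod w).
  { pose proof (Cmod_triangle_minus s w) as T. rewrite Cmod_minus_sym in T. lra. }
  assert (Hw0 : w <> 0) by (apply Cmod_gt_0; lra).
  replace (/ w - / s)%C with ((s - w) / (w * s))%C by (field; auto).
  rewrite Cmod_div, Cmod_mult, Cmod_minus_sym by (apply Cmult_neq_0; auto).
  assert (Hws : 0 < Cmod w * Cmod s) by (apply Rmult_lt_0_compat; lra).
  apply (Rmult_lt_reg_r (Cmod w * Cmod s)); auto.
  unfold Rdiv. rewrite Rmult_assoc, Rinv_l, Rmult_1_r by lra.
  assert (eps * (Cmod s / 2 * Cmod s) < eps * (Cmod w * Cmod s)) by (apply Rmult_lt_compat_l; auto; now apply Rmult_lt_compat_r).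
  lra.
Qed.

Lemma continuous_Cinv {U : UniformSpace} (f : U -> C) (s : U) :
  continuous (U := C_UniformSpace) f s -> f s <> 0 ->
  continuous (U := C_UniformSpace) (fun x => / f x)%C s.
Proof.
  intros Hf H. apply (continuous_comp (V := C_UniformSpace) f Cinv); auto. now apply ccont_Cinv.
Qed.

(* Caratheodory's form of the derivative: the product and chain rules become algebra. *)
Definition Cdiff (f : C -> C) (s l : C) : Prop :=
  exists phi, (forall w, f w = f s + phi w * (w - s))%C /\ phi s = l /\ ccont phi s.

Lemma Cdiff_eq (f : C -> C) (s l l' : C) : Cdiff f s l -> l = l' -> Cdiff f s l'.
Proof. now intros H <-. Qed.

Lemma Cdiff_ext (f g : C -> C) (s l : C) : (forall w, f w = g w) -> Cdiff f s l -> Cdiff g s l.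
Proof.
  intros E (phi & H1 & H2 & H3). exists phi. repeat split; auto. intros w; rewrite <- !E; auto.
Qed.

Lemma Cdiff_cont (f : C -> C) (s l : C) : Cdiff f s l -> ccont f s.
Proof.
  intros (phi & H1 & H2 & H3).
  apply (continuous_ext (fun w => f s + phi w * (w - s))%C); [now intros; rewrite <- H1|].
  apply (continuous_Cplus (fun _ => f s)); [apply continuous_const|].
  apply continuous_Cmult; auto.
  apply (continuous_Cminus (fun w => w) (fun _ => s)); [apply continuous_id | apply continuous_const].
Qed.

(** The Caratheodory factor is the difference quotient, completed by [l] at [s]. The product and
    chain rules use the factor; Goursat's estimate and the construction of a primitive use the [eps]
    form. *)
Lemma Cdiff_eps (f : C -> C) (s l : C) :
  Cdiff f s l <->
  forall eps, 0 < eps -> exists d, 0 < d /\ forall w, Cmod (w - s) < d ->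
    Cmod (f w - f s - l * (w - s)) <= eps * Cmod (w - s).
Proof.
  split.
  - intros (phi & H1 & H2 & H3) eps He.
    destruct (proj1 (ccont_Cmod phi s) H3 eps He) as (d & Hd & H).
    exists d; split; auto. intros w Hw. rewrite (H1 w).
    replace (f s + phi w * (w - s) - f s - l * (w - s))%C with ((phi w - l) * (w - s))%C by ring.
    rewrite Cmod_mult. apply Rmult_le_compat_r; [apply Cmod_ge_0|].
    rewrite <- H2. left; auto.
  - intros H. exists (fun w => if Ceq_dec w s then l else (f w - f s) / (w - s))%C.
    split; [|split].
    + intros w. destruct (Ceq_dec w s) as [->|Hn]; [ring|]. field.
      intros E; apply Hn. replace w with (w - s + s)%C by ring. rewrite E; ring.
    + destruct (Ceq_dec s s); congruence.
    + apply ccont_Cmod. intros eps He.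
      destruct (H (eps / 2)) as (d & Hd & H'); [lra|].
      exists d; split; auto. intros w Hw.
      destruct (Ceq_dec s s) as [_|]; [|congruence].
      destruct (Ceq_dec w s) as [->|Hn].
      { replace (l - l)%C with (RtoC 0) by ring. now rewrite Cmod_0. }
      assert (Hn' : (w - s)%C <> 0).
      { intros E; apply Hn. replace w with (w - s + s)%C by ring. rewrite E; ring. }
      replace ((f w - f s) / (w - s) - l)%C with ((f w - f s - l * (w - s)) / (w - s))%C by (field; auto).
      rewrite Cmod_div by auto.
      assert (0 < Cmod (w - s)) by now apply Cmod_gt_0.
      apply (Rmult_lt_reg_r (Cmod (w - s))); auto.
      unfold Rdiv. rewrite Rmult_assoc, Rinv_l, Rmult_1_r by lra.
      specialize (H' w Hw). nra.
Qed.

Lemma Cdiff_const (k s : C) : Cdiff (fun _ => k) s 0.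
Proof.
  exists (fun _ => RtoC 0). split; [intros; ring|]. split; auto. apply continuous_const.
Qed.

Lemma Cdiff_id (s : C) : Cdiff (fun w => w) s 1.
Proof.
  exists (fun _ => RtoC 1). split; [intros; ring|]. split; auto. apply continuous_const.
Qed.

Lemma Cdiff_plus (f g : C -> C) (s l m : C) :
  Cdiff f s l -> Cdiff g s m -> Cdiff (fun w => f w + g w)%C s (l + m).
Proof.
  intros (phi & H1 & H2 & H3) (psi & K1 & K2 & K3).
  exists (fun w => phi w + psi w)%C. split; [|split].
  - intros w. rewrite (H1 w), (K1 w). ring.
  - now rewrite H2, K2.
  - now apply continuous_Cplus.
Qed.

Lemma Cdiff_mult (f g : C -> C) (s l m : C) :
  Cdiff f s l -> Cdiff g s m -> Cdiff (fun w => f w * g w)%C s (l * g s + f s * m).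
Proof.
  intros (phi & H1 & H2 & H3) Hg. pose proof (Cdiff_cont _ _ _ Hg) as Cg.
  destruct Hg as (psi & K1 & K2 & K3).
  exists (fun w => phi w * g w + f s * psi w)%C. split; [|split].
  - intros w. rewrite (H1 w), (K1 w). ring.
  - now rewrite H2, K2.
  - apply continuous_Cplus; apply continuous_Cmult; auto. apply continuous_const.
Qed.

Lemma Cdiff_scal (k : C) (f : C -> C) (s l : C) : Cdiff f s l -> Cdiff (fun w => k * f w)%C s (k * l).
Proof.
  intros H. eapply Cdiff_eq; [apply (Cdiff_mult (fun _ => k) f); [apply Cdiff_const | exact H]|]. ring.
Qed.

Lemma Cdiff_minus (f g : C -> C) (s l m : C) :
  Cdiff f s l -> Cdiff g s m -> Cdiff (fun w => f w - g w)%C s (l - m).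
Proof.
  intros Hf Hg.
  eapply Cdiff_ext; [|eapply Cdiff_eq; [apply (Cdiff_plus _ _ _ _ _ Hf (Cdiff_scal (-(1)) _ _ _ Hg))|]].
  - intros; cbn; ring.
  - ring.
Qed.

Lemma Cdiff_comp (f g : C -> C) (s l m : C) :
  Cdiff f (g s) l -> Cdiff g s m -> Cdiff (fun w => f (g w)) s (l * m).
Proof.
  intros (phi & H1 & H2 & H3) Hg. pose proof (Cdiff_cont _ _ _ Hg) as Cg.
  destruct Hg as (psi & K1 & K2 & K3).
  exists (fun w => phi (g w) * psi w)%C. split; [|split].
  - intros w. rewrite (H1 (g w)). rewrite (K1 w) at 2. ring.
  - now rewrite H2, K2.
  - apply continuous_Cmult; auto. now apply (continuous_comp (V := C_UniformSpace) g phi).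
Qed.

Lemma Cdiff_inv (s : C) : s <> 0 -> Cdiff Cinv s (- / (s * s)).
Proof.
  intros Hs.
  (* The factorization is required at every [w], also at 0, where [Cinv] has a default value; hence
     a separate value there, away from [s]. *)
  exists (fun w => if Ceq_dec w 0 then (/ 0 - / s) / (0 - s) else - / (w * s))%C. split; [|split].
  - intros w. destruct (Ceq_dec w 0) as [->|Hw].
    + replace ((/ 0 - / s) / (0 - s) * (0 - s))%C with (/ 0 - / s)%C; [ring|].
      unfold Cdiv. rewrite <- Cmult_assoc, Cinv_l, Cmult_1_r; auto.
      intros E; apply Hs. replace s with (-(0 - s))%C by ring. rewrite E; ring.
    + field; auto.
  - destruct (Ceq_dec s 0); congruence.
  - apply (continuous_ext_loc (T := C_UniformSpace) (U := C_UniformSpace) _ (fun w : C => - / (w * s))%C).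
    + apply (locally_Cmod s). exists (Cmod s). split; [now apply Cmod_gt_0|].
      intros w Hw. destruct (Ceq_dec w 0) as [->|_]; auto.
      exfalso. replace (0 - s)%C with (- s)%C in Hw by ring. rewrite Cmod_opp in Hw. lra.
    + apply (continuous_Copp (U := C_UniformSpace) (fun w => / (w * s))%C), (continuous_Cinv (U := C_UniformSpace)); [|now apply Cmult_neq_0].
      apply (continuous_Cmult (U := C_UniformSpace)); [apply continuous_id | apply continuous_const].
Qed.

(** * Complex exponential and sine *)

Lemma exp_le_compat (x y : R) : x <= y -> exp x <= exp y.
Proof. intros [H| ->]; [left; now apply exp_increasing | right; reflexivity]. Qed.

(** The inequality [1 + t <= exp t] at [t = - x], multiplied by [exp x]. *)
Lemma exp_le_1_plus (x : R) : exp x - 1 <= x * exp x.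
Proof.
  pose proof (exp_ineq1_le (- x)) as H. pose proof (exp_pos x).
  assert (E : exp x * exp (- x) = 1) by (rewrite <- exp_plus, Rplus_opp_r; apply exp_0).
  nra.
Qed.

Lemma Rabs_exp_minus_1 (x : R) : Rabs (exp x - 1) <= Rabs x * exp (Rabs x).
Proof.
  pose proof (exp_ineq1_le x) as H. pose proof (exp_le_1_plus x) as H1.
  pose proof (exp_ineq1_le (Rabs x)).
  destruct (Rle_dec 0 x) as [Hx|Hx].
  - rewrite !Rabs_pos_eq in *; lra.
  - rewrite Rabs_left1, (Rabs_left1 x) in * by nra. pose proof (exp_pos x). nra.
Qed.

Lemma Rabs_exp_taylor1 (x : R) : Rabs (exp x - 1 - x) <= x ^ 2 * exp (Rabs x).
Proof.
  pose proof (exp_ineq1_le x) as H. pose proof (exp_le_1_plus x) as H1.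
  pose proof (Rabs_exp_minus_1 x) as H2. pose proof (Rabs_pos x).
  rewrite (Rabs_pos_eq (exp x - 1 - x)) by lra.
  apply Rle_trans with (Rabs x * Rabs (exp x - 1)).
  - rewrite <- Rabs_mult. apply Rle_trans with (x * (exp x - 1)); [lra | apply Rle_abs].
  - replace (x ^ 2) with (Rabs x * Rabs x) by (rewrite <- Rabs_mult, Rabs_pos_eq; nra).
    nra.
Qed.

Lemma Rabs_sin_le (x : R) : Rabs (sin x) <= Rabs x.
Proof.
  assert (P : forall y, 0 <= y -> Rabs (sin y) <= y).
  { intros y Hy. destruct (Rle_lt_dec 1 y) as [H|H].
    - pose proof (SIN_bound y). apply Rabs_le; lra.
    - destruct (Req_dec y 0) as [->|Hn]; [rewrite sin_0, Rabs_R0; lra|].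
      pose proof (sin_lt_x y). pose proof PI2_1.
      assert (0 <= sin y) by (apply sin_ge_0; lra).
      rewrite Rabs_pos_eq; lra. }
  destruct (Rle_dec 0 x) as [Hx|Hx].
  - rewrite (Rabs_pos_eq x); auto.
  - rewrite <- (Rabs_Ropp x), <- Rabs_Ropp, <- sin_neg, (Rabs_pos_eq (- x)) by lra. apply P; lra.
Qed.

Lemma one_minus_cos (x : R) : 1 - cos x = 2 * (sin (x / 2)) ^ 2.
Proof. replace x with (2 * (x / 2)) at 1 by field. rewrite cos_2a_sin; ring. Qed.

Lemma Rabs_cos_minus_1 (x : R) : Rabs (cos x - 1) <= x ^ 2 / 2.
Proof.
  rewrite <- Rabs_Ropp. replace (- (cos x - 1)) with (1 - cos x) by ring.
  rewrite one_minus_cos.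
  pose proof (Rabs_sin_le (x / 2)) as H. pose proof (Rabs_pos (sin (x/2))).
  rewrite Rabs_pos_eq by nra.
  rewrite <- (pow2_abs (sin (x / 2))).
  replace (x ^ 2 / 2) with (2 * (Rabs (x / 2)) ^ 2) by (rewrite pow2_abs; field). nra.
Qed.

Lemma Rabs_cos_minus_1' (x : R) : Rabs (cos x - 1) <= Rabs x.
Proof.
  rewrite <- Rabs_Ropp. replace (- (cos x - 1)) with (1 - cos x) by ring.
  rewrite one_minus_cos.
  pose proof (Rabs_sin_le (x / 2)) as H. pose proof (Rabs_pos (sin (x/2))).
  assert (Rabs (sin (x / 2)) <= 1) by (pose proof (SIN_bound (x/2)); apply Rabs_le; lra).
  assert (0 <= (sin (x / 2)) ^ 2) by apply pow2_ge_0.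
  rewrite Rabs_pos_eq by lra.
  rewrite <- (pow2_abs (sin (x / 2))).
  replace (Rabs x) with (2 * (Rabs (x / 2))).
  2:{ unfold Rdiv; rewrite Rabs_mult, (Rabs_pos_eq (/2)); lra. }
  nra.
Qed.

Lemma Rabs_sin_minus_id (x : R) : Rabs (sin x - x) <= x ^ 2.
Proof.
  destruct (MVT_gen (fun t => sin t - t) 0 x (fun t => cos t - 1)) as (c & Hc & E).
  - intros. auto_derive; auto; ring.
  - intros. apply continuity_pt_minus; [apply continuity_sin | apply continuity_pt_id].
  - cbn in E. rewrite sin_0 in E. replace (sin x - x) with ((cos c - 1) * x) by lra.
    rewrite Rabs_mult. pose proof (Rabs_cos_minus_1' c).
    assert (Rabs c <= Rabs x).
    { unfold Rmin, Rmax in Hc. destruct (Rle_dec 0 x).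
      - rewrite !Rabs_pos_eq; lra.
      - rewrite !Rabs_left1; lra. }
    rewrite <- (pow2_abs x). pose proof (Rabs_pos x). nra.
Qed.

(** A crude constant is enough: this bound gives the derivative of [Cexp], the convergence of
    Gauss's product and the behaviour of the sine at its zeros. *)
Lemma Cexp_taylor1 (u : C) : Cmod (Cexp u - 1 - u) <= 2 * Cmod u ^ 2 * exp (Cmod u).
Proof.
  destruct u as [x y].
  (* With u = x + i y: exp u - 1 - u = exp x (exp(i y) - 1 - i y) + (exp x - 1 - x) + i y (exp x -
     1), and each of the three terms is of second order. *)
  assert (E : (Cexp (x, y) - 1 - (x, y) =
    RtoC (exp x) * ((cos y - 1)%R, (sin y - y)%R) + (RtoC (exp x - 1 - x) + (0%R, (y * (exp x - 1))%R)))%C).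
  { unfold Cminus, Cexp, RtoC, Cmult, Cplus, Copp, Re, Im; cbn [fst snd]; f_equal; ring. }
  rewrite E.
  assert (HC : Cmod (x, y) ^ 2 = x ^ 2 + y ^ 2) by (rewrite Cmod2_alt; reflexivity).
  assert (Hx : Rabs x <= Cmod (x, y)) by apply (re_le_Cmod (x, y)).
  pose proof (Rabs_pos x). pose proof (Rabs_pos y).
  assert (H1 : Cmod (cos y - 1, sin y - y) <= 3 / 2 * y ^ 2).
  { eapply Rle_trans; [apply Cmod_le_sum|]. cbn.
    pose proof (Rabs_cos_minus_1 y). pose proof (Rabs_sin_minus_id y). cbn in *. lra. }
  assert (H2 : exp x <= exp (Cmod (x, y))).
  { apply exp_le_compat. pose proof (Rle_abs x); lra. }
  assert (H3 : exp (Rabs x) <= exp (Cmod (x, y))).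
  { now apply exp_le_compat. }
  set (e := exp (Cmod (x, y))) in *.
  assert (He : 0 < e) by apply exp_pos.
  assert (H4 : Cmod (0, y * (exp x - 1)) <= (x ^ 2 + y ^ 2) / 2 * e).
  { eapply Rle_trans; [apply Cmod_le_sum|]. cbn [Re Im fst snd]. rewrite Rabs_R0, Rplus_0_l, Rabs_mult.
    pose proof (Rabs_exp_minus_1 x).
    apply Rle_trans with (Rabs y * Rabs x * e).
    - rewrite Rmult_assoc. apply Rmult_le_compat_l; auto. nra.
    - apply Rmult_le_compat_r; [lra|]. rewrite <- (pow2_abs x), <- (pow2_abs y). pose proof (pow2_ge_0 (Rabs x - Rabs y)); lra. }
  pose proof (Rabs_exp_taylor1 x) as H5.
  eapply Rle_trans; [apply Cmod_triangle|].
  eapply Rle_trans; [apply Rplus_le_compat_l, Cmod_triangle|].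
  rewrite Cmod_mult, !Cmod_R. rewrite (Rabs_pos_eq (exp x)) by (left; apply exp_pos).
  assert (x ^ 2 * exp (Rabs x) <= x ^ 2 * e) by (apply Rmult_le_compat_l; auto; apply pow2_ge_0).
  assert (exp x * Cmod (cos y - 1, sin y - y) <= e * (3 / 2 * y ^ 2)).
  { apply Rmult_le_compat; auto; [left; apply exp_pos | apply Cmod_ge_0]. }
  rewrite HC. pose proof (pow2_ge_0 x). nra.
Qed.

Lemma Cexp_minus_1 (u : C) : Cmod (Cexp u - 1) <= Cmod u * (1 + 2 * Cmod u * exp (Cmod u)).
Proof.
  replace (Cexp u - 1)%C with ((Cexp u - 1 - u) + u)%C by ring.
  eapply Rle_trans; [apply Cmod_triangle|]. pose proof (Cexp_taylor1 u). nra.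
Qed.

Lemma Cdiff_Cexp (s : C) : Cdiff Cexp s (Cexp s).
Proof.
  apply Cdiff_eps. intros eps He.
  set (K := 2 * exp (Re s) * exp 1).
  assert (HK : 0 < K) by (unfold K; pose proof (exp_pos (Re s)); pose proof (exp_pos 1); nra).
  exists (Rmin 1 (eps / K)). split; [apply Rmin_pos; [lra | now apply Rdiv_lt_0_compat]|].
  intros w Hw.
  assert (H1 := Rlt_le_trans _ _ _ Hw (Rmin_l _ _)).
  assert (H2 := Rlt_le_trans _ _ _ Hw (Rmin_r _ _)).
  replace (Cexp w - Cexp s - Cexp s * (w - s))%C with (Cexp s * (Cexp (w - s) - 1 - (w - s)))%C.
  2:{ replace w with (s + (w - s))%C at 3 by ring. rewrite Cexp_plus. ring. }
  rewrite Cmod_mult, Cmod_Cexp.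
  pose proof (Cexp_taylor1 (w - s)) as T. pose proof (Cmod_ge_0 (w - s)) as P.
  set (m := Cmod (w - s)) in *.
  assert (exp m <= exp 1) by (apply exp_le_compat; lra).
  pose proof (exp_pos (Re s)).
  apply Rle_trans with (exp (Re s) * (2 * m ^ 2 * exp 1)).
  { apply Rmult_le_compat_l; [lra|]. eapply Rle_trans; [exact T|]. apply Rmult_le_compat_l; auto. nra. }
  replace (exp (Re s) * (2 * m ^ 2 * exp 1)) with (K * m * m) by (unfold K; ring).
  apply Rmult_le_compat_r; auto.
  apply Rmult_lt_compat_l with (r := K) in H2; auto.
  replace (K * (eps / K)) with eps in H2 by (field; lra). lra.
Qed.

Definition Csin (s : C) : C := (- Ci / 2 * (Cexp (Ci * s) - Cexp (- (Ci * s))))%C.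
Definition Ccos (s : C) : C := (/ 2 * (Cexp (Ci * s) + Cexp (- (Ci * s))))%C.

Lemma Cdiff_exp_lin (k s : C) : Cdiff (fun w => Cexp (k * w)) s (k * Cexp (k * s)).
Proof.
  eapply Cdiff_eq.
  - apply (Cdiff_comp Cexp (fun w => k * w)%C); [apply Cdiff_Cexp | apply Cdiff_scal, Cdiff_id].
  - ring.
Qed.

Lemma C2_neq0 : RtoC 2 <> 0.
Proof. apply RtoC_neq0; lra. Qed.

Lemma Ci2 : (Ci * Ci)%C = (- (1))%C.
Proof. unfold Ci, Cmult, Copp, RtoC; cbn; f_equal; ring. Qed.

Lemma Cdiff_Csin (s : C) : Cdiff Csin s (Ccos s).
Proof.
  eapply Cdiff_ext; [|eapply Cdiff_eq].
  2: apply (Cdiff_scal (- Ci / 2)), (Cdiff_minus _ _ _ _ _ (Cdiff_exp_lin Ci s) (Cdiff_exp_lin (- Ci) s)).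
  - intros w; unfold Csin; cbn. replace (- Ci * w)%C with (- (Ci * w))%C by ring. reflexivity.
  - unfold Ccos. replace (- Ci * s)%C with (- (Ci * s))%C by ring.
    replace (- Ci / 2 * (Ci * Cexp (Ci * s) - - Ci * Cexp (- (Ci * s))))%C
      with (- (Ci * Ci) * / 2 * (Cexp (Ci * s) + Cexp (- (Ci * s))))%C by (field; apply C2_neq0).
    rewrite Ci2; ring.
Qed.

Lemma Cdiff_Ccos (s : C) : Cdiff Ccos s (- Csin s).
Proof.
  eapply Cdiff_ext; [|eapply Cdiff_eq].
  2: apply (Cdiff_scal (/ 2)), (Cdiff_plus _ _ _ _ _ (Cdiff_exp_lin Ci s) (Cdiff_exp_lin (- Ci) s)).
  - intros w; unfold Ccos; cbn. replace (- Ci * w)%C with (- (Ci * w))%C by ring. reflexivity.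
  - unfold Csin. replace (- Ci * s)%C with (- (Ci * s))%C by ring. field; apply C2_neq0.
Qed.

Lemma Csin_xy (x y : R) : Csin (x, y) = (sin x * cosh y, cos x * sinh y).
Proof.
  unfold Csin, Cexp, Ci, cosh, sinh, Cdiv. rewrite <- RtoC_inv by lra.
  unfold Cmult, Cminus, Cplus, Copp, RtoC. cbn.
  replace (0 * x - 1 * y) with (- y) by ring. replace (0 * y + 1 * x) with x by ring.
  rewrite Ropp_involutive, cos_neg, sin_neg. f_equal; field.
Qed.

Lemma Ccos_xy (x y : R) : Ccos (x, y) = (cos x * cosh y, - (sin x * sinh y)).
Proof.
  unfold Ccos, Cexp, Ci, cosh, sinh. rewrite <- RtoC_inv by lra.
  unfold Cmult, Cplus, Copp, RtoC. cbn.
  replace (0 * x - 1 * y) with (- y) by ring. replace (0 * y + 1 * x) with x by ring.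
  rewrite Ropp_involutive, cos_neg, sin_neg. f_equal; field.
Qed.

Lemma Csin_real (x : R) : Csin x = sin x.
Proof.
  unfold RtoC at 1. rewrite Csin_xy, sinh_0, cosh_0, Rmult_1_r, Rmult_0_r. reflexivity.
Qed.

Lemma Ccos_real (x : R) : Ccos x = cos x.
Proof.
  unfold RtoC at 1. rewrite Ccos_xy, sinh_0, cosh_0, Rmult_1_r, Rmult_0_r, Ropp_0. reflexivity.
Qed.

(** Source of the global facts on the sine: its zeros are real, sinh bounds it below away from the
    axis, and sin^2 bounds it below on vertical lines at half-integers. *)
Lemma Cmod2_Csin (x y : R) : Cmod (Csin (x, y)) ^ 2 = (sin x) ^ 2 + (sinh y) ^ 2.
Proof.
  rewrite Cmod2_alt, Csin_xy. cbn [Re Im fst snd].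
  pose proof (sin2_cos2 x) as E1. unfold Rsqr in E1.
  assert (E2 : cosh y * cosh y - sinh y * sinh y = 1).
  { unfold cosh, sinh. assert (exp y * exp (- y) = 1) by (rewrite <- exp_plus, Rplus_opp_r; apply exp_0).
    nra. }
  replace ((sin x * cosh y) ^ 2) with (sin x * sin x * (cosh y * cosh y)) by ring.
  replace (cosh y * cosh y) with (1 + sinh y * sinh y) by lra.
  replace ((cos x * sinh y) ^ 2) with (cos x * cos x * (sinh y * sinh y)) by ring.
  replace (cos x * cos x) with (1 - sin x * sin x) by lra. ring.
Qed.

Lemma Csin_neq0_im (x y : R) : y <> 0 -> Csin (x, y) <> 0.
Proof.
  intros Hy E. pose proof (Cmod2_Csin x y) as H. rewrite E, Cmod_0 in H.
  assert (sinh y <> 0).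
  { intros E'. apply Hy. unfold sinh in E'.
    assert (exp y = exp (- y)) as F by lra. apply exp_inv in F. lra. }
  pose proof (pow2_ge_0 (sin x)). assert (0 < sinh y ^ 2) by (apply pow2_gt_0; auto). cbn in H; nra.
Qed.

Lemma Csin_PI_shift (n : nat) (s : C) : Csin (s + INR n * PI) = ((- (1)) ^ n * Csin s)%C.
Proof.
  induction n as [|n IH].
  - cbn. replace (s + 0 * PI)%C with s by ring. ring.
  - rewrite S_INR, RtoC_plus.
    assert (A : forall s : C, Csin (s + PI) = (- Csin s)%C).
    { intros [x y]. replace ((x, y) + PI)%C with (x + PI, y) by (unfold Cplus, RtoC; cbn; f_equal; ring).
      rewrite !Csin_xy, neg_sin, neg_cos. unfold Copp; cbn; f_equal; ring. }
    replace (s + (INR n + 1) * PI)%C with ((s + INR n * PI) + PI)%C by ring.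
    rewrite A, IH, Cpow_S. ring.
Qed.

(** * Integrals of complex-valued functions *)

Local Notation CInt := (RInt (V := C_R_CompleteNormedModule)) (only parsing).
Local Notation is_CInt := (is_RInt (V := C_R_NormedModule)) (only parsing).
Local Notation ex_CInt := (ex_RInt (V := C_R_NormedModule)) (only parsing).
Local Notation ccurve := (continuous (T := R_UniformSpace) (U := C_UniformSpace)) (only parsing).

Lemma is_CInt_minus (f g : R -> C) (a b : R) (l m : C) :
  is_CInt f a b l -> is_CInt g a b m -> is_CInt (fun t => f t - g t)%C a b (l - m)%C.
Proof. apply (is_RInt_minus (V := C_R_NormedModule)). Qed.

Lemma is_CInt_pair (f : R -> C) (a b x y : R) :
  is_RInt (fun t => Re (f t)) a b x -> is_RInt (fun t => Im (f t)) a b y -> is_CInt f a b (x, y).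
Proof. apply (is_RInt_fct_extend_pair (U := R_NormedModule) (V := R_NormedModule)). Qed.

Lemma is_CInt_Re (f : R -> C) (a b : R) (l : C) : is_CInt f a b l -> is_RInt (fun t => Re (f t)) a b (Re l).
Proof. apply (is_RInt_fct_extend_fst (U := R_NormedModule) (V := R_NormedModule)). Qed.

Lemma is_CInt_Im (f : R -> C) (a b : R) (l : C) : is_CInt f a b l -> is_RInt (fun t => Im (f t)) a b (Im l).
Proof. apply (is_RInt_fct_extend_snd (U := R_NormedModule) (V := R_NormedModule)). Qed.

(** [C_R_NormedModule] is a module over the reals only, so a complex factor has to be distributed
    over real and imaginary parts. *)
Lemma is_CInt_scal (k : C) (f : R -> C) (a b : R) (l : C) :
  is_CInt f a b l -> is_CInt (fun t => k * f t)%C a b (k * l)%C.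
Proof.
  intros H. pose proof (is_CInt_Re _ _ _ _ H) as H1. pose proof (is_CInt_Im _ _ _ _ H) as H2.
  apply is_CInt_pair.
  - apply (is_RInt_minus (V := R_NormedModule) (fun t => Re k * Re (f t)) (fun t => Im k * Im (f t)));
    now apply (is_RInt_scal (V := R_NormedModule)).
  - apply (is_RInt_plus (V := R_NormedModule) (fun t => Re k * Im (f t)) (fun t => Im k * Re (f t)));
    now apply (is_RInt_scal (V := R_NormedModule)).
Qed.

Lemma ex_CInt_cont (f : R -> C) (a b : R) :
  (forall t, Rmin a b <= t <= Rmax a b -> ccurve f t) -> ex_CInt f a b.
Proof. apply (ex_RInt_continuous (V := C_R_CompleteNormedModule)). Qed.

Lemma CInt_correct (f : R -> C) (a b : R) : ex_CInt f a b -> is_CInt f a b (CInt f a b).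
Proof. apply (RInt_correct (V := C_R_CompleteNormedModule)). Qed.

Lemma CInt_unique (f : R -> C) (a b : R) (l : C) : is_CInt f a b l -> CInt f a b = l.
Proof. apply (is_RInt_unique (V := C_R_CompleteNormedModule)). Qed.

Lemma CInt_Chasles (f : R -> C) (a b c : R) :
  ex_CInt f a b -> ex_CInt f b c -> (CInt f a b + CInt f b c)%C = CInt f a c.
Proof. apply (RInt_Chasles (V := C_R_CompleteNormedModule)). Qed.

Lemma is_CInt_bound (f : R -> C) (a b B : R) (l : C) :
  is_CInt f a b l -> (forall t, Rmin a b <= t <= Rmax a b -> Cmod (f t) <= B) ->
  Cmod l <= Rabs (b - a) * B.
Proof.
  intros Hl HB.
  assert (P : forall a b l, a <= b -> is_CInt f a b l ->
    (forall t, a <= t <= b -> Cmod (f t) <= B) -> Cmod l <= (b - a) * B).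
  { clear. intros a b l Hab Hl HB. rewrite Cmod_norm.
    apply (norm_RInt_le_const (V := C_R_NormedModule) f a b l B); auto.
    intros x Hx. specialize (HB x Hx). rewrite Cmod_norm in HB. exact HB. }
  destruct (Rle_dec a b) as [H|H].
  - rewrite Rmin_left, Rmax_right in HB by lra. rewrite Rabs_pos_eq by lra. now apply P.
  - rewrite Rmin_right, Rmax_left in HB by lra. rewrite Rabs_left1 by lra.
    replace (- (b - a)) with (a - b) by ring. rewrite <- Cmod_opp.
    apply P; [lra | | auto]. apply (is_RInt_swap (V := C_R_NormedModule)) in Hl. exact Hl.
Qed.

(** Chain rule between a derivative over the reals and one over the complex numbers. The
    Caratheodory factor gives G(p u) - G(p t) = phi(p u) (p u - p t) exactly. *)
Lemma is_derive_path (G : C -> C) (p : R -> C) (t : R) (l p' : C) :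
  is_derive (K := R_AbsRing) (V := C_R_NormedModule) p t p' -> Cdiff G (p t) l ->
  is_derive (K := R_AbsRing) (V := C_R_NormedModule) (fun t => G (p t)) t (l * p')%C.
Proof.
  intros Hp HG.
  assert (Cp : ccurve p t).
  { apply (ex_derive_continuous (V := C_R_NormedModule)). now exists p'. }
  destruct HG as (phi & H1 & H2 & H3).
  assert (Cphi : ccurve (fun t => phi (p t)) t) by now apply (continuous_comp (V := C_UniformSpace) p phi).
  split; [apply is_linear_scal_l|].
  intros x Hx. apply (is_filter_lim_locally_unique (V := AbsRing_NormedModule R_AbsRing) t x) in Hx. subst x. intros eps.
  destruct Hp as [_ Hp].
  set (L := Cmod l + 1). set (Q := Cmod p' + 1).
  pose proof (Cmod_ge_0 l). pose proof (Cmod_ge_0 p').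
  assert (HL : 0 < L) by (unfold L; lra). assert (HQ : 0 < Q) by (unfold Q; lra).
  assert (He1 : 0 < eps / 2 / L) by (destruct eps; cbn; repeat apply Rdiv_lt_0_compat; lra).
  assert (He2 : 0 < eps / 2 / Q) by (destruct eps; cbn; repeat apply Rdiv_lt_0_compat; lra).
  specialize (Hp t (fun P HP => HP) (mkposreal _ He1)).
  pose proof (proj1 (filterlim_Cmod (F := locally t) (fun t => phi (p t)) _) Cphi _ He2) as K2.
  pose proof (proj1 (filterlim_Cmod (F := locally t) (fun t => phi (p t)) _) Cphi _ Rlt_0_1) as K3.
  generalize (filter_and _ _ Hp (filter_and _ _ K2 K3)). apply filter_imp.
  intros u (A & B & D). rewrite H2 in B, D. cbn [pos] in A.
  assert (A' : Cmod (p u - p t - RtoC (u - t) * p') <= eps / 2 / L * Rabs (u - t)).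
  { rewrite <- scal_R_Cmult, Cmod_norm. exact A. }
  clear A; rename A' into A.
  cut (Cmod (G (p u) - G (p t) - RtoC (u - t) * (l * p')) <= eps * Rabs (u - t)).
  { rewrite <- scal_R_Cmult, Cmod_norm. intros X; exact X. }
  (* The error is that of the path times a bounded factor, plus the tangent increment times
     [phi (p u) - l], which tends to 0. *)
  replace (G (p u) - G (p t) - RtoC (u - t) * (l * p'))%C with
    (phi (p u) * (p u - p t - RtoC (u - t) * p') + (phi (p u) - l) * (RtoC (u - t) * p'))%C
    by (rewrite (H1 (p u)); ring).
  eapply Rle_trans; [apply Cmod_triangle|]. rewrite !Cmod_mult, Cmod_R.
  assert (Cmod (phi (p u)) <= L).
  { pose proof (Cmod_triangle_minus (phi (p u)) l). unfold L; lra. }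
  pose proof (Rabs_pos (u - t)).
  assert (X1 : Cmod (phi (p u)) * Cmod (p u - p t - RtoC (u - t) * p') <= L * (eps / 2 / L * Rabs (u - t)))
    by (apply Rmult_le_compat; auto; apply Cmod_ge_0).
  assert (X2 : Cmod (phi (p u) - l) * (Rabs (u - t) * Cmod p') <= eps / 2 / Q * (Rabs (u - t) * Q)).
  { apply Rmult_le_compat; [apply Cmod_ge_0 | nra | lra | apply Rmult_le_compat_l; auto; unfold Q; lra]. }
  replace (L * (eps / 2 / L * Rabs (u - t))) with (eps / 2 * Rabs (u - t)) in X1 by (field; lra).
  replace (eps / 2 / Q * (Rabs (u - t) * Q)) with (eps / 2 * Rabs (u - t)) in X2 by (field; lra).
  lra.
Qed.

Lemma CInt_FTC (F f : R -> C) (a b : R) :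
  (forall t, Rmin a b <= t <= Rmax a b -> is_derive (K := R_AbsRing) (V := C_R_NormedModule) F t (f t)) ->
  (forall t, Rmin a b <= t <= Rmax a b -> ccurve f t) ->
  is_CInt f a b (F b - F a)%C.
Proof. apply (is_RInt_derive (V := C_R_CompleteNormedModule)). Qed.

Lemma is_derive_horizontal (x y : R) :
  is_derive (K := R_AbsRing) (V := C_R_NormedModule) (fun t => (t, y) : C) x (RtoC 1).
Proof.
  apply (filterdiff_ext_lin _ (fun t : R => (t * 1, t * 0))).
  - apply (filterdiff_comp_2 (V := R_NormedModule)
      (W := C_R_NormedModule) (fun t : R => t) (fun _ : R => y) (fun u v : R => ((u, v) : C))
      (fun t => t * 1) (fun t => t * 0) (fun u v : R => (u, v) : C)).
    + apply (is_derive_id (K := R_AbsRing)).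
    + apply (is_derive_const (K := R_AbsRing) (V := R_NormedModule)).
    + apply (filterdiff_ext (fun t : R * R => t)); [now intros []|].
      apply (filterdiff_ext_lin _ (fun t : R * R => t)); [|now intros []]. apply filterdiff_id.
  - intros t. unfold scal; cbn; unfold prod_scal, scal; cbn. unfold mult; cbn. f_equal; ring.
Qed.

(** * Rectangle integrals *)

Lemma is_derive_vertical (x y : R) :
  is_derive (K := R_AbsRing) (V := C_R_NormedModule) (fun t => (x, t) : C) y Ci.
Proof.
  (* A vertical segment is i times a horizontal one. *)
  assert (E : forall t, (Ci * ((t, (- x)%R) : C))%C = (x, t)).
  { intros t. unfold Cmult, Ci; cbn. f_equal; ring. }
  apply (is_derive_ext (K := R_AbsRing) (V := C_R_NormedModule) (fun t => Ci * ((t, (- x)%R) : C))%C _ _ _ E).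
  assert (D : is_derive (K := R_AbsRing) (V := C_R_NormedModule)
    (fun t => Ci * ((t, (- x)%R) : C))%C y (Ci * 1)%C).
  { apply (is_derive_path (fun w => Ci * w)%C (fun t => (t, (- x)%R))).
    - apply is_derive_horizontal.
    - eapply Cdiff_eq; [apply Cdiff_scal, Cdiff_id|]. ring. }
  rewrite Cmult_1_r in D. exact D.
Qed.

Lemma ccurve_horizontal (f : C -> C) (x y : R) : ccont f (x, y) -> ccurve (fun t => f (t, y)) x.
Proof.
  intros H. apply (continuous_comp (V := C_UniformSpace) (fun t : R => (t, y) : C) f); auto.
  apply (ex_derive_continuous (V := C_R_NormedModule)). exists (RtoC 1). apply is_derive_horizontal.
Qed.

Lemma ccurve_vertical (f : C -> C) (x y : R) : ccont f (x, y) -> ccurve (fun t => f (x, t)) y.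
Proof.
  intros H. apply (continuous_comp (V := C_UniformSpace) (fun t : R => (x, t) : C) f); auto.
  apply (ex_derive_continuous (V := C_R_NormedModule)). exists Ci. apply is_derive_vertical.
Qed.

Definition hint (f : C -> C) (y a b : R) : C := CInt (fun x => f (x, y)) a b.
Definition vint (f : C -> C) (x c d : R) : C := (Ci * CInt (fun y => f (x, y)) c d)%C.
Definition ex_hint (f : C -> C) (y a b : R) : Prop := ex_CInt (fun x => f (x, y)) a b.
Definition ex_vint (f : C -> C) (x c d : R) : Prop := ex_CInt (fun y => f (x, y)) c d.

(** The boundary is run counterclockwise when a <= b and c <= d; reversed bounds are allowed and
    only change the sign. *)
Definition rect (f : C -> C) (a b c d : R) : C :=
  (hint f c a b - hint f d a b + (vint f b c d - vint f a c d))%C.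

Definition ex_rect (f : C -> C) (a b c d : R) : Prop :=
  ex_hint f c a b /\ ex_hint f d a b /\ ex_vint f a c d /\ ex_vint f b c d.

Lemma ex_hint_cont (f : C -> C) (y a b : R) :
  (forall x, Rmin a b <= x <= Rmax a b -> ccont f (x, y)) -> ex_hint f y a b.
Proof. intros H. apply ex_CInt_cont. intros t Ht. apply ccurve_horizontal; auto. Qed.

Lemma ex_vint_cont (f : C -> C) (x c d : R) :
  (forall y, Rmin c d <= y <= Rmax c d -> ccont f (x, y)) -> ex_vint f x c d.
Proof. intros H. apply ex_CInt_cont. intros t Ht. apply ccurve_vertical; auto. Qed.

Lemma hint_bound (f : C -> C) (y a b B : R) :
  ex_hint f y a b -> (forall x, Rmin a b <= x <= Rmax a b -> Cmod (f (x, y)) <= B) ->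
  Cmod (hint f y a b) <= Rabs (b - a) * B.
Proof. intros H HB. eapply is_CInt_bound; [now apply CInt_correct | exact HB]. Qed.

Lemma vint_bound (f : C -> C) (x c d B : R) :
  ex_vint f x c d -> (forall y, Rmin c d <= y <= Rmax c d -> Cmod (f (x, y)) <= B) ->
  Cmod (vint f x c d) <= Rabs (d - c) * B.
Proof.
  intros H HB. unfold vint. rewrite Cmod_mult, Cmod_Ci, Rmult_1_l.
  eapply is_CInt_bound; [now apply CInt_correct | exact HB].
Qed.

Lemma hint_Chasles (f : C -> C) (y a b c : R) :
  ex_hint f y a b -> ex_hint f y b c -> hint f y a c = (hint f y a b + hint f y b c)%C.
Proof. intros. symmetry. now apply CInt_Chasles. Qed.

Lemma vint_Chasles (f : C -> C) (x a b c : R) :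
  ex_vint f x a b -> ex_vint f x b c -> vint f x a c = (vint f x a b + vint f x b c)%C.
Proof.
  intros. unfold vint. rewrite <- (CInt_Chasles (fun y => f (x, y)) a b c); auto. ring.
Qed.

Lemma hint_minus (f g : C -> C) (y a b : R) : ex_hint f y a b -> ex_hint g y a b ->
  hint (fun s => f s - g s)%C y a b = (hint f y a b - hint g y a b)%C.
Proof. intros. apply CInt_unique, is_CInt_minus; now apply CInt_correct. Qed.

Lemma vint_minus (f g : C -> C) (y a b : R) : ex_vint f y a b -> ex_vint g y a b ->
  vint (fun s => f s - g s)%C y a b = (vint f y a b - vint g y a b)%C.
Proof.
  intros. unfold vint.
  rewrite (CInt_unique _ _ _ (CInt (fun t => f (y, t)) a b - CInt (fun t => g (y, t)) a b)%C); [ring|].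
  apply is_CInt_minus; now apply CInt_correct.
Qed.

Lemma rect_minus (f g : C -> C) (a b c d : R) : ex_rect f a b c d -> ex_rect g a b c d ->
  rect (fun s => f s - g s)%C a b c d = (rect f a b c d - rect g a b c d)%C.
Proof.
  intros (F1 & F2 & F3 & F4) (G1 & G2 & G3 & G4). unfold rect.
  rewrite !hint_minus, !vint_minus by auto. ring.
Qed.

Lemma rect_split_x (f : C -> C) (a m b c d : R) : a <= m <= b ->
  ex_hint f c a b -> ex_hint f d a b -> rect f a b c d = (rect f a m c d + rect f m b c d)%C.
Proof.
  intros Hm H1 H2. unfold rect.
  rewrite (hint_Chasles f c a m b), (hint_Chasles f d a m b); [ring| | | |].
  1,3: now apply (ex_RInt_Chasles_1 (V := C_R_CompleteNormedModule) _ a m b).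
  1,2: now apply (ex_RInt_Chasles_2 (V := C_R_CompleteNormedModule) _ a m b).
Qed.

Lemma rect_split_y (f : C -> C) (a b c m d : R) : c <= m <= d ->
  ex_vint f a c d -> ex_vint f b c d -> rect f a b c d = (rect f a b c m + rect f a b m d)%C.
Proof.
  intros Hm H1 H2. unfold rect.
  rewrite (vint_Chasles f a c m d), (vint_Chasles f b c m d); [ring| | | |].
  1,3: now apply (ex_RInt_Chasles_1 (V := C_R_CompleteNormedModule) _ c m d).
  1,2: now apply (ex_RInt_Chasles_2 (V := C_R_CompleteNormedModule) _ c m d).
Qed.

Lemma rect_bound (f : C -> C) (a b c d B : R) : a <= b -> c <= d -> ex_rect f a b c d ->
  (forall x y, a <= x <= b -> c <= y <= d -> (x = a \/ x = b \/ y = c \/ y = d) -> Cmod (f (x, y)) <= B) ->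
  Cmod (rect f a b c d) <= 2 * B * ((b - a) + (d - c)).
Proof.
  intros Hab Hcd (H1 & H2 & H3 & H4) HB. unfold rect.
  assert (K1 : Cmod (hint f c a b) <= Rabs (b - a) * B).
  { apply hint_bound; auto. rewrite Rmin_left, Rmax_right by auto. intros; apply HB; auto; lra. }
  assert (K2 : Cmod (hint f d a b) <= Rabs (b - a) * B).
  { apply hint_bound; auto. rewrite Rmin_left, Rmax_right by auto. intros; apply HB; auto; lra. }
  assert (K3 : Cmod (vint f a c d) <= Rabs (d - c) * B).
  { apply vint_bound; auto. rewrite Rmin_left, Rmax_right by auto. intros; apply HB; auto; lra. }
  assert (K4 : Cmod (vint f b c d) <= Rabs (d - c) * B).
  { apply vint_bound; auto. rewrite Rmin_left, Rmax_right by auto. intros; apply HB; auto; lra. }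
  rewrite Rabs_pos_eq in K1, K2, K3, K4 by lra.
  eapply Rle_trans; [apply Cmod_triangle|]. unfold Cminus.
  pose proof (Cmod_triangle (hint f c a b) (- hint f d a b)).
  pose proof (Cmod_triangle (vint f b c d) (- vint f a c d)).
  rewrite Cmod_opp in *. lra.
Qed.

Lemma ex_rect_cont (f : C -> C) (a b c d : R) : a <= b -> c <= d ->
  (forall x y, a <= x <= b -> c <= y <= d -> (x = a \/ x = b \/ y = c \/ y = d) -> ccont f (x, y)) ->
  ex_rect f a b c d.
Proof.
  intros Hab Hcd H. repeat split.
  1,2: apply ex_hint_cont; rewrite Rmin_left, Rmax_right by auto; intros; apply H; auto; lra.
  1,2: apply ex_vint_cont; rewrite Rmin_left, Rmax_right by auto; intros; apply H; auto; lra.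
Qed.

Lemma hint_FTC (F f : C -> C) (y a b : R) :
  (forall x, Rmin a b <= x <= Rmax a b -> Cdiff F (x, y) (f (x, y)) /\ ccont f (x, y)) ->
  hint f y a b = (F (b, y) - F (a, y))%C.
Proof.
  intros H. apply CInt_unique, (CInt_FTC (fun x => F (x, y))).
  - intros t Ht. replace (f (t, y)) with (f (t, y) * 1)%C by ring.
    apply (is_derive_path F (fun x => (x, y))); [apply is_derive_horizontal | now apply H].
  - intros t Ht. now apply ccurve_horizontal, H.
Qed.

Lemma vint_FTC (F f : C -> C) (x c d : R) :
  (forall y, Rmin c d <= y <= Rmax c d -> Cdiff F (x, y) (f (x, y)) /\ ccont f (x, y)) ->
  vint f x c d = (F (x, d) - F (x, c))%C.
Proof.
  intros H. unfold vint.
  rewrite (CInt_unique _ _ _ (- Ci * F (x, d) - - Ci * F (x, c))%C).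
  { replace (Ci * (- Ci * F (x, d) - - Ci * F (x, c)))%C with (- (Ci * Ci) * (F (x, d) - F (x, c)))%C by ring.
    rewrite Ci2. ring. }
  apply (CInt_FTC (fun y => - Ci * F (x, y))%C).
  - intros t Ht. replace (f (x, t)) with (- Ci * f (x, t) * Ci)%C.
    2:{ replace (- Ci * f (x, t) * Ci)%C with (- (Ci * Ci) * f (x, t))%C by ring. rewrite Ci2; ring. }
    apply (is_derive_path (fun w => - Ci * F w)%C (fun y => (x, y))); [apply is_derive_vertical|].
    now apply Cdiff_scal, H.
  - intros t Ht. now apply ccurve_vertical, H.
Qed.

Lemma rect_primitive (F f : C -> C) (a b c d : R) : a <= b -> c <= d ->
  (forall s, Cdiff F s (f s)) -> (forall s, ccont f s) -> rect f a b c d = 0.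
Proof.
  intros Hab Hcd HF Hf. unfold rect.
  rewrite !(hint_FTC F f), !(vint_FTC F f) by auto. ring.
Qed.

(** Compactness in the form of Cousin's lemma: if [P] failed, it would fail on one quarter after
    another, and these shrink to a point where the local hypothesis contradicts it. It serves both
    Goursat's theorem and the boundedness of continuous functions. *)
Lemma bisection_2d (P : R -> R -> R -> R -> Prop) (a b c d : R) : a <= b -> c <= d ->
  (forall x1 x2 y1 y2, a <= x1 -> x1 <= x2 -> x2 <= b -> c <= y1 -> y1 <= y2 -> y2 <= d ->
    P x1 ((x1 + x2) / 2) y1 ((y1 + y2) / 2) -> P ((x1 + x2) / 2) x2 y1 ((y1 + y2) / 2) ->
    P x1 ((x1 + x2) / 2) ((y1 + y2) / 2) y2 -> P ((x1 + x2) / 2) x2 ((y1 + y2) / 2) y2 ->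
    P x1 x2 y1 y2) ->
  (forall u v, a <= u <= b -> c <= v <= d -> exists delta, 0 < delta /\
    forall x1 x2 y1 y2, a <= x1 -> x1 <= u <= x2 -> x2 <= b -> c <= y1 -> y1 <= v <= y2 -> y2 <= d ->
      x2 - x1 < delta -> y2 - y1 < delta -> P x1 x2 y1 y2) ->
  P a b c d.
Proof.
  intros Hab Hcd Hsplit Hloc. apply NNPP. intros Hbad.
  (* [next] selects a quarter on which [P] fails; the fourth is taken without a test, because
     [Hsplit] forces [P] to fail there once it holds on the other three. *)
  set (next := fun q : R * R * (R * R) =>
    let '((x1, x2), (y1, y2)) := q in
    let mx := (x1 + x2) / 2 in let my := (y1 + y2) / 2 in
    if excluded_middle_informative (P x1 mx y1 my) then
    if excluded_middle_informative (P mx x2 y1 my) then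
    if excluded_middle_informative (P x1 mx my y2) then ((mx, x2), (my, y2))
    else ((x1, mx), (my, y2)) else ((mx, x2), (y1, my)) else ((x1, mx), (y1, my))).
  set (q := fix q n := match n with O => ((a, b), (c, d)) | S n => next (q n) end).
  set (good := fun (n : nat) (q : R * R * (R * R)) => let '((x1, x2), (y1, y2)) := q in
    a <= x1 /\ x1 <= x2 /\ x2 <= b /\ c <= y1 /\ y1 <= y2 /\ y2 <= d /\
    x2 - x1 = (b - a) * (/ 2) ^ n /\ y2 - y1 = (d - c) * (/ 2) ^ n /\ ~ P x1 x2 y1 y2).
  assert (Hq : forall n, good n (q n)).
  { induction n as [|n IH]; [cbn; repeat split; auto; lra|].
    cbn [q]. destruct (q n) as [[x1 x2] [y1 y2]].
    destruct IH as (I1 & I2 & I3 & I4 & I5 & I6 & I7 & I8 & I9). cbn [next].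
    repeat destruct excluded_middle_informative; cbn [good pow]; repeat split; auto; lra || (intros ?; apply I9; apply Hsplit; auto). }
  assert (Hmono : forall n, fst (fst (q n)) <= fst (fst (q (S n))) /\ fst (snd (q n)) <= fst (snd (q (S n))) /\
    snd (fst (q (S n))) <= snd (fst (q n)) /\ snd (snd (q (S n))) <= snd (snd (q n))).
  { intros n. pose proof (Hq n) as G. change (q (S n)) with (next (q n)). destruct (q n) as [[x1 x2] [y1 y2]].
    destruct G as (I1 & I2 & I3 & I4 & I5 & I6 & _). cbn [next].
    repeat destruct excluded_middle_informative; cbn; lra. }
  assert (Hgood : forall n, a <= fst (fst (q n)) /\ fst (fst (q n)) <= snd (fst (q n)) /\ snd (fst (q n)) <= b /\
    c <= fst (snd (q n)) /\ fst (snd (q n)) <= snd (snd (q n)) /\ snd (snd (q n)) <= d).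
  { intros n. pose proof (Hq n) as G. destruct (q n) as [[x1 x2] [y1 y2]]. cbn in *. tauto. }
  assert (Hnest : forall (l r : nat -> R), (forall n, l n <= l (S n)) -> (forall n, r (S n) <= r n) ->
    (forall n, l n <= r n) -> exists u, forall n, l n <= u <= r n).
  { clear. intros l r Hl Hr Hlr.
    assert (Hl' : forall n k, l n <= l (n + k)%nat).
    { intros n k; induction k; [rewrite Nat.add_0_r; lra | rewrite Nat.add_succ_r; eapply Rle_trans; eauto]. }
    assert (Hr' : forall n k, r (n + k)%nat <= r n).
    { intros n k; induction k; [rewrite Nat.add_0_r; lra | rewrite Nat.add_succ_r; eapply Rle_trans; eauto]. }
    assert (Hlr' : forall n m, l n <= r m).
    { intros n m. apply Rle_trans with (l (n + m)%nat); auto. apply Rle_trans with (r (n + m)%nat); auto.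
      rewrite Nat.add_comm; auto. }
    destruct (completeness (fun x => exists n, x = l n)) as [u [U1 U2]].
    - exists (r O). intros x [n ->]; auto.
    - exists (l O), O; auto.
    - exists u. intros n; split; [apply U1; eauto|]. apply U2. intros x [m ->]; auto. }
  destruct (Hnest (fun n => fst (fst (q n))) (fun n => snd (fst (q n)))) as [u Hu]; try (intros n; apply Hmono || apply Hgood).
  destruct (Hnest (fun n => fst (snd (q n))) (fun n => snd (snd (q n)))) as [v Hv]; try (intros n; apply Hmono || apply Hgood).
  destruct (Hloc u v) as (delta & Hd & H).
  { pose proof (Hu O); cbn in *; lra. }
  { pose proof (Hv O); cbn in *; lra. }
  (* Both sides at stage N are at most the sum of the initial sides times 2^-N; the [+ 1] keeps the
     divisor positive for a degenerate rectangle. *)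
  destruct (pow_lt_1_zero (/ 2)) with (y := delta / ((b - a) + (d - c) + 1)) as [N HN].
  { rewrite Rabs_pos_eq; lra. }
  { apply Rdiv_lt_0_compat; lra. }
  specialize (HN N (le_n N)). rewrite Rabs_pos_eq in HN by (apply pow_le; lra).
  apply Rmult_lt_compat_l with (r := (b - a) + (d - c) + 1) in HN; [|lra].
  replace (((b - a) + (d - c) + 1) * (delta / ((b - a) + (d - c) + 1))) with delta in HN by (field; lra).
  pose proof (pow_le (/ 2) N ltac:(lra)) as Hp.
  specialize (Hu N). specialize (Hv N). pose proof (Hq N) as G.
  destruct (q N) as [[x1 x2] [y1 y2]]. cbn in *.
  destruct G as (I1 & I2 & I3 & I4 & I5 & I6 & I7 & I8 & I9).
  apply I9, H; auto.
  - rewrite I7. assert (0 <= (d - c) * (/ 2) ^ N) by (apply Rmult_le_pos; lra). nra.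
  - rewrite I8. assert (0 <= (b - a) * (/ 2) ^ N) by (apply Rmult_le_pos; lra). nra.
Qed.

(** * Goursat and simple poles *)

Lemma Cmod_xy_le (x y u v : R) : Cmod ((x, y) - (u, v)) <= Rabs (x - u) + Rabs (y - v).
Proof. apply (Cmod_le_sum ((x, y) - (u, v))%C). Qed.

(** The bound [eps] times the squared half-perimeter is reproduced by bisection: each of the four
    quarters carries a quarter of it. Near a point, subtracting the affine approximation leaves an
    integrand that is small compared with the distance. *)
Lemma goursat (f : C -> C) (a b c d : R) : a <= b -> c <= d ->
  (forall x y, a <= x <= b -> c <= y <= d -> exists l, Cdiff f (x, y) l) ->
  rect f a b c d = 0.
Proof.
  intros Hab Hcd Hf.
  assert (Cf : forall x y, a <= x <= b -> c <= y <= d -> ccont f (x, y)).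
  { intros x y Hx Hy. destruct (Hf x y Hx Hy) as [l Hl]. eapply Cdiff_cont; eauto. }
  assert (Key : forall eps, 0 < eps -> Cmod (rect f a b c d) <= eps * ((b - a) + (d - c)) ^ 2).
  { intros eps He.
    apply (bisection_2d (fun x1 x2 y1 y2 => Cmod (rect f x1 x2 y1 y2) <= eps * ((x2 - x1) + (y2 - y1)) ^ 2)); auto.
    - intros x1 x2 y1 y2 A1 A2 A3 B1 B2 B3 H1 H2 H3 H4.
      rewrite (rect_split_x f x1 ((x1 + x2) / 2) x2) by
        (lra || (apply ex_hint_cont; rewrite Rmin_left, Rmax_right by lra; intros; apply Cf; lra)).
      rewrite (rect_split_y f x1 _ y1 ((y1 + y2) / 2) y2) by
        (lra || (apply ex_vint_cont; rewrite Rmin_left, Rmax_right by lra; intros; apply Cf; lra)).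
      rewrite (rect_split_y f _ x2 y1 ((y1 + y2) / 2) y2) by
        (lra || (apply ex_vint_cont; rewrite Rmin_left, Rmax_right by lra; intros; apply Cf; lra)).
      eapply Rle_trans; [apply Cmod_triangle|].
      eapply Rle_trans; [apply Rplus_le_compat; apply Cmod_triangle|]. nra.
    - intros u v Hu Hv. destruct (Hf u v Hu Hv) as [l Hl].
      (* [eps / 2] compensates the factor 2 between half-perimeter and perimeter in [rect_bound]. *)
      destruct (proj1 (Cdiff_eps f (u, v) l) Hl (eps / 2)) as (delta & Hd & H); [lra|].
      exists (delta / 2). split; [lra|].
      intros x1 x2 y1 y2 A1 A2 A3 B1 B2 B3 D1 D2.
      (* [P] is the first-order Taylor polynomial at (u, v) and [Q] a primitive of it, so [P]
         contributes nothing to the boundary integral. *)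
      set (P := fun w : C => (f (u, v) + l * (w - (u, v)))%C).
      set (Q := fun w : C => (f (u, v) * w + l / 2 * ((w - (u, v)) * (w - (u, v))))%C).
      assert (HP : forall w, Cdiff P w l).
      { intros w. eapply Cdiff_eq.
        - apply (Cdiff_plus (fun _ => f (u, v)) (fun w => l * (w - (u, v)))%C); [apply Cdiff_const|].
          apply Cdiff_scal, (Cdiff_minus (fun w => w) (fun _ => (u, v))); [apply Cdiff_id | apply Cdiff_const].
        - ring. }
      assert (HQ : forall w, Cdiff Q w (P w)).
      { intros w.
        assert (D : Cdiff (fun w => w - (u, v))%C w (1 - 0)) by
          (apply (Cdiff_minus (fun w => w) (fun _ => (u, v))); [apply Cdiff_id | apply Cdiff_const]).
        eapply Cdiff_eq.
        - apply (Cdiff_plus (fun w => f (u, v) * w)%C); apply Cdiff_scal; [apply Cdiff_id|].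
          apply (Cdiff_mult _ _ _ _ _ D D).
        - unfold P. field. }
      assert (ZP : rect P x1 x2 y1 y2 = 0).
      { apply (rect_primitive Q); auto; try lra. intros; eapply Cdiff_cont; eauto. }
      assert (EP : ex_rect P x1 x2 y1 y2) by (apply ex_rect_cont; try lra; intros; eapply Cdiff_cont; eauto).
      assert (EF : ex_rect f x1 x2 y1 y2) by (apply ex_rect_cont; try lra; intros; apply Cf; lra).
      replace (rect f x1 x2 y1 y2) with (rect (fun s => f s - P s)%C x1 x2 y1 y2)
        by (rewrite rect_minus, ZP by auto; ring).
      replace (eps * (x2 - x1 + (y2 - y1)) ^ 2) with
        (2 * (eps / 2 * (x2 - x1 + (y2 - y1))) * (x2 - x1 + (y2 - y1))) by field.
      apply rect_bound; try lra.
      + apply ex_rect_cont; try lra. intros. apply (continuous_Cminus f P); [apply Cf; lra | eapply Cdiff_cont; eauto].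
      + intros x y Hx Hy _.
        pose proof (Cmod_xy_le x y u v) as M.
        assert (Rabs (x - u) <= x2 - x1) by (apply Rabs_le; lra).
        assert (Rabs (y - v) <= y2 - y1) by (apply Rabs_le; lra).
        unfold P. replace (f (x, y) - (f (u, v) + l * ((x, y) - (u, v))))%C with
          (f (x, y) - f (u, v) - l * ((x, y) - (u, v)))%C by ring.
        eapply Rle_trans; [apply H; lra|]. apply Rmult_le_compat_l; lra. }
  apply Cmod_eq_0, Rle_antisym; [|apply Cmod_ge_0].
  apply Rnot_lt_le. intros Hpos.
  set (m := Cmod (rect f a b c d)) in *. set (K := (b - a + (d - c)) ^ 2) in *.
  assert (0 <= K) by apply pow2_ge_0.
  specialize (Key (m / 2 / (K + 1))).
  assert (A : 0 < m / 2 / (K + 1)) by (repeat apply Rdiv_lt_0_compat; lra).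
  specialize (Key A).
  assert (E : m / 2 / (K + 1) * (K + 1) = m / 2) by (field; lra). nra.
Qed.

Lemma is_RInt_0 (a b : R) : is_RInt (fun _ => 0) a b 0.
Proof.
  exact (eq_rect _ (fun l => is_RInt (fun _ => 0) a b l) (is_RInt_const (V := R_NormedModule) a b 0) 0 (Rmult_0_r (b - a))).
Qed.

(** Over a side of a centred square the variable (x - k) / e runs from -1 to 1, where twice the
    arctangent increases by PI. *)
Lemma is_RInt_atan (k e : R) : 0 < e ->
  is_RInt (fun x => 2 * e / ((x - k) ^ 2 + e ^ 2)) (k - e) (k + e) PI.
Proof.
  intros He.
  replace PI with (minus (2 * atan ((k + e - k) / e)) (2 * atan ((k - e - k) / e))).
  2:{ replace ((k + e - k) / e) with 1 by (field; lra). replace ((k - e - k) / e) with (- (1)) by (field; lra).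
      rewrite atan_opp, atan_1. unfold minus, plus, opp; cbn. field. }
  apply (is_RInt_derive (fun x => 2 * atan ((x - k) / e))).
  - intros x _. auto_derive; [lra|]. field.
    split; [|lra]. pose proof (pow2_ge_0 (x - k)). pose proof (pow_lt e 2 He). nra.
  - intros x _. apply (ex_derive_continuous (V := R_NormedModule)). auto_derive.
    pose proof (pow2_ge_0 (x - k)). pose proof (pow_lt e 2 He). nra.
Qed.

Lemma Cinv_xy (x y : R) : (/ (x, y))%C = (x / (x ^ 2 + y ^ 2), - y / (x ^ 2 + y ^ 2)).
Proof. reflexivity. Qed.

(** Opposite sides of a centred square combine: one component cancels and the other is the
    arctangent density, so each pair of sides contributes [PI * Ci]. *)
Lemma rect_inv_square (k e : R) : 0 < e ->
  rect (fun s => / (s - k))%C (k - e) (k + e) (- e) e = (2 * PI * Ci)%C.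
Proof.
  intros He.
  assert (Hc : forall x y, (x = k - e \/ x = k + e \/ y = - e \/ y = e) ->
    ccont (fun s => / (s - k))%C (x, y)).
  { intros x y Hxy. apply (continuous_Cinv (fun s => s - k)%C).
    - apply (continuous_Cminus (fun s => s) (fun _ => RtoC k)); [apply continuous_id | apply continuous_const].
    - intros E. injection E. intros. lra. }
  assert (EX : ex_rect (fun s => / (s - k))%C (k - e) (k + e) (- e) e)
    by (apply ex_rect_cont; try lra; intros; now apply Hc).
  destruct EX as (E1 & E2 & E3 & E4).
  apply CInt_correct in E1, E2, E3, E4.
  assert (H1 := is_CInt_minus _ _ _ _ _ _ E1 E2).
  assert (H2 := is_CInt_minus _ _ _ _ _ _ E4 E3).
  assert (Hs : forall x y : R, (((x, y) : C) - k)%C = ((x - k)%R, y)).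
  { intros; unfold Cminus, Cplus, Copp, RtoC; cbn; f_equal; ring. }
  apply CInt_unique in H1. apply CInt_unique in H2.
  assert (K1 : is_CInt (fun x => / ((x, (- e)%R) - k) - / ((x, e) - k))%C (k - e) (k + e) (0, PI)).
  { apply is_CInt_pair.
    - apply (is_RInt_ext (fun _ => 0)).
      + intros x _. rewrite !Hs, !Cinv_xy. cbn. field. repeat split; apply Rgt_not_eq; pose proof (pow2_ge_0 (x - k)); nra.
      + apply is_RInt_0.
    - apply (is_RInt_ext (fun x => 2 * e / ((x - k) ^ 2 + e ^ 2))); [|now apply is_RInt_atan].
      intros x _. rewrite !Hs, !Cinv_xy. cbn. field. repeat split; apply Rgt_not_eq; pose proof (pow2_ge_0 (x - k)); nra. }
  assert (K2 : is_CInt (fun y => / (((k + e)%R, y) - k) - / (((k - e)%R, y) - k))%C (- e) e (PI, 0)).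
  { apply is_CInt_pair.
    - apply (is_RInt_ext (fun y => 2 * e / ((y - 0) ^ 2 + e ^ 2))).
      + intros y _. rewrite !Hs, !Cinv_xy. cbn. field. repeat split; apply Rgt_not_eq; pose proof (pow2_ge_0 y); nra.
      + pose proof (is_RInt_atan 0 e He) as A. rewrite Rminus_0_l, Rplus_0_l in A. exact A.
    - apply (is_RInt_ext (fun _ => 0)).
      + intros y _. rewrite !Hs, !Cinv_xy. cbn. field. repeat split; apply Rgt_not_eq; pose proof (pow2_ge_0 y); nra.
      + apply is_RInt_0. }
  apply CInt_unique in K1. apply CInt_unique in K2.
  unfold rect, hint, vint.
  rewrite K1 in H1. rewrite K2 in H2.
  transitivity ((0, PI) + Ci * (PI, 0))%C.
  - rewrite H1, H2. ring.
  - unfold Cplus, Cmult, Ci, RtoC; cbn; f_equal; ring.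
Qed.

(** Boundedness of f - r / (w - k) near k suffices: Goursat reduces the rectangle to a square of
    half-side [e] around k, where this difference contributes at most [8 * B * e], and [e] is
    arbitrarily small. *)
Lemma rect_simple_pole (f : C -> C) (k : R) (r : C) (a b c d B delta : R) :
  a < k < b -> c < 0 < d -> 0 < delta ->
  (forall x y, a <= x <= b -> c <= y <= d -> (x, y) <> RtoC k -> exists l, Cdiff f (x, y) l) ->
  (forall w : C, w <> RtoC k -> Cmod (w - k) < delta -> Cmod (f w - r * / (w - k)) <= B) ->
  rect f a b c d = (2 * PI * Ci * r)%C.
Proof.
  intros Hk Hcd Hd Hf HB.
  assert (Cf : forall x y, a <= x <= b -> c <= y <= d -> (x <> k \/ y <> 0) -> ccont f (x, y)).
  { intros x y Hx Hy Hn. destruct (Hf x y Hx Hy) as [l Hl]; [|eapply Cdiff_cont; eauto].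
    intros E; injection E; intros; lra. }
  assert (Df : forall x y, a <= x <= b -> c <= y <= d -> (x <> k \/ y <> 0) -> exists l, Cdiff f (x, y) l).
  { intros x y Hx Hy Hn. apply Hf; auto. intros E; injection E; intros; lra. }
  (* Keeps the square inside the rectangle; [delta / 3] puts its boundary points, at distance at
     most 2 e from k, within [delta]. *)
  set (e0 := Rmin (Rmin (k - a) (b - k)) (Rmin (Rmin (- c) d) (delta / 3))).
  assert (He0 : 0 < e0) by (unfold e0; repeat apply Rmin_pos; lra).
  assert (M1 : e0 <= k - a) by (unfold e0; eapply Rle_trans; [apply Rmin_l | apply Rmin_l]).
  assert (M2 : e0 <= b - k) by (unfold e0; eapply Rle_trans; [apply Rmin_l | apply Rmin_r]).
  assert (M3 : e0 <= - c) by (unfold e0; eapply Rle_trans; [apply Rmin_r | eapply Rle_trans; [apply Rmin_l | apply Rmin_l]]).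
  assert (M4 : e0 <= d) by (unfold e0; eapply Rle_trans; [apply Rmin_r | eapply Rle_trans; [apply Rmin_l | apply Rmin_r]]).
  assert (M5 : e0 <= delta / 3) by (unfold e0; eapply Rle_trans; [apply Rmin_r | apply Rmin_r]).
  assert (HB0 : 0 <= B).
  { eapply Rle_trans; [apply Cmod_ge_0 | apply (HB ((k + delta / 2)%R : C))].
    - intros E; apply RtoC_inj in E; lra.
    - rewrite <- RtoC_minus, Cmod_R, Rabs_pos_eq; lra. }
  assert (Key : forall e, 0 < e < e0 -> Cmod (rect f a b c d - 2 * PI * Ci * r) <= 8 * B * e).
  { intros e He.
    assert (Hh : forall y, c <= y <= d -> y <> 0 -> ex_hint f y a b).
    { intros y Hy Hn. apply ex_hint_cont. rewrite Rmin_left, Rmax_right by lra. intros; apply Cf; auto; lra. }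
    assert (Hv : forall x, a <= x <= b -> x <> k -> ex_vint f x c d).
    { intros x Hx Hn. apply ex_vint_cont. rewrite Rmin_left, Rmax_right by lra. intros; apply Cf; auto; lra. }
    assert (Hh' : forall y, c <= y <= d -> y <> 0 -> ex_hint f y (k - e) b).
    { intros y Hy Hn. apply ex_hint_cont. rewrite Rmin_left, Rmax_right by lra. intros; apply Cf; auto; lra. }
    assert (Hv' : forall x, a <= x <= b -> x <> k -> ex_vint f x (- e) d).
    { intros x Hx Hn. apply ex_vint_cont. rewrite Rmin_left, Rmax_right by lra. intros; apply Cf; auto; lra. }
    (* The left and right strips, then the bottom and top pieces, are split off; Goursat annihilates
       these four and leaves the central square. *)
    rewrite (rect_split_x f a (k - e) b c d) by (lra || apply Hh; lra).
    rewrite (rect_split_x f (k - e) (k + e) b c d) by (lra || apply Hh'; lra).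
    rewrite (rect_split_y f (k - e) (k + e) c (- e) d) by (lra || apply Hv; lra).
    rewrite (rect_split_y f (k - e) (k + e) (- e) e d) by (lra || apply Hv'; lra).
    rewrite (goursat f a (k - e) c d), (goursat f (k + e) b c d), (goursat f (k - e) (k + e) c (- e)),
      (goursat f (k - e) (k + e) e d) by (lra || (intros; apply Df; lra)).
    set (g := fun s => (r * / (s - k))%C).
    assert (Cg : forall x y, (x <> k \/ y <> 0) -> ccont g (x, y)).
    { intros x y Hxy. apply (continuous_Cmult (fun _ => r)); [apply continuous_const|].
      apply (continuous_Cinv (fun s => s - k)%C).
      - apply (continuous_Cminus (fun s => s) (fun _ => RtoC k)); [apply continuous_id | apply continuous_const].
      - intros E. injection E. intros. lra. }
    assert (Eg : ex_rect g (k - e) (k + e) (- e) e) by (apply ex_rect_cont; try lra; intros; apply Cg; lra).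
    assert (Ef : ex_rect f (k - e) (k + e) (- e) e) by (apply ex_rect_cont; try lra; intros; apply Cf; lra).
    assert (Rg : rect g (k - e) (k + e) (- e) e = (2 * PI * Ci * r)%C).
    { rewrite <- (rect_inv_square k e) by lra.
      assert (Ei : ex_rect (fun s => / (s - k))%C (k - e) (k + e) (- e) e).
      { apply ex_rect_cont; try lra. intros. apply (continuous_Cinv (fun s => s - k)%C).
        - apply (continuous_Cminus (fun s => s) (fun _ => RtoC k)); [apply continuous_id | apply continuous_const].
        - intros E. injection E. intros. lra. }
      destruct Ei as (E1 & E2 & E3 & E4). apply CInt_correct in E1, E2, E3, E4.
      unfold rect, hint, vint, g.
      rewrite (CInt_unique _ _ _ _ (is_CInt_scal r _ _ _ _ E1)), (CInt_unique _ _ _ _ (is_CInt_scal r _ _ _ _ E2)),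
        (CInt_unique _ _ _ _ (is_CInt_scal r _ _ _ _ E3)), (CInt_unique _ _ _ _ (is_CInt_scal r _ _ _ _ E4)).
      ring. }
    replace (0 + (0 + (rect f (k - e) (k + e) (- e) e + 0) + 0) - 2 * PI * Ci * r)%C with
      (rect (fun s => f s - g s)%C (k - e) (k + e) (- e) e) by (rewrite rect_minus, Rg by auto; ring).
    replace (8 * B * e) with (2 * B * (k + e - (k - e) + (e - - e))) by ring.
    apply rect_bound; try lra.
    - apply ex_rect_cont; try lra. intros. apply (continuous_Cminus f g); [apply Cf | apply Cg]; lra.
    - intros x y Hx Hy Hxy. apply HB.
      + intros E; injection E; intros; lra.
      + eapply Rle_lt_trans; [apply Cmod_xy_le|].
        assert (Rabs (x - k) <= e) by (apply Rabs_le; lra).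
        assert (Rabs (y - 0) <= e) by (apply Rabs_le; lra). lra. }
  assert (Z : Cmod (rect f a b c d - 2 * PI * Ci * r) = 0).
  { apply Rle_antisym; [|apply Cmod_ge_0]. apply Rnot_lt_le. intros Hpos.
    set (m := Cmod _) in *.
    (* With this [e] the bound [8 * B * e] stays below m / 2, a contradiction. *)
    specialize (Key (Rmin (e0 / 2) (m / (16 * B + 1)))).
    assert (A : 0 < m / (16 * B + 1)) by (apply Rdiv_lt_0_compat; lra).
    assert (Q : m <= 8 * B * Rmin (e0 / 2) (m / (16 * B + 1))).
    { apply Key. split; [apply Rmin_pos; lra|]. eapply Rle_lt_trans; [apply Rmin_l | lra]. }
    assert (Q2 : 8 * B * Rmin (e0 / 2) (m / (16 * B + 1)) <= 8 * B * (m / (16 * B + 1)))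
      by (apply Rmult_le_compat_l; [lra | apply Rmin_r]).
    assert (E : m / (16 * B + 1) * (16 * B + 1) = m) by (field; lra). nra. }
  apply Cmod_eq_0 in Z.
  replace (rect f a b c d) with (rect f a b c d - 2 * PI * Ci * r + 2 * PI * Ci * r)%C by ring.
  rewrite Z. ring.
Qed.

(** * The Gamma function *)

Local Notation is_Clim u l := (filterlim u eventually (locally (T := C_UniformSpace) l)) (only parsing).

Lemma is_Clim_eps (u : nat -> C) (l : C) :
  is_Clim u l <-> forall eps, 0 < eps -> exists N, forall n, (N <= n)%nat -> Cmod (u n - l) < eps.
Proof. apply (filterlim_Cmod (F := eventually) u l). Qed.

Lemma is_Clim_Re (u : nat -> C) (l : C) : is_Clim u l -> is_lim_seq (fun n => Re (u n)) (Re l).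
Proof.
  intros H. apply (filterlim_comp _ _ _ u (fun z : C => Re z) _ _ _ H).
  apply (continuous_fst (U := R_UniformSpace) (V := R_UniformSpace)).
Qed.

Lemma is_Clim_Im (u : nat -> C) (l : C) : is_Clim u l -> is_lim_seq (fun n => Im (u n)) (Im l).
Proof.
  intros H. apply (filterlim_comp _ _ _ u (fun z : C => Im z) _ _ _ H).
  apply (continuous_snd (U := R_UniformSpace) (V := R_UniformSpace)).
Qed.

Lemma is_Clim_pair (u : nat -> C) (l : C) :
  is_lim_seq (fun n => Re (u n)) (Re l) -> is_lim_seq (fun n => Im (u n)) (Im l) -> is_Clim u l.
Proof.
  intros H1 H2. apply is_Clim_eps. intros eps He.
  assert (He2 : 0 < eps / 2) by lra.
  apply is_lim_seq_spec in H1. apply is_lim_seq_spec in H2.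
  destruct (H1 (mkposreal _ He2)) as [N1 K1]. destruct (H2 (mkposreal _ He2)) as [N2 K2].
  exists (max N1 N2). intros n Hn. specialize (K1 n ltac:(lia)). specialize (K2 n ltac:(lia)).
  eapply Rle_lt_trans; [apply Cmod_le_sum|]. unfold Cminus. rewrite re_plus, im_plus, re_opp, im_opp.
  unfold Rminus in K1, K2; cbn [pos] in K1, K2; lra.
Qed.

Lemma is_Clim_ext_loc (u v : nat -> C) (l : C) (N : nat) :
  (forall n, (N <= n)%nat -> u n = v n) -> is_Clim u l -> is_Clim v l.
Proof.
  intros E. rewrite !is_Clim_eps. intros H eps He. destruct (H eps He) as [M HM].
  exists (max N M). intros n Hn. rewrite <- E by lia. apply HM; lia.
Qed.

Lemma is_Clim_const (k : C) : is_Clim (fun _ => k) k.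
Proof. apply filterlim_const. Qed.

Lemma is_Clim_mult (u v : nat -> C) (l m : C) :
  is_Clim u l -> is_Clim v m -> is_Clim (fun n => u n * v n)%C (l * m)%C.
Proof.
  intros Hu Hv.
  pose proof (is_Clim_Re _ _ Hu). pose proof (is_Clim_Im _ _ Hu).
  pose proof (is_Clim_Re _ _ Hv). pose proof (is_Clim_Im _ _ Hv).
  apply is_Clim_pair.
  - rewrite re_mult.
    apply (is_lim_seq_ext (fun n => Re (u n) * Re (v n) - Im (u n) * Im (v n))); [now intros; rewrite re_mult|].
    apply is_lim_seq_minus'; now apply is_lim_seq_mult'.
  - rewrite im_mult.
    apply (is_lim_seq_ext (fun n => Re (u n) * Im (v n) + Im (u n) * Re (v n))); [now intros; rewrite im_mult|].
    apply is_lim_seq_plus'; now apply is_lim_seq_mult'.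
Qed.

Lemma is_Clim_unique (u : nat -> C) (l m : C) : is_Clim u l -> is_Clim u m -> l = m.
Proof.
  intros Hl Hm. rewrite (surjective_pairing l), (surjective_pairing m). f_equal.
  - apply is_Clim_Re, is_lim_seq_unique in Hl. apply is_Clim_Re, is_lim_seq_unique in Hm. unfold Re in *. congruence.
  - apply is_Clim_Im, is_lim_seq_unique in Hl. apply is_Clim_Im, is_lim_seq_unique in Hm. unfold Im in *. congruence.
Qed.

(** [Lim_seq] and [real] are total, so a value of [CGamma] says something about [Gamma_seq] only
    once convergence is known. *)
Lemma CGamma_lim (s l : C) : is_Clim (Gamma_seq s) l -> CGamma s = l.
Proof.
  intros H. unfold CGamma.
  rewrite (is_lim_seq_unique _ _ (is_Clim_Re _ _ H)), (is_lim_seq_unique _ _ (is_Clim_Im _ _ H)).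
  now destruct l.
Qed.

Lemma Cauchy_is_Clim (u : nat -> C) :
  (forall eps, 0 < eps -> exists N, forall n m, (N <= n)%nat -> (n <= m)%nat -> Cmod (u m - u n) < eps) ->
  exists l, is_Clim u l.
Proof.
  intros H.
  assert (P : forall part : C -> R, (forall a b, part (a - b)%C = part a - part b) -> (forall c, Rabs (part c) <= Cmod c) ->
    ex_finite_lim_seq (fun n => part (u n))).
  { intros part Hm Hb. apply ex_lim_seq_cauchy_corr. intros eps.
    destruct (H eps (cond_pos eps)) as [N HN]. exists N. intros n m Hn Hm'.
    rewrite <- Hm. eapply Rle_lt_trans; [apply Hb|].
    destruct (Nat.le_ge_cases n m); [rewrite Cmod_minus_sym|]; apply HN; auto. }
  destruct (P Re) as [x Hx]; [intros; unfold Cminus; now rewrite re_plus, re_opp | apply re_le_Cmod |].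
  destruct (P Im) as [y Hy]; [intros; unfold Cminus; now rewrite im_plus, im_opp | apply im_le_Cmod |].
  exists (x, y). now apply is_Clim_pair.
Qed.

(** Telescoping differences stand for a summable 1 / n^2: relative increments of this size keep the
    sequence bounded, and then the increments themselves telescope to a Cauchy estimate. *)
Lemma is_Clim_product (v : nat -> C) (K : R) : 0 <= K ->
  (forall n, Cmod (v (S n) - v n) <= K * (/ INR (n + 1) - / INR (n + 2)) * Cmod (v n)) ->
  exists l, is_Clim v l.
Proof.
  intros HK H.
  assert (Hd : forall n, 0 < / INR (n + 2) < / INR (n + 1)).
  { intros n. split.
    - apply Rinv_0_lt_compat, lt_0_INR; lia.
    - apply Rinv_lt_contravar; [apply Rmult_lt_0_compat; apply lt_0_INR; lia | apply lt_INR; lia]. }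
  set (B := Cmod (v O) * exp K).
  (* This weighted modulus is nonincreasing, since 1 + x <= exp x absorbs one increment. *)
  assert (HB : forall n, Cmod (v n) * exp (K * / INR (n + 1)) <= B).
  { induction n as [|n IH].
    - unfold B. cbn. rewrite Rinv_1, Rmult_1_r. lra.
    - eapply Rle_trans; [|exact IH].
      replace (S n + 1)%nat with (n + 2)%nat by lia.
      specialize (H n). specialize (Hd n).
      set (d1 := / INR (n + 1)) in *. set (d2 := / INR (n + 2)) in *.
      pose proof (Cmod_triangle_minus (v (S n)) (v n)) as T. pose proof (Cmod_ge_0 (v n)).
      replace (K * d1) with (K * (d1 - d2) + K * d2) by ring. rewrite exp_plus.
      pose proof (exp_ineq1_le (K * (d1 - d2))). pose proof (exp_pos (K * d2)).
      rewrite <- Rmult_assoc. apply Rmult_le_compat_r; [lra|]. nra. }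
  assert (HB' : forall n, Cmod (v n) <= B).
  { intros n. eapply Rle_trans; [|apply (HB n)]. specialize (Hd n).
    pose proof (exp_ineq1_le (K * / INR (n + 1))). pose proof (Cmod_ge_0 (v n)).
    assert (0 <= K * / INR (n + 1)) by (apply Rmult_le_pos; lra). nra. }
  assert (Hdist : forall n k, Cmod (v (n + k)%nat - v n) <= K * B * (/ INR (n + 1) - / INR (n + k + 1))).
  { intros n k. induction k as [|k IH].
    - rewrite !Nat.add_0_r. replace (v n - v n)%C with (RtoC 0) by ring. rewrite Cmod_0. lra.
    - replace (v (n + S k)%nat - v n)%C with ((v (S (n + k)) - v (n + k)%nat) + (v (n + k)%nat - v n))%C
        by (rewrite Nat.add_succ_r; ring).
      eapply Rle_trans; [apply Cmod_triangle|].
      specialize (H (n + k)%nat). specialize (HB' (n + k)%nat). specialize (Hd (n + k)%nat).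
      replace (n + S k + 1)%nat with (n + k + 2)%nat by lia.
      set (d1 := / INR (n + k + 1)) in *. set (d2 := / INR (n + k + 2)) in *.
      assert (K * (d1 - d2) * Cmod (v (n + k)%nat) <= K * (d1 - d2) * B).
      { apply Rmult_le_compat_l; auto. apply Rmult_le_pos; lra. }
      lra. }
  assert (B0 : 0 <= B) by (eapply Rle_trans; [apply Cmod_ge_0 | apply (HB' O)]).
  assert (KB0 : 0 <= K * B) by (now apply Rmult_le_pos).
  apply Cauchy_is_Clim. intros eps He.
  destruct (archimed_cor1 (eps / (K * B + 1))) as (N & HN1 & HN2).
  { apply Rdiv_lt_0_compat; lra. }
  exists N. intros n m Hn Hm. replace m with (n + (m - n))%nat by lia.
  eapply Rle_lt_trans; [apply Hdist|].
  assert (0 < / INR (n + (m - n) + 1)) by (apply Rinv_0_lt_compat, lt_0_INR; lia).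
  assert (/ INR (n + 1) <= / INR N) by (apply Rinv_le_contravar; [apply lt_0_INR; lia | apply le_INR; lia]).
  assert (E : eps / (K * B + 1) * (K * B + 1) = eps) by (field; lra).
  assert (0 < / INR N) by (apply Rinv_0_lt_compat, lt_0_INR; lia).
  nra.
Qed.

(** The denominator s (s + 1) ... (s + n) of [Gamma_seq]; it has n + 1 factors, one more than the
    usual Pochhammer symbol of index n. *)
Definition rising (s : C) (n : nat) : C :=
  fold_right Cmult 1 (map (fun k => s + INR k)%C (seq 0 (S n))).

Lemma rising_0 (s : C) : rising s 0 = s.
Proof. unfold rising; cbn. ring. Qed.

Lemma rising_S (s : C) (n : nat) : rising s (S n) = (rising s n * (s + INR (S n)))%C.
Proof.
  unfold rising. rewrite (seq_S (S n)), map_app, fold_right_app. cbn [map fold_right]. rewrite Nat.add_0_l, Cmult_1_r.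
  generalize (map (fun k => (s + INR k)%C) (seq 0 (S n))). intros L. generalize (s + INR (S n))%C. intros a.
  induction L as [|x L IH]; cbn; [ring|]. rewrite IH. ring.
Qed.

Lemma rising_neq0 (s : C) (n : nat) : (forall k, s + INR k <> 0)%C -> rising s n <> 0.
Proof.
  intros H. induction n as [|n IH].
  - rewrite rising_0. specialize (H O). cbn in H. now rewrite Cplus_0_r in H.
  - rewrite rising_S. apply Cmult_neq_0; auto.
Qed.

Lemma rising_shift (s : C) (n : nat) : rising s (S n) = (s * rising (s + 1) n)%C.
Proof.
  induction n as [|n IH].
  - rewrite rising_S, !rising_0. reflexivity.
  - rewrite rising_S, IH, rising_S, !S_INR, !RtoC_plus. ring.
Qed.

Lemma Gamma_seq_rising (s : C) (n : nat) :
  Gamma_seq s n = (INR (fact n) * Cexp (s * ln (INR n)) / rising s n)%C.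
Proof. reflexivity. Qed.

Lemma Gamma_seq_succ (s : C) (n : nat) : (forall k, s + INR k <> 0)%C ->
  Gamma_seq s (S n) =
  (Gamma_seq s n * (INR (S n) * Cexp (s * (ln (INR (S n)) - ln (INR n))%R) / (s + INR (S n))))%C.
Proof.
  intros H. rewrite !Gamma_seq_rising, rising_S, fact_simpl, mult_INR, RtoC_mult.
  replace (s * ln (INR (S n)))%C with (s * ln (INR n) + s * (ln (INR (S n)) - ln (INR n))%R)%C
    by (rewrite RtoC_minus; ring).
  rewrite Cexp_plus. field. split; [apply H | now apply rising_neq0].
Qed.

(** Both sides come from 1 + x <= exp x, at x equal to minus and plus the difference of the
    logarithms. *)
Lemma ln_succ_bounds (n : nat) : (1 <= n)%nat ->
  / INR (S n) <= ln (INR (S n)) - ln (INR n) <= / INR n.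
Proof.
  intros Hn. assert (P : 0 < INR n) by (apply lt_0_INR; lia). rewrite S_INR.
  split.
  - pose proof (exp_ineq1_le (ln (INR n) - ln (INR n + 1))) as H.
    unfold Rminus in H at 2. rewrite exp_plus, exp_Ropp, !exp_ln in H by lra.
    replace (/ (INR n + 1)) with (1 - INR n * / (INR n + 1)) by (field; lra). lra.
  - pose proof (exp_ineq1_le (ln (INR n + 1) - ln (INR n))) as H.
    unfold Rminus in H at 2. rewrite exp_plus, exp_Ropp, !exp_ln in H by lra.
    replace (/ INR n) with ((INR n + 1) * / INR n - 1) by (field; lra). lra.
Qed.

(** The quotient of consecutive terms is 1 + O(1 / n^2): the first-order part of the power (1 +
    1/n)^s cancels against that of (s + n + 1) / (n + 1). *)
Lemma Gamma_seq_cv (s : C) : (forall k, s + INR k <> 0)%C -> exists l, is_Clim (Gamma_seq s) l.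
Proof.
  intros Hs. set (m := Cmod s). assert (Hm : 0 <= m) by apply Cmod_ge_0.
  (* The bracket bounds n times the numerator of the quotient minus 1; the factor 2 comes from the
     denominator, which is at least n / 2. *)
  set (K := 2 * (4 * m ^ 2 * exp m + m)).
  assert (HK : 0 <= K).
  { unfold K. pose proof (exp_pos m). assert (0 <= 4 * m ^ 2 * exp m) by (apply Rmult_le_pos; [nra | lra]). lra. }
  assert (Hstep : forall n, (2 <= n)%nat -> 2 * m <= INR n ->
    Cmod (Gamma_seq s (S n) - Gamma_seq s n) <= K / INR n ^ 2 * Cmod (Gamma_seq s n)).
  { intros n Hn Hmn. rewrite Gamma_seq_succ by auto.
    pose proof (ln_succ_bounds n ltac:(lia)) as [L1 L2].
    set (dl := ln (INR (S n)) - ln (INR n)) in *.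
    assert (Pn : 2 <= INR n) by (apply (le_INR 2); lia).
    rewrite S_INR in *.
    assert (Hd : 0 < / (INR n + 1)) by (apply Rinv_0_lt_compat; lra).
    assert (Hd1 : (INR n + 1) * / (INR n + 1) = 1) by (field; lra).
    assert (Hd2 : INR n * / INR n = 1) by (field; lra).
    assert (Hden : INR n / 2 <= Cmod (s + (INR n + 1)%R)).
    { pose proof (Cmod_triangle_minus (RtoC (INR n + 1)) (s + (INR n + 1)%R)) as T.
      replace (RtoC (INR n + 1) - (s + (INR n + 1)%R))%C with (- s)%C in T by ring.
      rewrite Cmod_opp, Cmod_R, Rabs_pos_eq in T by lra. fold m in T. lra. }
    assert (Hn0 : (s + (INR n + 1)%R)%C <> 0) by (apply Cmod_gt_0; lra).
    set (G := Gamma_seq s n).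
    replace (G * ((INR n + 1)%R * Cexp (s * dl) / (s + (INR n + 1)%R)) - G)%C with
      (((INR n + 1)%R * (Cexp (s * dl) - 1 - s * dl) + s * ((INR n + 1) * dl - 1)%R) / (s + (INR n + 1)%R) * G)%C.
    2:{ rewrite RtoC_minus, RtoC_mult. field. auto. }
    rewrite Cmod_mult, Cmod_div by auto. apply Rmult_le_compat_r; [apply Cmod_ge_0|].
    assert (Hsd : Cmod (s * dl) = m * dl) by (rewrite Cmod_mult, Cmod_R, Rabs_pos_eq by lra; reflexivity).
    pose proof (Cexp_taylor1 (s * dl)) as T. rewrite Hsd in T.
    assert (Hin : / INR n <= / 2) by (apply Rinv_le_contravar; lra).
    assert (He : exp (m * dl) <= exp m) by (apply exp_le_compat; nra).
    assert (N1 : Cmod ((INR n + 1)%R * (Cexp (s * dl) - 1 - s * dl)) <= 4 * m ^ 2 * exp m * / INR n).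
    { rewrite Cmod_mult, Cmod_R, Rabs_pos_eq by lra.
      apply Rle_trans with ((INR n + 1) * (2 * (m * dl) ^ 2 * exp m)).
      - apply Rmult_le_compat_l; [lra|]. eapply Rle_trans; [exact T|].
        apply Rmult_le_compat_l; [nra | auto].
      - replace ((INR n + 1) * (2 * (m * dl) ^ 2 * exp m)) with (2 * m ^ 2 * exp m * ((INR n + 1) * dl ^ 2)) by ring.
        replace (4 * m ^ 2 * exp m * / INR n) with (2 * m ^ 2 * exp m * (2 * / INR n)) by ring.
        apply Rmult_le_compat_l; [apply Rmult_le_pos; [nra | left; apply exp_pos]|].
        assert (dl ^ 2 <= / INR n ^ 2) by (rewrite <- pow_inv; apply pow_incr; lra).
        apply Rle_trans with ((INR n + 1) * / INR n ^ 2); [apply Rmult_le_compat_l; lra|].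
        replace (2 * / INR n) with (2 * INR n * / INR n ^ 2) by (field; lra).
        apply Rmult_le_compat_r; [left; apply Rinv_0_lt_compat; nra | lra]. }
    assert (N2 : Cmod (s * ((INR n + 1) * dl - 1)%R) <= m * / INR n).
    { rewrite Cmod_mult, Cmod_R. apply Rmult_le_compat_l; auto. apply Rabs_le. split; nra. }
    assert (N3 := Rle_trans _ _ _ (Cmod_triangle _ _) (Rplus_le_compat _ _ _ _ N1 N2)).
    replace (K / INR n ^ 2) with ((4 * m ^ 2 * exp m * / INR n + m * / INR n) / (INR n / 2)) by (unfold K; field; lra).
    unfold Rdiv at 1 3. apply Rmult_le_compat; auto.
    - apply Cmod_ge_0.
    - left; apply Rinv_0_lt_compat; lra.
    - apply Rinv_le_contravar; lra. }
  destruct (INR_unbounded (2 * m)) as [N0 HN0].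
  (* Starting at [N] ensures 2 |s| <= n in [Hstep], and the shift by at least 2 gives 1 / (n + N)^2
     <= 1 / ((n + 1) (n + 2)). *)
  set (N := (N0 + 2)%nat).
  destruct (is_Clim_product (fun n => Gamma_seq s (n + N)%nat) K HK) as [l Hl].
  { intros n. eapply Rle_trans; [apply Hstep|].
    - unfold N; lia.
    - apply Rle_trans with (INR N0); [lra | apply le_INR; unfold N; lia].
    - apply Rmult_le_compat_r; [apply Cmod_ge_0|].
      unfold Rdiv. apply Rmult_le_compat_l; auto.
      assert (0 < INR (n + 1)) by (apply lt_0_INR; lia).
      assert (INR (n + 2) = INR (n + 1) + 1) by (rewrite !plus_INR; cbn; lra).
      replace (/ INR (n + 1) - / INR (n + 2)) with (/ (INR (n + 1) * INR (n + 2))) by (rewrite H0; field; lra).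
      assert (INR (n + 2) <= INR (n + N)) by (apply le_INR; unfold N; lia).
      apply Rinv_le_contravar; nra. }
  exists l. rewrite is_Clim_eps in *. intros eps He. destruct (Hl eps He) as [M HM].
  exists (M + N)%nat. intros n Hn. specialize (HM (n - N)%nat ltac:(lia)).
  replace (n - N + N)%nat with n in HM by lia. exact HM.
Qed.

Lemma CGamma_correct (s : C) : (forall k, s + INR k <> 0)%C -> is_Clim (Gamma_seq s) (CGamma s).
Proof. intros H. destruct (Gamma_seq_cv s H) as [l Hl]. now rewrite (CGamma_lim _ _ Hl). Qed.

Lemma is_Clim_ratio (s : C) : (forall k, s + INR k <> 0)%C ->
  is_Clim (fun n => INR n / (s + INR (S n)))%C (RtoC 1).
Proof.
  intros Hs. apply is_Clim_eps. intros eps He.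
  set (m := Cmod (s + 1)). assert (0 <= m) by apply Cmod_ge_0.
  destruct (INR_unbounded (m + m / eps)) as [N HN].
  exists N. intros n Hn.
  assert (INR N <= INR n) by (apply le_INR; auto).
  assert (0 <= m / eps) by (apply Rdiv_le_0_compat; lra).
  assert (E : (s + INR (S n))%C = ((s + 1) + INR n)%C) by (rewrite S_INR, RtoC_plus; ring).
  replace (INR n / (s + INR (S n)) - 1)%C with (- (s + 1) / (s + INR (S n)))%C.
  2:{ pose proof (Hs (S n)) as Z. rewrite E in *. field. exact Z. }
  rewrite Cmod_div, Cmod_opp, E by apply Hs. fold m.
  assert (D : INR n - m <= Cmod (s + 1 + INR n)).
  { pose proof (Cmod_triangle_minus (RtoC (INR n)) (s + 1 + INR n)) as T.
    replace (INR n - (s + 1 + INR n))%C with (- (s + 1))%C in T by ring.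
    rewrite Cmod_opp, Cmod_R, Rabs_pos_eq in T by apply pos_INR. fold m in T. lra. }
  apply (Rmult_lt_reg_r (Cmod (s + 1 + INR n))); [lra|].
  unfold Rdiv. rewrite Rmult_assoc, Rinv_l, Rmult_1_r by lra.
  assert (m / eps * eps = m) by (field; lra). nra.
Qed.

(** The functional equation holds for the finite products up to the factor n / (s + n + 1), which
    tends to 1. *)
Lemma CGamma_succ (s : C) : (forall k, s + INR k <> 0)%C -> CGamma (s + 1) = (s * CGamma s)%C.
Proof.
  intros Hs. apply CGamma_lim.
  replace (s * CGamma s)%C with (s * CGamma s * 1)%C by ring.
  apply (is_Clim_ext_loc (fun n => s * Gamma_seq s n * (INR n / (s + INR (S n))))%C _ _ 1).
  - intros n Hn. rewrite !Gamma_seq_rising.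
    assert (H0 : s <> 0) by (specialize (Hs O); cbn in Hs; now rewrite Cplus_0_r in Hs).
    assert (E : rising (s + 1) n = (rising s n * (s + INR (S n)) / s)%C).
    { rewrite <- rising_S, rising_shift. field. auto. }
    rewrite E. replace ((s + 1) * ln (INR n))%C with (s * ln (INR n) + ln (INR n))%C by ring.
    rewrite Cexp_plus, Cexp_real, exp_ln by (apply lt_0_INR; lia).
    field. repeat split; auto. now apply rising_neq0.
  - apply is_Clim_mult; [|now apply is_Clim_ratio].
    apply is_Clim_mult; [apply is_Clim_const | now apply CGamma_correct].
Qed.

(** * Sine product and reflection formula *)

Lemma Csin2_Ccos2 (s : C) : (Csin s * Csin s + Ccos s * Ccos s)%C = 1.
Proof.
  unfold Csin, Ccos. rewrite Cexp_opp.
  replace (- Ci / 2 * (Cexp (Ci * s) - / Cexp (Ci * s)) * (- Ci / 2 * (Cexp (Ci * s) - / Cexp (Ci * s))))%C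
    with ((Ci * Ci) * (/ 2 * (Cexp (Ci * s) - / Cexp (Ci * s)) * (/ 2 * (Cexp (Ci * s) - / Cexp (Ci * s)))))%C
    by (field; apply Cexp_neq0).
  rewrite Ci2. field. apply Cexp_neq0.
Qed.

Lemma Ccos_double (s : C) : (Ccos (2 * s) - 1)%C = (- (2) * (Csin s * Csin s))%C.
Proof.
  assert (E : Ccos (2 * s) = (Ccos s * Ccos s - Csin s * Csin s)%C).
  { unfold Csin, Ccos. replace (Ci * (2 * s))%C with (Ci * s + Ci * s)%C by ring.
    rewrite !Cexp_opp, Cexp_plus.
    replace (- Ci / 2 * (Cexp (Ci * s) - / Cexp (Ci * s)) * (- Ci / 2 * (Cexp (Ci * s) - / Cexp (Ci * s))))%C
      with ((Ci * Ci) * (/ 2 * (Cexp (Ci * s) - / Cexp (Ci * s)) * (/ 2 * (Cexp (Ci * s) - / Cexp (Ci * s)))))%C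
      by (field; apply Cexp_neq0).
    rewrite Ci2. field. apply Cexp_neq0. }
  rewrite E, <- (Csin2_Ccos2 s). ring.
Qed.

Lemma Cmod_Csin_le (v : C) : Cmod (Csin v) <= Cmod v * (1 + 2 * Cmod v * exp (Cmod v)).
Proof.
  unfold Csin. rewrite Cmod_mult.
  assert (E : Cmod (- Ci / 2) = / 2).
  { rewrite Cmod_div by apply C2_neq0. rewrite Cmod_opp, Cmod_Ci, Cmod_R, Rabs_pos_eq; lra. }
  rewrite E.
  replace (Cexp (Ci * v) - Cexp (- (Ci * v)))%C with ((Cexp (Ci * v) - 1) + - (Cexp (- (Ci * v)) - 1))%C by ring.
  pose proof (Cexp_minus_1 (Ci * v)) as H1. pose proof (Cexp_minus_1 (- (Ci * v))) as H2.
  rewrite Cmod_opp in H2. rewrite Cmod_mult, Cmod_Ci, Rmult_1_l in H1, H2.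
  pose proof (Cmod_triangle (Cexp (Ci * v) - 1) (- (Cexp (- (Ci * v)) - 1))) as T.
  rewrite Cmod_opp in T. lra.
Qed.

Lemma Cdiff_pow (f : C -> C) (s l : C) (n : nat) :
  Cdiff f s l -> Cdiff (fun w => f w ^ S n)%C s (INR (S n) * f s ^ n * l).
Proof.
  intros H. induction n as [|n IH].
  - eapply Cdiff_ext; [|eapply Cdiff_eq; [exact H|]].
    + intros w; cbn; ring.
    + cbn. ring.
  - eapply Cdiff_ext; [|eapply Cdiff_eq; [apply (Cdiff_mult f (fun w => f w ^ S n)%C); [exact H | exact IH]|]].
    + intros w; reflexivity.
    + rewrite (S_INR (S n)), RtoC_plus, !Cpow_S. ring.
Qed.

(** The integration variable is complex so that [Cdiff] and [hint_FTC] apply; the integral itself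
    runs along the real axis. *)
Definition wallis_fun (n : nat) (s w : C) : C := (Ccos w ^ n * Ccos (2 * s * w))%C.
Definition wallis (n : nat) (s : C) : C := hint (wallis_fun n s) 0 0 (PI / 2).

Lemma Cdiff_lin (k s : C) : Cdiff (fun w => k * w)%C s k.
Proof. eapply Cdiff_eq; [apply Cdiff_scal, Cdiff_id|]. ring. Qed.

Lemma ccont_Cpow (f : C -> C) (s : C) (n : nat) : ccont f s -> ccont (fun w => f w ^ n)%C s.
Proof.
  intros H. induction n as [|n IH].
  - cbn. apply continuous_const.
  - cbn. now apply (continuous_Cmult f (fun w => f w ^ n)%C).
Qed.

Lemma wallis_fun_cont (n : nat) (s w : C) : ccont (wallis_fun n s) w.
Proof.
  apply (continuous_Cmult (fun w => Ccos w ^ n)%C (fun w => Ccos (2 * s * w))).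
  - apply ccont_Cpow. eapply Cdiff_cont, Cdiff_Ccos.
  - apply (Cdiff_cont _ _ _ (Cdiff_comp Ccos (fun w => 2 * s * w)%C w _ _ (Cdiff_Ccos _) (Cdiff_lin _ _))).
Qed.

Lemma ex_wallis (n : nat) (s : C) (a b : R) : ex_hint (wallis_fun n s) 0 a b.
Proof. apply ex_hint_cont. intros; apply wallis_fun_cont. Qed.

Lemma Csin_0 : Csin 0 = 0.
Proof. rewrite Csin_real, sin_0. reflexivity. Qed.

Lemma Ccos_0 : Ccos 0 = 1.
Proof. rewrite Ccos_real, cos_0. reflexivity. Qed.

Lemma Ccos_PI2 : Ccos (PI / 2) = 0.
Proof. rewrite <- RtoC_div by lra. rewrite Ccos_real, cos_PI2. reflexivity. Qed.

(* Integrates the derivative of [(n+2) cos^(n+1) sin cos(2 s w) - 2 s cos^(n+2) sin(2 s w)]. *)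
Lemma wallis_rec (n : nat) (s : C) :
  ((INR (n + 2) * INR (n + 2) - 4 * s * s) * wallis (n + 2) s = INR (n + 2) * INR (n + 1) * wallis n s)%C.
Proof.
  set (N := INR (n + 2)).
  set (A := fun w => (N * (Ccos w ^ S n * (Csin w * Ccos (2 * s * w))) - 2 * s * (Ccos w ^ S (S n) * Csin (2 * s * w)))%C).
  set (B := fun w => ((N * N - 4 * s * s) * wallis_fun (n + 2) s w - N * INR (n + 1) * wallis_fun n s w)%C).
  assert (D : forall w, Cdiff A w (B w)).
  { intros w. unfold A.
    assert (D1 : Cdiff (fun w => Ccos (2 * s * w)) w (- Csin (2 * s * w) * (2 * s)))
      by (apply (Cdiff_comp Ccos (fun w => 2 * s * w)%C); [apply Cdiff_Ccos | apply Cdiff_lin]).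
    assert (D2 : Cdiff (fun w => Csin (2 * s * w)) w (Ccos (2 * s * w) * (2 * s)))
      by (apply (Cdiff_comp Csin (fun w => 2 * s * w)%C); [apply Cdiff_Csin | apply Cdiff_lin]).
    eapply Cdiff_eq.
    - apply Cdiff_minus; apply Cdiff_scal; apply Cdiff_mult.
      + apply (Cdiff_pow Ccos). apply Cdiff_Ccos.
      + apply Cdiff_mult; [apply Cdiff_Csin | exact D1].
      + apply (Cdiff_pow Ccos). apply Cdiff_Ccos.
      + exact D2.
    - unfold B, wallis_fun. replace (n + 2)%nat with (S (S n)) by lia. rewrite !Cpow_S.
      replace (INR (S (S n))) with N by (unfold N; f_equal; lia).
      replace (INR (S n)) with (N - 1) by (unfold N; replace (n + 2)%nat with (S (S n)) by lia; rewrite !S_INR; lra).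
      replace (INR (n + 1)) with (N - 1) by (unfold N; replace (n + 2)%nat with (S (S n)) by lia; replace (n + 1)%nat with (S n) by lia; rewrite !S_INR; lra).
      rewrite RtoC_minus.
      generalize (Csin2_Ccos2 w). generalize (Ccos w ^ n)%C. generalize (Csin (2 * s * w)) (Ccos (2 * s * w)) (Csin w) (Ccos w).
      intros p q x y r E.
      transitivity (N * ((N - 1) * r * - (x * x) * q + (y * r) * (y * q + x * (- p * (2 * s)))) -
        2 * s * (N * (y * r) * - x * p + y * (y * r) * (q * (2 * s))))%C; [ring|].
      replace (x * x)%C with (1 - y * y)%C by (rewrite <- E; ring). ring. }
  assert (CB : forall w, ccont B w).
  { intros w. apply (continuous_Cminus (fun w => (N * N - 4 * s * s) * wallis_fun (n + 2) s w)%C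
      (fun w => N * INR (n + 1) * wallis_fun n s w)%C).
    - apply (continuous_Cmult (fun _ => (N * N - 4 * s * s)%C)); [apply continuous_const | apply wallis_fun_cont].
    - apply (continuous_Cmult (fun _ => (N * INR (n + 1))%C)); [apply continuous_const | apply wallis_fun_cont]. }
  assert (I1 : hint B 0 0 (PI / 2) = 0).
  { rewrite (hint_FTC A B) by auto. unfold A.
    change (((PI / 2)%R, 0) : C) with (RtoC (PI / 2)). change ((0, 0) : C) with (RtoC 0).
    rewrite RtoC_div by lra. rewrite Ccos_PI2, Csin_0, Cmult_0_r, Csin_0, !Cpow_S. ring. }
  assert (I2 : hint B 0 0 (PI / 2) = ((N * N - 4 * s * s) * wallis (n + 2) s - N * INR (n + 1) * wallis n s)%C).
  { apply CInt_unique. apply is_CInt_minus; apply is_CInt_scal; apply CInt_correct; apply ex_wallis. }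
  rewrite I1 in I2.
  replace ((N * N - 4 * s * s) * wallis (n + 2) s)%C with
    (((N * N - 4 * s * s) * wallis (n + 2) s - N * INR (n + 1) * wallis n s) + N * INR (n + 1) * wallis n s)%C by ring.
  rewrite <- I2. unfold N. ring.
Qed.

(** Here sin(PI s) enters; the recurrence ties all integrals of even index to this one. *)
Lemma wallis_0 (s : C) : s <> 0 -> wallis 0 s = (Csin (PI * s) / (2 * s))%C.
Proof.
  intros Hs. pose proof C2_neq0 as H2.
  unfold wallis. rewrite (hint_FTC (fun w => Csin (2 * s * w) / (2 * s))%C).
  - change (((PI / 2)%R, 0) : C) with (RtoC (PI / 2)). change ((0, 0) : C) with (RtoC 0).
    rewrite RtoC_div by lra. rewrite Cmult_0_r, Csin_0.
    replace (2 * s * (PI / 2))%C with (PI * s)%C by (field; auto). field. auto.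
  - intros x _. split; [|apply wallis_fun_cont].
    assert (D2 : Cdiff (fun w => Csin (2 * s * w)) ((x, 0) : C) (Ccos (2 * s * (x, 0%R)) * (2 * s)))
      by (apply (Cdiff_comp Csin (fun w => 2 * s * w)%C); [apply Cdiff_Csin | apply Cdiff_lin]).
    eapply Cdiff_ext; [|eapply Cdiff_eq; [apply (Cdiff_scal (/ (2 * s)) _ _ _ D2)|]].
    + intros w; cbn. field. auto.
    + unfold wallis_fun. cbn. field. auto.
Qed.

Lemma wallis_fun_real (n : nat) (t : R) : wallis_fun n 0 (t, 0) = RtoC (cos t ^ n).
Proof.
  unfold wallis_fun. change ((t, 0) : C) with (RtoC t).
  replace (2 * 0 * t)%C with (RtoC 0) by ring. rewrite Ccos_0, Ccos_real, RtoC_pow. ring.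
Qed.

Lemma wallis_0_0 : wallis 0 0 = (PI / 2)%C.
Proof.
  unfold wallis. rewrite (hint_FTC (fun w => w)).
  - rewrite <- RtoC_div by lra. unfold RtoC, Cminus, Cplus, Copp; cbn; f_equal; ring.
  - intros x _. split; [|apply wallis_fun_cont]. eapply Cdiff_eq; [apply Cdiff_id|].
    rewrite wallis_fun_real. reflexivity.
Qed.

Fixpoint sine_prod (s : C) (m : nat) : C :=
  match m with O => 1 | S m => sine_prod s m * (1 - s * s / (INR (S m) * INR (S m))) end%C.

Lemma INR_S_neq0 (m : nat) : RtoC (INR (S m)) <> 0.
Proof. apply RtoC_neq0. apply not_0_INR. lia. Qed.

(** Dividing the recurrence by (2 m + 2)^2 leaves on the right a factor free of s, which cancels
    against the same recurrence at s = 0. *)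
Lemma wallis_rec_even (m : nat) (s : C) :
  ((1 - s * s / (INR (S m) * INR (S m))) * wallis (2 * S m) s = (2 * INR m + 1) / (2 * INR m + 2) * wallis (2 * m) s)%C.
Proof.
  pose proof (wallis_rec (2 * m) s) as H. replace (2 * m + 2)%nat with (2 * S m)%nat in H by lia.
  pose proof (INR_S_neq0 m) as Hm. pose proof C2_neq0.
  assert (E1 : INR (2 * S m) = 2 * INR (S m)) by (rewrite mult_INR; reflexivity).
  assert (E2 : INR (2 * m + 1) = 2 * INR m + 1) by (rewrite plus_INR, mult_INR; reflexivity).
  rewrite E1, E2, RtoC_plus, !RtoC_mult in H.
  set (M := RtoC (INR (S m))) in *.
  replace (2 * INR m + 2)%C with (2 * M)%C by (unfold M; rewrite S_INR, RtoC_plus; ring).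
  replace ((1 - s * s / (M * M)) * wallis (2 * S m) s)%C with
    ((2 * M * (2 * M) - 4 * s * s) * wallis (2 * S m) s / (4 * M * M))%C.
  2:{ field. auto. }
  rewrite H. field. auto.
Qed.

Lemma wallis_even_0_rec (m : nat) :
  wallis (2 * S m) 0 = (RtoC ((2 * INR m + 1) / (2 * INR m + 2)) * wallis (2 * m) 0)%C.
Proof.
  pose proof (wallis_rec_even m 0) as H. pose proof (INR_S_neq0 m). pose proof (pos_INR m).
  replace (1 - 0 * 0 / (INR (S m) * INR (S m)))%C with (RtoC 1) in H by (field; auto).
  rewrite Cmult_1_l in H. rewrite H. rewrite RtoC_div, !RtoC_plus, !RtoC_mult by lra. reflexivity.
Qed.

Lemma wallis_even_0_pos (m : nat) : exists x, 0 < x /\ wallis (2 * m) 0 = RtoC x.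
Proof.
  induction m as [|m (x & Hx & E)].
  - exists (PI / 2). split; [apply PI2_RGT_0|]. change (2 * 0)%nat with 0%nat. rewrite wallis_0_0, RtoC_div by lra. reflexivity.
  - exists ((2 * INR m + 1) / (2 * INR m + 2) * x). pose proof (pos_INR m). split.
    + apply Rmult_lt_0_compat; auto. apply Rdiv_lt_0_compat; lra.
    + rewrite wallis_even_0_rec, E, RtoC_mult. reflexivity.
Qed.

(** With W for [wallis], the cross-multiplied form of sine_prod s m * W_2m(s) / W_2m(0) = W_0(s) /
    W_0(0), so that the induction involves no quotient of integrals. *)
Lemma wallis_sine_prod (m : nat) (s : C) :
  (sine_prod s m * wallis (2 * m) s * wallis 0 0 = wallis 0 s * wallis (2 * m) 0)%C.
Proof.
  induction m as [|m IH].
  - change (2 * 0)%nat with 0%nat. cbn [sine_prod]. ring.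
  - cbn [sine_prod].
    replace (sine_prod s m * (1 - s * s / (INR (S m) * INR (S m))) * wallis (2 * S m) s * wallis 0 0)%C with
      (sine_prod s m * ((1 - s * s / (INR (S m) * INR (S m))) * wallis (2 * S m) s) * wallis 0 0)%C by ring.
    rewrite wallis_rec_even, wallis_even_0_rec.
    pose proof (pos_INR m). rewrite RtoC_div, !RtoC_plus, !RtoC_mult by lra.
    set (k := ((2 * INR m + 1) / (2 * INR m + 2))%C).
    replace (sine_prod s m * (k * wallis (2 * m) s) * wallis 0 0)%C with
      (k * (sine_prod s m * wallis (2 * m) s * wallis 0 0))%C by ring.
    rewrite IH. ring.
Qed.

(** Jordan's inequality with a generous constant: for t <= 1/2, sin t >= t - t^2 >= t / 2; beyond,
    sin t >= sin(1/2) >= 1/4 while t <= 2. *)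
Lemma le_8_sin (t : R) : 0 <= t <= PI / 2 -> t <= 8 * sin t.
Proof.
  intros [H1 H2]. pose proof PI_4. pose proof PI2_1.
  destruct (Rle_dec t (1 / 2)) as [L|L].
  - pose proof (Rabs_sin_minus_id t) as A. apply Rabs_le_between in A. nra.
  - assert (A : sin (1 / 2) <= sin t) by (apply sin_incr_1; lra).
    pose proof (Rabs_sin_minus_id (1 / 2)) as B. apply Rabs_le_between in B. lra.
Qed.

(** Since cos(2 s t) - 1 = - 2 sin(s t)^2 is O(sin(t)^2) on [0, PI/2], the difference is dominated
    by the integral of cos^(2m) sin^2 at s = 0, which is W_2m(0) - W_(2m+2)(0) = W_2m(0) / (2 m + 2)
    by the recurrence. *)
Lemma wallis_diff (s : C) : exists K, 0 <= K /\ forall m,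
  Cmod (wallis (2 * m) s - wallis (2 * m) 0) <= K * / (2 * INR m + 2) * Cmod (wallis (2 * m) 0).
Proof.
  set (r := Cmod s * (PI / 2)). set (k1 := Cmod s * (1 + 2 * r * exp r)).
  pose proof (Cmod_ge_0 s) as Hs. pose proof PI2_RGT_0 as HP.
  assert (Hr : 0 <= r) by (unfold r; nra).
  assert (Hk1 : 0 <= k1).
  { unfold k1. apply Rmult_le_pos; auto. pose proof (exp_pos r). assert (0 <= r * exp r) by (apply Rmult_le_pos; lra). lra. }
  (* [k1 * t] bounds |sin(s t)|; 128 is 2 * 8^2, from the double angle and [le_8_sin]. *)
  exists (128 * k1 ^ 2). split; [nra|]. intros m.
  assert (E1 : is_CInt (fun t => wallis_fun (2 * m) s (t, 0) - wallis_fun (2 * m) 0 (t, 0))%C 0 (PI / 2)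
    (wallis (2 * m) s - wallis (2 * m) 0)%C) by (apply is_CInt_minus; apply CInt_correct; apply ex_wallis).
  assert (E2 : is_CInt (fun t => wallis_fun (2 * m) 0 (t, 0) - wallis_fun (2 * S m) 0 (t, 0))%C 0 (PI / 2)
    (wallis (2 * m) 0 - wallis (2 * S m) 0)%C) by (apply is_CInt_minus; apply CInt_correct; apply ex_wallis).
  apply is_CInt_Re in E2. apply (is_RInt_scal (V := R_NormedModule) _ _ _ (128 * k1 ^ 2)) in E2.
  rewrite Cmod_norm.
  eapply Rle_trans; [apply (norm_RInt_le (V := C_R_NormedModule) _ _ _ _ _ _ (Rlt_le _ _ HP) ) with (2 := E1) (3 := E2)|].
  - intros t Ht. rewrite <- Cmod_norm.
    change (scal (128 * k1 ^ 2) (Re (wallis_fun (2 * m) 0 (t, 0) - wallis_fun (2 * S m) 0 (t, 0)))) with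
      ((128 * k1 ^ 2) * (Re (wallis_fun (2 * m) 0 (t, 0%R) - wallis_fun (2 * S m) 0 (t, 0%R)))).
    assert (Q : (wallis_fun (2 * m) s (t, 0%R) - wallis_fun (2 * m) 0 (t, 0%R))%C =
      (RtoC (cos t ^ (2 * m)) * (- (2) * (Csin (s * t) * Csin (s * t))))%C).
    { rewrite wallis_fun_real. unfold wallis_fun. change ((t, 0) : C) with (RtoC t).
      rewrite <- Ccos_double, Ccos_real, RtoC_pow. replace (2 * (s * t))%C with (2 * s * t)%C by ring. ring. }
    rewrite Q, !wallis_fun_real, <- RtoC_minus, re_RtoC, !Cmod_mult, Cmod_opp, !Cmod_R.
    assert (C0 : 0 <= cos t ^ (2 * m)) by (rewrite pow_mult; apply pow_le, pow2_ge_0).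
    rewrite (Rabs_pos_eq _ C0), (Rabs_pos_eq 2) by lra.
    replace (2 * S m)%nat with (2 * m + 2)%nat by lia. rewrite pow_add.
    replace (cos t ^ (2 * m) - cos t ^ (2 * m) * cos t ^ 2) with (cos t ^ (2 * m) * sin t ^ 2).
    2:{ pose proof (sin2_cos2 t) as S. unfold Rsqr in S. replace (sin t ^ 2) with (1 - cos t ^ 2) by (cbn; lra). ring. }
    pose proof (Cmod_Csin_le (s * t)) as L. rewrite Cmod_mult, Cmod_R, Rabs_pos_eq in L by lra.
    assert (Lr : Cmod s * t <= r) by (unfold r; nra).
    assert (0 <= Cmod s * t) by nra.
    assert (Le : exp (Cmod s * t) <= exp r) by now apply exp_le_compat.
    assert (L2 : Cmod (Csin (s * t)) <= k1 * t).
    { eapply Rle_trans; [exact L|]. unfold k1.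
      replace (Cmod s * (1 + 2 * r * exp r) * t) with (Cmod s * t * (1 + 2 * r * exp r)) by ring.
      apply Rmult_le_compat_l; auto. pose proof (exp_pos (Cmod s * t)).
      assert (Cmod s * t * exp (Cmod s * t) <= r * exp r) by (apply Rmult_le_compat; lra). lra. }
    pose proof (le_8_sin t ltac:(lra)) as L3. pose proof (Cmod_ge_0 (Csin (s * t))) as L4.
    assert (L5 : Cmod (Csin (s * t)) <= k1 * (8 * sin t)) by (eapply Rle_trans; [exact L2 | apply Rmult_le_compat_l; auto]).
    replace (128 * k1 ^ 2 * (cos t ^ (2 * m) * sin t ^ 2)) with
      (cos t ^ (2 * m) * (2 * ((k1 * (8 * sin t)) * (k1 * (8 * sin t))))) by ring.
    apply Rmult_le_compat_l; auto. apply Rmult_le_compat_l; [lra|]. apply Rmult_le_compat; auto.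
  - rewrite wallis_even_0_rec. destruct (wallis_even_0_pos m) as (x & Hx & E). rewrite E.
    rewrite <- RtoC_mult, <- RtoC_minus, re_RtoC, Cmod_R, Rabs_pos_eq by lra.
    change (scal (128 * k1 ^ 2) ?y) with ((128 * k1 ^ 2) * y).
    change (128 * k1 ^ 2 * (x - (2 * INR m + 1) / (2 * INR m + 2) * x) <= 128 * k1 ^ 2 * / (2 * INR m + 2) * x).
    right. field. pose proof (pos_INR m). lra.
Qed.

Lemma wallis_ratio_lim (s : C) : is_Clim (fun m => wallis (2 * m) s / wallis (2 * m) 0)%C (RtoC 1).
Proof.
  apply is_Clim_eps. intros eps He.
  destruct (wallis_diff s) as (K & HK & H).
  destruct (INR_unbounded (K / eps)) as [N HN].
  exists N. intros m Hm. specialize (H m).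
  destruct (wallis_even_0_pos m) as (x & Hx & E). rewrite E in *.
  assert (Hx0 : RtoC x <> 0) by (apply RtoC_neq0; lra).
  replace (wallis (2 * m) s / x - 1)%C with ((wallis (2 * m) s - x) / x)%C by (field; auto).
  rewrite Cmod_div by auto. rewrite Cmod_R, Rabs_pos_eq in * by lra.
  assert (INR N <= INR m) by now apply le_INR. pose proof (pos_INR m).
  eapply Rle_lt_trans with (K * / (2 * INR m + 2)).
  - apply (Rmult_le_reg_r x); auto. unfold Rdiv. rewrite Rmult_assoc, Rinv_l by lra. lra.
  - apply (Rmult_lt_reg_r (2 * INR m + 2)); [lra|]. rewrite Rmult_assoc, Rinv_l by lra.
    assert (K / eps * eps = K) by (field; lra). nra.
Qed.

Lemma inv_sine_prod_lim (s : C) : s <> 0 -> Csin (PI * s) <> 0 ->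
  is_Clim (fun m => / sine_prod s m)%C (PI * s / Csin (PI * s))%C.
Proof.
  intros Hs Hsin.
  assert (P0 : RtoC PI <> 0) by (apply RtoC_neq0, PI_neq0).
  replace (PI * s / Csin (PI * s))%C with (1 * (PI * s / Csin (PI * s)))%C by ring.
  apply (is_Clim_ext_loc (fun m => wallis (2 * m) s / wallis (2 * m) 0 * (PI * s / Csin (PI * s)))%C _ _ 0).
  - intros m _. pose proof (wallis_sine_prod m s) as E. rewrite wallis_0_0, wallis_0 in E by auto.
    destruct (wallis_even_0_pos m) as (x & Hx & Ex). rewrite Ex in *.
    assert (Hx0 : RtoC x <> 0) by (apply RtoC_neq0; lra).
    pose proof C2_neq0 as H2.
    (* Exhibiting an inverse shows at once that the partial product does not vanish. *)
    assert (Q : (sine_prod s m * (wallis (2 * m) s / x * (PI * s / Csin (PI * s))))%C = 1).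
    { replace (sine_prod s m * (wallis (2 * m) s / x * (PI * s / Csin (PI * s))))%C with
        ((sine_prod s m * wallis (2 * m) s * (PI / 2)) * (2 * s / (x * Csin (PI * s))))%C by (field; auto).
      rewrite E. field. auto. }
    assert (Qn : sine_prod s m <> 0).
    { intros Z. rewrite Z, Cmult_0_l in Q. apply RtoC_inj in Q. lra. }
    rewrite <- (Cmult_1_l (/ sine_prod s m)), <- Q. field. auto.
  - apply is_Clim_mult; [apply wallis_ratio_lim | apply is_Clim_const].
Qed.

(** Pairing k - s with k + s for 1 <= k <= n gives k^2 (1 - s^2 / k^2); the first factor - s and the
    last factor 1 + s + n are left over. *)
Lemma rising_reflection (s : C) (n : nat) :
  (rising (- s) n * rising (1 + s) n)%C =
  (- s * (1 + s + INR n) * (INR (fact n) * INR (fact n)) * sine_prod s n)%C.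
Proof.
  induction n as [|n IH].
  - rewrite !rising_0. cbn. ring.
  - rewrite !rising_S.
    replace (rising (- s) n * (- s + INR (S n)) * (rising (1 + s) n * (1 + s + INR (S n))))%C with
      (rising (- s) n * rising (1 + s) n * ((- s + INR (S n)) * (1 + s + INR (S n))))%C by ring.
    rewrite IH. cbn [sine_prod]. rewrite fact_simpl, mult_INR, RtoC_mult.
    pose proof (INR_S_neq0 n) as Hn.
    replace (RtoC (INR n)) with (INR (S n) - 1)%C by (rewrite S_INR, RtoC_plus; ring).
    field. auto.
Qed.

(** The powers n^(-s) and n^(1+s) multiply to n and the factorials cancel by [rising_reflection];
    what remains is - 1/s times n / (1 + s + n) times the inverse of the partial sine product. *)
Lemma CGamma_reflection (s : C) : (forall k : Z, s <> RtoC (IZR k)) -> Csin (PI * s) <> 0 ->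
  (CGamma (- s) * CGamma (1 + s))%C = (- PI / Csin (PI * s))%C.
Proof.
  intros Hs Hsin.
  assert (H1 : forall k, (- s + INR k)%C <> 0).
  { intros k E. apply (Hs (Z.of_nat k)). rewrite <- INR_IZR_INZ.
    replace (RtoC (INR k)) with (s + (- s + INR k))%C by ring. rewrite E; ring. }
  assert (H2 : forall k, (1 + s + INR k)%C <> 0).
  { intros k E. apply (Hs (- Z.of_nat (S k))%Z). rewrite opp_IZR, <- INR_IZR_INZ, S_INR, RtoC_opp, RtoC_plus.
    replace s with ((1 + s + INR k) - (INR k + 1))%C at 1 by ring. rewrite E; ring. }
  assert (H0 : s <> 0) by apply (Hs 0%Z).
  assert (P0 : RtoC PI <> 0) by (apply RtoC_neq0, PI_neq0).
  apply (is_Clim_unique (fun n => Gamma_seq (- s) n * Gamma_seq (1 + s) n)%C).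
  { apply is_Clim_mult; now apply CGamma_correct. }
  replace (- PI / Csin (PI * s))%C with (- / s * 1 * (PI * s / Csin (PI * s)))%C by (field; auto).
  apply (is_Clim_ext_loc (fun n => - / s * (INR n / (s + INR (S n))) * / sine_prod s n)%C _ _ 1).
  - intros n Hn. rewrite !Gamma_seq_rising.
    assert (Hr1 := rising_neq0 (- s) n H1). assert (Hr2 := rising_neq0 (1 + s) n H2).
    pose proof (rising_reflection s n) as E.
    assert (Hprod := Cmult_neq_0 _ _ Hr1 Hr2). rewrite E in Hprod.
    assert (Hf : RtoC (INR (fact n)) <> 0) by (apply RtoC_neq0, INR_fact_neq_0).
    assert (HQ : sine_prod s n <> 0) by (intros Z; apply Hprod; rewrite Z; ring).
    replace (s + INR (S n))%C with (1 + s + INR n)%C by (rewrite S_INR, RtoC_plus; ring).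
    replace (INR (fact n) * Cexp (- s * ln (INR n)) / rising (- s) n *
      (INR (fact n) * Cexp ((1 + s) * ln (INR n)) / rising (1 + s) n))%C with
      (INR (fact n) * INR (fact n) * (Cexp (- s * ln (INR n)) * Cexp ((1 + s) * ln (INR n))) /
        (rising (- s) n * rising (1 + s) n))%C by (field; auto).
    rewrite E, <- Cexp_plus.
    replace (- s * ln (INR n) + (1 + s) * ln (INR n))%C with (RtoC (ln (INR n))) by ring.
    rewrite Cexp_real, exp_ln by (apply lt_0_INR; lia).
    pose proof (H2 n). field. repeat split; auto.
  - apply is_Clim_mult; [|now apply inv_sine_prod_lim].
    apply is_Clim_mult; [apply is_Clim_const|]. apply is_Clim_ratio.
    intros k E. apply (Hs (- Z.of_nat k)%Z). rewrite opp_IZR, <- INR_IZR_INZ, RtoC_opp.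
    replace s with ((s + INR k) - INR k)%C at 1 by ring. rewrite E; ring.
Qed.

(** * Growth of Gamma and poles of the sine kernel *)

(** Compactness through [bisection_2d]: continuity bounds the function near each point, and the
    largest of four bounds serves a subdivided rectangle. *)
Lemma Re_bounded_below (f : C -> C) (a b c d : R) : a <= b -> c <= d ->
  (forall x y, a <= x <= b -> c <= y <= d -> ccont f (x, y)) ->
  exists B, forall x y, a <= x <= b -> c <= y <= d -> - B <= Re (f (x, y)).
Proof.
  intros Hab Hcd Hf.
  apply (bisection_2d (fun x1 x2 y1 y2 => exists B, forall x y, x1 <= x <= x2 -> y1 <= y <= y2 -> - B <= Re (f (x, y)))); auto.
  - intros x1 x2 y1 y2 _ _ _ _ _ _ [B1 H1] [B2 H2] [B3 H3] [B4 H4].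
    exists (Rmax (Rmax B1 B2) (Rmax B3 B4)). intros x y Hx Hy.
    pose proof (Rmax_l (Rmax B1 B2) (Rmax B3 B4)). pose proof (Rmax_r (Rmax B1 B2) (Rmax B3 B4)).
    pose proof (Rmax_l B1 B2). pose proof (Rmax_r B1 B2). pose proof (Rmax_l B3 B4). pose proof (Rmax_r B3 B4).
    destruct (Rle_dec x ((x1 + x2) / 2)); destruct (Rle_dec y ((y1 + y2) / 2)).
    + specialize (H1 x y ltac:(lra) ltac:(lra)); lra.
    + specialize (H3 x y ltac:(lra) ltac:(lra)); lra.
    + specialize (H2 x y ltac:(lra) ltac:(lra)); lra.
    + specialize (H4 x y ltac:(lra) ltac:(lra)); lra.
  - intros u v Hu Hv.
    destruct (proj1 (ccont_Cmod f (u, v)) (Hf u v Hu Hv) 1 Rlt_0_1) as (d0 & Hd & H).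
    exists (d0 / 2). split; [lra|]. intros x1 x2 y1 y2 A1 A2 A3 B1 B2 B3 D1 D2.
    exists (1 - Re (f (u, v))). intros x y Hx Hy.
    assert (M : Cmod (f (x, y) - f (u, v)) < 1).
    { apply H. eapply Rle_lt_trans; [apply Cmod_xy_le|].
      assert (Rabs (x - u) <= x2 - x1) by (apply Rabs_le; lra).
      assert (Rabs (y - v) <= y2 - y1) by (apply Rabs_le; lra). lra. }
    pose proof (re_le_Cmod (f (x, y) - f (u, v))) as M2.
    unfold Cminus in M2 at 1. rewrite re_plus, re_opp in M2.
    apply Rabs_le_between in M2. lra.
Qed.

(** The exponential of Re [LG] is |Gamma(a s + b)|, so the functional equation becomes additive:
    passing from s to s + 1/a adds ln |a s + b| to Re [LG], which exceeds the prescribed gain L / a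
    far to the right. What is left is a compact rectangle. *)
Lemma Re_LG_growth (a b : R) (LG : C -> C) (L Y : R) : 0 < a -> 0 < b -> 0 <= Y ->
  (forall x y, 0 <= x -> ccont LG (x, y)) ->
  (forall x y, 0 <= x -> Cexp (LG (x, y)) = CGamma (a * (x, y) + b)) ->
  exists K, forall x y, 0 <= x -> - Y <= y <= Y -> L * x - K <= Re (LG (x, y)).
Proof.
  intros Ha Hb HY Hc Hlog.
  (* Beyond [X0] the factor |a s + b| is at least exp (L / a), so one step of length 1/a gains L /
     a, exactly the increase of L x. *)
  set (X0 := exp (L / a) / a).
  assert (HX0 : 0 < X0) by (apply Rdiv_lt_0_compat; auto; apply exp_pos).
  assert (Hia : 0 < / a) by now apply Rinv_0_lt_compat.
  destruct (Re_bounded_below LG 0 (X0 + / a) (- Y) Y) as [B HB]; try lra.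
  { intros; apply Hc; lra. }
  (* On the base rectangle Re [LG] >= - B and L x <= |L| (X0 + 1/a). Its width includes one step, so
     the predecessor of a point to its right still lies beyond [X0]. *)
  exists (B + Rabs L * (X0 + / a)).
  assert (P : forall n x y, 0 <= x -> x <= X0 + / a + INR n * / a -> - Y <= y <= Y ->
    L * x - (B + Rabs L * (X0 + / a)) <= Re (LG (x, y))).
  { assert (Base : forall x y, 0 <= x <= X0 + / a -> - Y <= y <= Y -> L * x - (B + Rabs L * (X0 + / a)) <= Re (LG (x, y))).
    { intros x y Hx Hy. specialize (HB x y Hx Hy).
      assert (L * x <= Rabs L * x) by (apply Rmult_le_compat_r; [lra | apply Rle_abs]).
      assert (Rabs L * x <= Rabs L * (X0 + / a)) by (apply Rmult_le_compat_l; [apply Rabs_pos | lra]). lra. }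
    induction n as [|n IH]; intros x y H0 Hx Hy.
    - cbn in Hx. apply Base; lra.
    - destruct (Rle_dec x (X0 + / a)) as [H|H]; [apply Base; lra|].
      rewrite S_INR in Hx. specialize (IH (x - / a) y ltac:(lra) ltac:(lra) Hy).
      assert (E : exp (Re (LG (x, y))) = Cmod (a * ((x - / a)%R, y) + b) * exp (Re (LG ((x - / a)%R, y)))).
      { rewrite <- !Cmod_Cexp, !Hlog by lra. rewrite <- Cmod_mult, <- CGamma_succ.
        - f_equal. f_equal. unfold RtoC, Cplus, Cmult; cbn; f_equal; field; lra.
        - intros k Z. apply (f_equal Re) in Z.
          unfold RtoC, Cplus, Cmult, Re in Z; cbn [fst snd] in Z.
          pose proof (pos_INR k). assert (0 <= a * (x - / a)) by (apply Rmult_le_pos; lra). lra. }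
      assert (M : exp (L / a) <= Cmod (a * ((x - / a)%R, y) + b)).
      { eapply Rle_trans; [|apply re_le_Cmod].
        unfold RtoC, Cplus, Cmult, Re; cbn [fst snd].
        eapply Rle_trans; [|apply Rle_abs].
        assert (a * X0 <= a * (x - / a)) by (apply Rmult_le_compat_l; lra).
        replace (a * X0) with (exp (L / a)) in * by (unfold X0; field; lra). lra. }
      assert (F : exp (L / a + Re (LG ((x - / a)%R, y))) <= exp (Re (LG (x, y)))).
      { rewrite E, exp_plus. apply Rmult_le_compat_r; auto. left; apply exp_pos. }
      assert (F' : L / a + Re (LG ((x - / a)%R, y)) <= Re (LG (x, y))).
      { apply Rnot_lt_le. intros Q. apply exp_increasing in Q. lra. }
      replace (L * x) with (L / a + L * (x - / a)) by (field; lra). lra. }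
  intros x y Hx Hy. destruct (INR_unbounded (a * x)) as [n Hn].
  apply (P n x y); auto.
  apply Rmult_lt_compat_r with (r := / a) in Hn; auto.
  replace (a * x * / a) with x in Hn by (field; lra). lra.
Qed.

Lemma Csin_taylor1 (v : C) : Cmod (Csin v - v) <= 2 * Cmod v ^ 2 * exp (Cmod v).
Proof.
  assert (E : (Csin v - v)%C = (- Ci / 2 * ((Cexp (Ci * v) - 1 - Ci * v) + - (Cexp (- (Ci * v)) - 1 - - (Ci * v))))%C).
  { unfold Csin. transitivity (- Ci / 2 * (Cexp (Ci * v) - Cexp (- (Ci * v))) + (Ci * Ci) * v)%C.
    - rewrite Ci2. ring.
    - field. }
  assert (E2 : Cmod (- Ci / 2) = / 2).
  { rewrite Cmod_div by apply C2_neq0. rewrite Cmod_opp, Cmod_Ci, Cmod_R, Rabs_pos_eq; lra. }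
  rewrite E, Cmod_mult, E2.
  pose proof (Cexp_taylor1 (Ci * v)) as H1. pose proof (Cexp_taylor1 (- (Ci * v))) as H2.
  rewrite Cmod_opp in H2. rewrite Cmod_mult, Cmod_Ci, Rmult_1_l in H1, H2.
  pose proof (Cmod_triangle (Cexp (Ci * v) - 1 - Ci * v) (- (Cexp (- (Ci * v)) - 1 - - (Ci * v)))) as T.
  rewrite Cmod_opp in T. lra.
Qed.

Lemma Csin_PI_eq0 (s : C) : Csin (PI * s) = 0 -> exists k : Z, s = RtoC (IZR k).
Proof.
  destruct s as [x y]. intros E.
  replace (PI * (x, y))%C with ((PI * x)%R, (PI * y)%R) in E by (unfold RtoC, Cmult; cbn; f_equal; ring).
  pose proof PI_RGT_0 as HP.
  destruct (Req_dec y 0) as [->|Hy].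
  - pose proof (Cmod2_Csin (PI * x) (PI * 0)) as M. rewrite E, Cmod_0, Rmult_0_r, sinh_0 in M.
    assert (S : sin (PI * x) = 0) by (cbn in M; nra).
    destruct (sin_eq_0_0 _ S) as [k Hk]. exists k. unfold RtoC. f_equal.
    apply (Rmult_eq_reg_l PI); lra.
  - exfalso. apply (Csin_neq0_im (PI * x) (PI * y)); auto. intros Z. apply Rmult_integral in Z. lra.
Qed.

Definition sine_kernel (q : C -> C) (s : C) : C := (- PI / Csin (PI * s) * q s)%C.

Lemma Cdiff_sine_kernel (q : C -> C) (s l : C) :
  Cdiff q s l -> Csin (PI * s) <> 0 -> exists m, Cdiff (sine_kernel q) s m.
Proof.
  intros Hq Hs. eexists. unfold sine_kernel.
  apply (Cdiff_mult (fun s => - PI / Csin (PI * s))%C q); [|exact Hq].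
  apply (Cdiff_scal (- PI) (fun s => / Csin (PI * s))%C).
  apply (Cdiff_comp Cinv (fun s => Csin (PI * s))); [now apply Cdiff_inv|].
  apply (Cdiff_comp Csin (fun s => PI * s)%C); [apply Cdiff_Csin | apply Cdiff_lin].
Qed.

Lemma Cpow_m1_sqr (k : nat) : ((- (1)) ^ k * (- (1)) ^ k)%C = 1.
Proof. rewrite <- Cpow_mult_l. replace (- (1) * - (1))%C with (RtoC 1) by ring. apply Cpow_1_l. Qed.

Lemma Cmod_Cpow_m1 (k : nat) : Cmod ((- (1)) ^ k) = 1.
Proof. rewrite Cmod_pow, Cmod_m1. apply pow1. Qed.

(** Local input of [rect_simple_pole]: the remainder is bounded because [q] is differentiable at k
    and sin v = v + O(v^2). *)
Lemma sine_kernel_pole (q : C -> C) (k : nat) (l : C) : Cdiff q (INR k) l ->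
  exists B delta, 0 < delta /\ forall w, w <> RtoC (INR k) -> Cmod (w - INR k) < delta ->
    Cmod (sine_kernel q w - - (- (1)) ^ k * q (INR k) * / (w - INR k)) <= B.
Proof.
  intros Hq. pose proof PI_RGT_0 as HP. pose proof PI_4 as HP4.
  destruct (proj1 (Cdiff_eps q _ _) Hq 1 Rlt_0_1) as (d & Hd & H).
  (* With v = PI (w - k), the radius 1/48 and PI <= 4 give |v| <= 1/12, hence |sin v - v| <= 6 |v|^2
     <= |v| / 2. The bound adds 2 (|l| + 1) for the difference quotient of [q] and 12 PI |q k| for
     the error of the sine. *)
  exists (2 * (Cmod l + 1) + Cmod (q (INR k)) * (12 * PI)), (Rmin d (/ 48)).
  split; [apply Rmin_pos; lra|]. intros w Hw Hwd.
  assert (H1 := Rlt_le_trans _ _ _ Hwd (Rmin_l _ _)).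
  assert (H2 := Rlt_le_trans _ _ _ Hwd (Rmin_r _ _)). clear Hwd.
  set (u := (w - INR k)%C) in *. set (v := (PI * u)%C).
  assert (Ew : w = (u + INR k)%C) by (unfold u; ring).
  assert (Hu : u <> 0) by (intros Z; apply Hw; rewrite Ew, Z; ring).
  assert (P0 : RtoC PI <> 0) by (apply RtoC_neq0; lra).
  assert (Hv : v <> 0) by now apply Cmult_neq_0.
  assert (Mu : 0 < Cmod u) by now apply Cmod_gt_0.
  assert (Mv : 0 < Cmod v) by now apply Cmod_gt_0.
  assert (Evu : Cmod v = PI * Cmod u) by (unfold v; rewrite Cmod_mult, Cmod_R, Rabs_pos_eq; lra).
  assert (Mv1 : Cmod v <= / 12) by (rewrite Evu; nra).
  assert (T : Cmod (Csin v - v) <= 6 * Cmod v ^ 2).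
  { eapply Rle_trans; [apply Csin_taylor1|].
    assert (exp (Cmod v) <= 3) by (eapply Rle_trans; [apply (exp_le_compat _ 1); lra | apply exp_le_3]).
    pose proof (pow2_ge_0 (Cmod v)). nra. }
  assert (Ms : Cmod v / 2 <= Cmod (Csin v)).
  { pose proof (Cmod_triangle_minus v (Csin v)) as T2. rewrite Cmod_minus_sym in T2. nra. }
  assert (Hs : Csin v <> 0) by (apply Cmod_gt_0; lra).
  set (sg := ((- (1)) ^ k)%C).
  assert (Esg : (sg * sg)%C = 1) by apply Cpow_m1_sqr.
  assert (Hsg : sg <> 0) by (intros Z; rewrite Z, Cmult_0_l in Esg; apply RtoC_inj in Esg; lra).
  assert (Es : Csin (PI * w) = (sg * Csin v)%C).
  { replace (PI * w)%C with (v + INR k * PI)%C by (unfold v; rewrite Ew; ring).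
    rewrite Csin_PI_shift. reflexivity. }
  unfold sine_kernel. rewrite Es.
  (* One part carries the variation of [q], the other the error of replacing sin v by v;
     [sg * sg = 1] moves the sign to the numerator. *)
  replace (- PI / (sg * Csin v) * q w - - sg * q (INR k) * / u)%C with
    (- sg * ((q w - q (INR k)) / u * (v / Csin v) + q (INR k) * ((v - Csin v) / (u * Csin v))))%C.
  2:{ transitivity (- (sg * sg) * PI / (sg * Csin v) * q w - - sg * q (INR k) * / u)%C.
      - unfold v. field. fold v. auto.
      - rewrite Esg. replace (- (1) * PI)%C with (- PI)%C by ring. reflexivity. }
  rewrite Cmod_mult, Cmod_opp. unfold sg at 1. rewrite Cmod_Cpow_m1, Rmult_1_l.
  eapply Rle_trans; [apply Cmod_triangle|]. rewrite !Cmod_mult, !Cmod_div by (auto; now apply Cmult_neq_0).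
  rewrite Cmod_mult.
  apply Rplus_le_compat.
  - rewrite (Rmult_comm 2). apply Rmult_le_compat.
    + apply Rdiv_le_0_compat; [apply Cmod_ge_0 | auto].
    + apply Rdiv_le_0_compat; lra.
    + specialize (H w H1). rewrite Rmult_1_l in H. fold u in H.
      assert (Cmod (q w - q (INR k)) <= Cmod (l * u) + Cmod u).
      { pose proof (Cmod_triangle_minus (q w - q (INR k)) (l * u)). lra. }
      rewrite Cmod_mult in H0. apply (Rmult_le_reg_r (Cmod u)); auto.
      unfold Rdiv. rewrite Rmult_assoc, Rinv_l by lra. lra.
    + apply (Rmult_le_reg_r (Cmod (Csin v))); [lra|]. unfold Rdiv. rewrite Rmult_assoc, Rinv_l by lra. lra.
  - apply Rmult_le_compat_l; [apply Cmod_ge_0|].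
    apply (Rmult_le_reg_r (Cmod u * Cmod (Csin v))); [apply Rmult_lt_0_compat; lra|].
    unfold Rdiv. rewrite Rmult_assoc, Rinv_l by (apply Rgt_not_eq, Rmult_lt_0_compat; lra).
    rewrite Rmult_1_r, Cmod_minus_sym. eapply Rle_trans; [exact T|].
    replace (6 * Cmod v ^ 2) with (12 * PI * (Cmod u * (Cmod v / 2))) by (rewrite Evu; field).
    apply Rmult_le_compat_l; [lra|]. apply Rmult_le_compat_l; lra.
Qed.

(** Through |sinh y|, since sinh t >= t for t >= 0 by the mean value theorem. Being uniform in x,
    the bound controls the kernel near the heights of the two ends of the loop. *)
Lemma Cmod_Csin_ge_im (x y : R) : Rabs y <= Cmod (Csin (x, y)).
Proof.
  apply Rsqr_incr_0; [|apply Rabs_pos | apply Cmod_ge_0].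
  rewrite <- Rsqr_abs, !Rsqr_pow2, Cmod2_Csin.
  assert (Rabs y <= Rabs (sinh y)).
  { assert (P : forall t, 0 <= t -> t <= sinh t).
    { intros t Ht. unfold sinh.
      destruct (Rle_lt_or_eq_dec 0 t Ht) as [Hlt| <-]; [|rewrite Ropp_0; lra].
      destruct (MVT_gen (fun u => exp u - exp (- u)) 0 t (fun u => exp u + exp (- u))) as (c & Hc & E).
      - intros; auto_derive; auto; ring.
      - intros; apply derivable_continuous_pt, ex_derive_Reals_0; auto_derive; auto.
      - cbn in E. rewrite Ropp_0, exp_0 in E.
        assert (2 <= exp c + exp (- c)) by (pose proof (exp_ineq1_le c); pose proof (exp_ineq1_le (- c)); lra).
        assert (2 * t <= (exp c + exp (- c)) * t) by (apply Rmult_le_compat_r; lra). lra. }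
    destruct (Rle_dec 0 y) as [Hy|Hy].
    - rewrite (Rabs_pos_eq y) by auto. eapply Rle_trans; [now apply P | apply Rle_abs].
    - rewrite (Rabs_left1 y) by lra. eapply Rle_trans; [apply (P (- y)); lra|].
      rewrite <- Rabs_Ropp. replace (sinh (- y)) with (- sinh y) by (unfold sinh; rewrite Ropp_involutive; field).
      apply Rle_abs. }
  pose proof (pow2_ge_0 (sin x)). rewrite <- (pow2_abs y), <- (pow2_abs (sinh y)).
  pose proof (Rabs_pos y). nra.
Qed.

(** At a half-integer abscissa the term sin^2 equals 1 at every height; a vertical side placed there
    crosses the axis between two poles. *)
Lemma Cmod_Csin_half (n : nat) (y : R) : 1 <= Cmod (Csin (PI * ((INR n + / 2)%R, y))).
Proof.
  replace (PI * ((INR n + / 2)%R, y))%C with (((PI / 2)%R, (PI * y)%R) + INR n * PI)%C.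
  2:{ unfold RtoC, Cmult, Cplus; cbn; f_equal; field. }
  rewrite Csin_PI_shift, Cmod_mult, Cmod_Cpow_m1, Rmult_1_l.
  apply Rsqr_incr_0; [|lra | apply Cmod_ge_0].
  rewrite !Rsqr_pow2, Cmod2_Csin, sin_PI2. pose proof (pow2_ge_0 (sinh (PI * y))). lra.
Qed.

(** * A primitive on the doubly cut plane *)

Definition gap (x y : R) : Prop := y <> 0 \/ 0 < x < 1.

Lemma hint_swap (f : C -> C) (y a b : R) : ex_hint f y a b -> hint f y b a = (- hint f y a b)%C.
Proof.
  intros H. symmetry. apply (opp_RInt_swap (V := C_R_CompleteNormedModule)). exact H.
Qed.

Lemma vint_swap (f : C -> C) (x c d : R) : ex_vint f x c d -> vint f x d c = (- vint f x c d)%C.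
Proof.
  intros H. unfold vint.
  rewrite <- (opp_RInt_swap (V := C_R_CompleteNormedModule) _ _ _ H).
  change (opp ?u) with (- u)%C. ring.
Qed.

(** Exchanging two bounds only changes the sign of [rect]. This lets the primitive be compared at
    two points in any relative position. *)
Lemma goursat_unordered (f : C -> C) (a b c d : R) :
  (forall x y, Rmin a b <= x <= Rmax a b -> Rmin c d <= y <= Rmax c d -> exists l, Cdiff f (x, y) l) ->
  rect f a b c d = 0.
Proof.
  intros Hf.
  assert (Cf : forall x y, Rmin a b <= x <= Rmax a b -> Rmin c d <= y <= Rmax c d -> ccont f (x, y)).
  { intros x y Hx Hy. destruct (Hf x y Hx Hy) as [l Hl]. eapply Cdiff_cont; eauto. }
  assert (Eh : forall y, Rmin c d <= y <= Rmax c d -> ex_hint f y a b) by (intros; apply ex_hint_cont; auto).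
  assert (Ev : forall x, Rmin a b <= x <= Rmax a b -> ex_vint f x c d) by (intros; apply ex_vint_cont; auto).
  assert (Mab := conj (conj (Rmin_l a b) (Rmin_r a b)) (conj (Rmax_l a b) (Rmax_r a b))).
  assert (Mcd := conj (conj (Rmin_l c d) (Rmin_r c d)) (conj (Rmax_l c d) (Rmax_r c d))).
  assert (Z : rect f (Rmin a b) (Rmax a b) (Rmin c d) (Rmax c d) = 0) by (apply goursat; auto; lra).
  assert (Sx : rect f b a c d = (- rect f a b c d)%C).
  { unfold rect. rewrite !(hint_swap f _ a b) by (apply Eh; lra). ring. }
  assert (Sy : rect f a b d c = (- rect f a b c d)%C).
  { unfold rect. rewrite !(vint_swap f _ c d) by (apply Ev; lra). ring. }
  assert (Sxy : rect f b a d c = rect f a b c d).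
  { unfold rect. rewrite !(hint_swap f _ a b), !(vint_swap f _ c d) by (apply Eh; lra) || (apply Ev; lra). ring. }
  unfold Rmin, Rmax in Z. destruct (Rle_dec a b), (Rle_dec c d); auto.
  - rewrite Sy in Z. rewrite <- (Copp_0), <- Z. ring.
  - rewrite Sx in Z. rewrite <- (Copp_0), <- Z. ring.
  - rewrite Sxy in Z. auto.
Qed.

Lemma gap_cont (f : C -> C) : (forall x y, gap x y -> exists l, Cdiff f (x, y) l) ->
  forall x y, gap x y -> ccont f (x, y).
Proof. intros Hf x y H. destruct (Hf x y H) as [l Hl]. eapply Cdiff_cont; eauto. Qed.

(** The path runs from c vertically along Re = c, then horizontally to w. For c in (0,1) it stays in
    the cut plane whenever w does: the vertical part meets the axis at c, and a horizontal part on
    the axis joins two points of (0,1). *)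
Definition cross_primitive (f : C -> C) (c : R) (w : C) : C :=
  (vint f c 0 (Im w) + hint f (Im w) c (Re w))%C.

(** Goursat on the rectangle with opposite corners (c, y0) and (x0, y) exchanges the detour along Re
    = c for one along Re = x0. *)
Lemma cross_primitive_diff (f : C -> C) (c x0 y0 x y : R) : 0 < c < 1 ->
  (forall x y, gap x y -> exists l, Cdiff f (x, y) l) ->
  (forall u v, Rmin c x0 <= u <= Rmax c x0 -> Rmin y0 y <= v <= Rmax y0 y -> gap u v) ->
  (forall u, Rmin x0 x <= u <= Rmax x0 x -> gap u y) ->
  (cross_primitive f c (x, y) - cross_primitive f c (x0, y0))%C = (vint f x0 y0 y + hint f y x0 x)%C.
Proof.
  intros Hc Hf H1 H2. pose proof (gap_cont f Hf) as Cf.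
  assert (My := conj (conj (Rmin_l y0 y) (Rmin_r y0 y)) (conj (Rmax_l y0 y) (Rmax_r y0 y))).
  assert (Z : rect f c x0 y0 y = 0) by (apply goursat_unordered; intros; apply Hf; auto).
  unfold cross_primitive; cbn [Re Im fst snd].
  rewrite (vint_Chasles f c 0 y0 y) by (apply ex_vint_cont; intros; apply Cf; right; lra).
  rewrite (hint_Chasles f y c x0 x) by (apply ex_hint_cont; intros; apply Cf; [apply H1 + apply H2]; auto; lra).
  unfold rect in Z.
  transitivity ((vint f x0 y0 y + hint f y x0 x) - (hint f y0 c x0 - hint f y c x0 + (vint f x0 y0 y - vint f c y0 y)))%C.
  - ring.
  - rewrite Z. ring.
Qed.

Lemma Cdiff_cross_primitive (f : C -> C) (c x0 y0 : R) : 0 < c < 1 ->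
  (forall x y, gap x y -> exists l, Cdiff f (x, y) l) -> gap x0 y0 ->
  Cdiff (cross_primitive f c) (x0, y0) (f (x0, y0)).
Proof.
  intros Hc Hf Hgap. pose proof (gap_cont f Hf) as Cf.
  apply Cdiff_eps. intros eps He.
  destruct (proj1 (ccont_Cmod f (x0, y0)) (Cf _ _ Hgap) (eps / 2)) as (d1 & Hd1 & H1); [lra|].
  (* If y0 = 0, then x0 lies in (0,1) and the rectangles may cross the axis, since their abscissas
     stay in (0,1); otherwise y keeps the sign of y0 and they do not meet the axis. *)
  assert (Hd2 : exists d2, 0 < d2 /\ forall x y, Rabs (x - x0) < d2 -> Rabs (y - y0) < d2 ->
     (forall u v, Rmin c x0 <= u <= Rmax c x0 -> Rmin y0 y <= v <= Rmax y0 y -> gap u v) /\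
     (forall u v, Rmin x0 x <= u <= Rmax x0 x -> Rmin y0 y <= v <= Rmax y0 y -> gap u v)).
  { destruct (Req_dec y0 0) as [E|E].
    - destruct Hgap as [Hg|Hg]; [contradiction|].
      exists (Rmin x0 (1 - x0)). split; [apply Rmin_pos; lra|].
      intros x y Hx Hy. pose proof (Rmin_l x0 (1 - x0)). pose proof (Rmin_r x0 (1 - x0)).
      apply Rabs_def2 in Hx.
      split; intros u v Hu _; right.
      + revert Hu. unfold Rmin, Rmax. destruct (Rle_dec c x0); lra.
      + revert Hu. unfold Rmin at 1, Rmax. destruct (Rle_dec x0 x); lra.
    - exists (Rabs y0). split; [now apply Rabs_pos_lt|]. intros x y Hx Hy.
      assert (P : forall v, Rmin y0 y <= v <= Rmax y0 y -> v <> 0).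
      { intros v. unfold Rmin, Rmax. destruct (Rle_dec y0 y); intros Hv;
        unfold Rabs in Hy; destruct (Rcase_abs (y - y0)), (Rcase_abs y0); lra. }
      split; intros u v _ Hv; left; auto. }
  destruct Hd2 as (d2 & Hd2 & H2).
  exists (Rmin (d1 / 2) d2). split; [apply Rmin_pos; lra|].
  intros [x y] Hw.
  assert (W1 := Rlt_le_trans _ _ _ Hw (Rmin_l _ _)).
  assert (W2 := Rlt_le_trans _ _ _ Hw (Rmin_r _ _)).
  pose proof (re_le_Cmod ((x, y) - (x0, y0))) as Rx. pose proof (im_le_Cmod ((x, y) - (x0, y0))) as Ry.
  change (Rabs (x - x0) <= Cmod ((x, y) - (x0, y0))) in Rx.
  change (Rabs (y - y0) <= Cmod ((x, y) - (x0, y0))) in Ry.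
  destruct (H2 x y) as [A1 A2]; try lra.
  assert (My := conj (conj (Rmin_l y0 y) (Rmin_r y0 y)) (conj (Rmax_l y0 y) (Rmax_r y0 y))).
  assert (Mx := conj (conj (Rmin_l x0 x) (Rmin_r x0 x)) (conj (Rmax_l x0 x) (Rmax_r x0 x))).
  rewrite (cross_primitive_diff f c x0 y0 x y) by (auto; intros; apply A2; auto; lra).
  set (k := f (x0, y0)).
  assert (Hk : forall w, Cdiff (fun w => k * w)%C w ((fun _ => k) w)) by (intros; apply Cdiff_lin).
  assert (Ck : forall w, ccont (fun _ : C => k) w) by (intros; apply continuous_const).
  assert (Ev : ex_vint f x0 y0 y) by (apply ex_vint_cont; intros; apply Cf, A2; auto; lra).
  assert (Eh : ex_hint f y x0 x) by (apply ex_hint_cont; intros; apply Cf, A2; auto; lra).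
  assert (Evk : ex_vint (fun _ => k) x0 y0 y) by (apply ex_vint_cont; auto).
  assert (Ehk : ex_hint (fun _ => k) y x0 x) by (apply ex_hint_cont; auto).
  (* The linear term is the integral of the constant [k] over the same two segments, so only f - k
     is left, below [eps / 2] on each. *)
  replace (vint f x0 y0 y + hint f y x0 x - k * ((x, y) - (x0, y0)))%C with
    (vint (fun s => f s - k)%C x0 y0 y + hint (fun s => f s - k)%C y x0 x)%C.
  2:{ rewrite (vint_minus f (fun _ => k)), (hint_minus f (fun _ => k)) by auto.
      rewrite (vint_FTC (fun w => k * w)%C (fun _ => k)) by auto.
      rewrite (hint_FTC (fun w => k * w)%C (fun _ => k)) by auto. ring. }
  eapply Rle_trans; [apply Cmod_triangle|].
  assert (B1 : Cmod (vint (fun s => f s - k)%C x0 y0 y) <= Rabs (y - y0) * (eps / 2)).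
  { apply vint_bound.
    - apply ex_vint_cont. intros. apply (continuous_Cminus f (fun _ => k)); auto. apply Cf, A2; auto; lra.
    - intros v Hv. left. apply H1. eapply Rle_lt_trans; [apply Cmod_xy_le|].
      rewrite Rminus_diag, Rabs_R0.
      assert (Rabs (v - y0) <= Rabs (y - y0)).
      { revert Hv. unfold Rmin, Rmax. destruct (Rle_dec y0 y); intros Hv;
        [rewrite !Rabs_pos_eq | rewrite !Rabs_left1]; lra. }
      lra. }
  assert (B2 : Cmod (hint (fun s => f s - k)%C y x0 x) <= Rabs (x - x0) * (eps / 2)).
  { apply hint_bound.
    - apply ex_hint_cont. intros. apply (continuous_Cminus f (fun _ => k)); auto. apply Cf, A2; auto; lra.
    - intros u Hu. left. apply H1. eapply Rle_lt_trans; [apply Cmod_xy_le|].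
      assert (Rabs (u - x0) <= Rabs (x - x0)).
      { revert Hu. unfold Rmin, Rmax. destruct (Rle_dec x0 x); intros Hu;
        [rewrite !Rabs_pos_eq | rewrite !Rabs_left1]; lra. }
      lra. }
  set (m := Cmod ((x, y) - (x0, y0))) in *.
  assert (Rabs (y - y0) * (eps / 2) <= m * (eps / 2)) by (apply Rmult_le_compat_r; lra).
  assert (Rabs (x - x0) * (eps / 2) <= m * (eps / 2)) by (apply Rmult_le_compat_r; lra).
  lra.
Qed.

Lemma hint_exp_bound (f : C -> C) (y a b K : R) : a <= b -> 0 <= K -> ex_hint f y a b ->
  (forall x, a <= x <= b -> Cmod (f (x, y)) <= K * exp (- x)) ->
  Cmod (hint f y a b) <= K * exp (- a).
Proof.
  intros Hab HK He Hf.
  assert (I : is_RInt (fun x => K * exp (- x)) a b (minus (- K * exp (- b)) (- K * exp (- a)))).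
  { apply (is_RInt_derive (fun x => - K * exp (- x))).
    - intros x _. auto_derive; auto. ring.
    - intros x _. apply (ex_derive_continuous (V := R_NormedModule)). auto_derive. auto. }
  apply CInt_correct in He. unfold hint. rewrite Cmod_norm.
  eapply Rle_trans.
  - apply (norm_RInt_le (V := C_R_NormedModule) _ _ _ _ _ _ Hab) with (2 := He) (3 := I).
    intros x Hx. rewrite <- Cmod_norm. auto.
  - change (- K * exp (- b) - - K * exp (- a) <= K * exp (- a)).
    pose proof (exp_pos (- b)). nra.
Qed.

Lemma is_CInt_path (f : C -> C) (c : R) (p p' : R -> C) (T1 T2 : R) : 0 < c < 1 ->
  (forall x y, gap x y -> exists l, Cdiff f (x, y) l) ->
  (forall t, is_derive (K := R_AbsRing) (V := C_R_NormedModule) p t (p' t)) ->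
  (forall t, ccurve p' t) ->
  (forall t, Im (p t) = 0 -> Re (p t) = c) ->
  is_CInt (fun t => f (p t) * p' t)%C T1 T2 (cross_primitive f c (p T2) - cross_primitive f c (p T1))%C.
Proof.
  intros Hc Hf Hp Hp' Hcross.
  assert (Hg : forall t, gap (Re (p t)) (Im (p t))).
  { intros t. destruct (Req_dec (Im (p t)) 0) as [E|E]; [right; rewrite (Hcross t E); auto | now left]. }
  assert (Ep : forall t, p t = (Re (p t), Im (p t))) by (intros; apply surjective_pairing).
  apply (CInt_FTC (fun t => cross_primitive f c (p t))).
  - intros t _. apply is_derive_path; auto. rewrite Ep. now apply Cdiff_cross_primitive.
  - intros t _. apply (continuous_Cmult (fun t => f (p t)) p'); auto.
    apply (continuous_comp (V := C_UniformSpace) p f).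
    + apply (ex_derive_continuous (V := C_R_NormedModule)). exists (p' t). apply Hp.
    + rewrite Ep. now apply gap_cont.
Qed.

(** * The loop integral *)

(** Minus the residue of [sine_kernel q] at the pole k + 1; index 0 belongs to the pole 1, the first
    one enclosed by the loop. *)
Definition alt_term (q : C -> C) (k : nat) : C := ((- (1)) ^ S k * q (INR (S k)))%C.

Lemma sine_kernel_hol (q : C -> C) :
  (forall x y, y <> 0 \/ 0 < x -> exists l, Cdiff q (x, y) l) ->
  forall x y, y <> 0 \/ 0 < x -> (forall k : Z, (x, y) <> RtoC (IZR k)) ->
  exists l, Cdiff (sine_kernel q) (x, y) l.
Proof.
  intros Hq x y H Hk. destruct (Hq x y H) as [l Hl].
  apply (Cdiff_sine_kernel q _ l Hl). intros Z. destruct (Csin_PI_eq0 _ Z) as [k E]. now apply (Hk k).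
Qed.

Lemma not_integer_between (n : Z) (x y : R) : IZR n < x < IZR (n + 1) ->
  forall k : Z, ((x, y) : C) <> RtoC (IZR k).
Proof.
  intros [H1 H2] k E. injection E. intros _ ->. apply lt_IZR in H1. apply lt_IZR in H2. lia.
Qed.

Lemma sine_kernel_gap (q : C -> C) :
  (forall x y, y <> 0 \/ 0 < x -> exists l, Cdiff q (x, y) l) ->
  forall x y, gap x y -> exists l, Cdiff (sine_kernel q) (x, y) l.
Proof.
  intros Hq x y [H|H].
  - apply sine_kernel_hol; auto. intros k E. injection E. auto.
  - apply sine_kernel_hol; auto; [right; lra|]. apply (not_integer_between 0). cbn; lra.
Qed.

(** Cutting at half-integer abscissas isolates the poles 1, ..., n + 1, one per rectangle; [sum_n]
    up to n has n + 1 terms, whence [S n] in the right side. *)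
Lemma rect_sine_kernel (q : C -> C) (c phi1 phi2 : R) (n : nat) : 0 < c < 1 -> phi1 < 0 < phi2 ->
  (forall x y, y <> 0 \/ 0 < x -> exists l, Cdiff q (x, y) l) ->
  rect (sine_kernel q) c (INR (S n) + / 2) phi1 phi2 =
  (- (2 * PI * Ci * sum_n (G := C_AbelianMonoid) (alt_term q) n))%C.
Proof.
  intros Hc Hphi Hq.
  assert (Step : forall k a b, INR k - 1 < a < INR k -> INR k < b < INR k + 1 -> 0 < a ->
    rect (sine_kernel q) a b phi1 phi2 = (2 * PI * Ci * (- (- (1)) ^ k * q (INR k)))%C).
  { intros k a b H1 H2 H3.
    destruct (Hq (INR k) 0) as [l Hl]; [right; lra|].
    destruct (sine_kernel_pole q k l Hl) as (B & delta & Hd & HB).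
    apply (rect_simple_pole _ (INR k) _ a b phi1 phi2 B delta); auto; try lra.
    intros x y Hx Hy Hn. destruct (Req_dec y 0) as [->|Hy0].
    - apply sine_kernel_hol; auto; [right; lra|].
      assert (x <> INR k) by (intros ->; now apply Hn).
      destruct (Rlt_le_dec x (INR k)).
      + apply (not_integer_between (Z.of_nat k - 1)).
        replace (Z.of_nat k - 1 + 1)%Z with (Z.of_nat k) by ring. rewrite minus_IZR, <- INR_IZR_INZ. lra.
      + apply (not_integer_between (Z.of_nat k)). rewrite plus_IZR, <- INR_IZR_INZ. lra.
    - apply sine_kernel_gap; auto. now left. }
  induction n as [|n IH].
  - rewrite (Step 1%nat) by (cbn; lra). rewrite sum_O. unfold alt_term. ring.
  - rewrite (rect_split_x _ c (INR (S n) + / 2)).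
    + rewrite IH, (Step (S (S n))).
      * rewrite sum_Sn. unfold alt_term at 3. change (plus ?u ?v) with (u + v)%C. ring.
      * rewrite (S_INR (S n)). lra.
      * lra.
      * pose proof (pos_INR (S n)). lra.
    + rewrite (S_INR (S n)). pose proof (pos_INR n). rewrite S_INR. lra.
    + apply ex_hint_cont. intros. apply (gap_cont _ (sine_kernel_gap q Hq)). left; lra.
    + apply ex_hint_cont. intros. apply (gap_cont _ (sine_kernel_gap q Hq)). left; lra.
Qed.

Lemma Cmod_sine_kernel (q : C -> C) (x y B m : R) : 0 < m -> m <= Cmod (Csin (PI * (x, y))) ->
  Cmod (q (x, y)) <= B -> Cmod (sine_kernel q (x, y)) <= PI / m * B.
Proof.
  intros Hm Hs Hq. pose proof PI_RGT_0. unfold sine_kernel.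
  rewrite Cmod_mult, Cmod_div by (apply Cmod_gt_0; lra).
  rewrite Cmod_opp, Cmod_R, Rabs_pos_eq by lra.
  apply Rmult_le_compat; auto; try apply Cmod_ge_0.
  - apply Rdiv_le_0_compat; lra.
  - unfold Rdiv. apply Rmult_le_compat_l; [lra|]. apply Rinv_le_contravar; lra.
Qed.

Lemma ex_series_alt_term (q : C -> C) (K : R) :
  (forall x, 0 <= x -> Cmod (q (x, 0)) <= K * exp (- x)) ->
  exists S, is_series (K := C_AbsRing) (V := C_NormedModule) (alt_term q) S.
Proof.
  intros Hq.
  apply (ex_series_le (K := C_AbsRing) (V := C_CompleteNormedModule) (alt_term q) (fun k => K * (exp (- 1)) ^ k)).
  - intros n. change (norm (alt_term q n)) with (Cmod (alt_term q n)).
    unfold alt_term. rewrite Cmod_mult, Cmod_Cpow_m1, Rmult_1_l.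
    eapply Rle_trans; [apply (Hq (INR (S n))); apply pos_INR|].
    assert (HK : 0 <= K).
    { specialize (Hq 0 (Rle_refl 0)). rewrite Ropp_0, exp_0 in Hq.
      pose proof (Cmod_ge_0 (q (0, 0))). lra. }
    apply Rmult_le_compat_l; auto.
    replace (exp (- 1) ^ n) with (exp (- INR n)).
    + apply exp_le_compat. rewrite S_INR. lra.
    + induction n as [|n IH]; [cbn; rewrite Ropp_0; apply exp_0|].
      cbn [pow]. rewrite <- IH, <- exp_plus, S_INR. f_equal. ring.
  - apply (ex_series_scal (K := R_AbsRing) (V := R_NormedModule) K (fun k => exp (- 1) ^ k)). exists (/ (1 - exp (- 1))). apply is_series_geom.
    rewrite Rabs_pos_eq by (left; apply exp_pos). rewrite <- exp_0. apply exp_increasing. lra.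
Qed.

(** With X = n + 3/2, the increment of the primitive from (X, phi1) to (X, phi2) is the integral
    over the right side minus that over the rectangle, hence 2 PI i times a partial sum up to a term
    of order exp(- n). The ends of the loop are then joined to these two points. *)
Theorem sine_kernel_loop (q : C -> C) (c phi1 phi2 : R) (p p' : R -> C) :
  0 < c < 1 -> phi1 < 0 < phi2 ->
  (forall x y, y <> 0 \/ 0 < x -> exists l, Cdiff q (x, y) l) ->
  (forall Y, exists K, forall x y, 0 <= x -> - Y <= y <= Y -> Cmod (q (x, y)) <= K * exp (- x)) ->
  (forall t, is_derive (K := R_AbsRing) (V := C_R_NormedModule) p t (p' t)) ->
  (forall t, ccurve p' t) ->
  (forall t, Im (p t) = 0 -> Re (p t) = c) ->
  filterlim (fun t => Re (p t)) (Rbar_locally m_infty) (Rbar_locally p_infty) ->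
  filterlim (fun t => Im (p t)) (Rbar_locally m_infty) (locally phi1) ->
  filterlim (fun t => Re (p t)) (Rbar_locally p_infty) (Rbar_locally p_infty) ->
  filterlim (fun t => Im (p t)) (Rbar_locally p_infty) (locally phi2) ->
  exists l, is_series (K := C_AbsRing) (V := C_NormedModule) (alt_term q) l /\
    is_RInt_gen (V := C_R_NormedModule) (fun t => sine_kernel q (p t) * p' t)%C
      (Rbar_locally m_infty) (Rbar_locally p_infty) (2 * PI * Ci * l)%C.
Proof.
  intros Hc Hphi Hq Hdec Hp Hp' Hcross Hr1 Hi1 Hr2 Hi2.
  (* A height that covers both ends of the loop with the margin [m] chosen below. *)
  set (Y := 2 * (phi2 - phi1)).
  destruct (Hdec Y) as [K HK].
  assert (HK0 : 0 <= K).
  { specialize (HK 0 0 (Rle_refl 0) ltac:(unfold Y; lra)). rewrite Ropp_0, exp_0 in HK.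
    pose proof (Cmod_ge_0 (q (0, 0))). lra. }
  destruct (ex_series_alt_term q K) as [l HS].
  { intros x Hx. apply HK; auto. unfold Y; lra. }
  exists l. split; auto.
  set (f := sine_kernel q). set (G := cross_primitive f c).
  assert (Hf : forall x y, gap x y -> exists l, Cdiff f (x, y) l) by now apply sine_kernel_gap.
  assert (Cf := gap_cont f Hf).
  pose proof PI_RGT_0 as HPI. pose proof PI2_1 as HPI1.
  (* A point within [m] of the height phi1 or phi2 stays at distance at least [m] from the axis. *)
  set (m := Rmin (- phi1 / 2) (phi2 / 2)).
  assert (Hm : 0 < m) by (apply Rmin_pos; lra).
  assert (Hm1 := Rmin_l (- phi1 / 2) (phi2 / 2)). assert (Hm2 := Rmin_r (- phi1 / 2) (phi2 / 2)). fold m in Hm1, Hm2.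
  set (M := PI / m * K).
  assert (HM : 0 <= M) by (unfold M; apply Rmult_le_pos; auto; apply Rdiv_le_0_compat; lra).
  assert (Bf : forall x y, 0 <= x -> m <= Rabs y -> - Y <= y <= Y -> Cmod (f (x, y)) <= M * exp (- x)).
  { intros x y Hx Hy HY. unfold M. rewrite Rmult_assoc. apply Cmod_sine_kernel; auto.
    replace (PI * (x, y))%C with ((PI * x)%R, (PI * y)%R) by (unfold RtoC, Cmult; cbn; f_equal; ring).
    eapply Rle_trans; [|apply Cmod_Csin_ge_im]. rewrite Rabs_mult, (Rabs_pos_eq PI) by lra.
    pose proof (Rabs_pos y). nra. }
  assert (Bhalf : forall n y, - Y <= y <= Y -> Cmod (f ((INR n + / 2)%R, y)) <= PI / 1 * (K * exp (- INR n))).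
  { intros n y HY. pose proof (pos_INR n). apply Cmod_sine_kernel; [lra | apply Cmod_Csin_half|].
    eapply Rle_trans; [apply HK; auto; lra|]. apply Rmult_le_compat_l; auto. apply exp_le_compat. lra. }
  (* From (n + 1/2, phi) to (x, y): vertically by less than [m], then to the right; both pieces
     avoid the axis and are of order exp(- n). *)
  assert (Side : forall phi n x y, (phi = phi1 \/ phi = phi2) -> Rabs (y - phi) < m -> INR n + / 2 <= x ->
    Cmod (G (x, y) - G ((INR n + / 2)%R, phi)) <= M * (m + 1) * exp (- INR n)).
  { intros phi n x y Hphi' Hy Hx. pose proof (pos_INR n).
    assert (Hs : forall v, Rmin phi y <= v <= Rmax phi y -> m <= Rabs v /\ v <> 0 /\ - Y <= v <= Y).
    { intros v Hv. apply Rabs_def2 in Hy.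
      assert (phi - m <= v <= phi + m) by (revert Hv; unfold Rmin, Rmax; destruct (Rle_dec phi y); lra).
      destruct Hphi' as [-> | ->]; unfold Y.
      - rewrite Rabs_left1 by lra. lra.
      - rewrite Rabs_pos_eq by lra. lra. }
    assert (My := conj (conj (Rmin_l phi y) (Rmin_r phi y)) (conj (Rmax_l phi y) (Rmax_r phi y))).
    unfold G. rewrite cross_primitive_diff; auto.
    2:{ intros u v _ Hv. left. now apply Hs. }
    2:{ intros u _. left. apply Hs. lra. }
    assert (Ee : exp (- (INR n + / 2)) <= exp (- INR n)) by (apply exp_le_compat; lra).
    eapply Rle_trans; [apply Cmod_triangle|].
    assert (V : Cmod (vint f (INR n + / 2) phi y) <= Rabs (y - phi) * (M * exp (- INR n))).
    { apply vint_bound.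
      - apply ex_vint_cont. intros v Hv. apply Cf. left. now apply Hs.
      - intros v Hv. destruct (Hs v Hv) as (A & B & D).
        eapply Rle_trans; [apply Bf; auto; lra|]. now apply Rmult_le_compat_l. }
    assert (Hh : Cmod (hint f y (INR n + / 2) x) <= M * exp (- (INR n + / 2))).
    { destruct (Hs y ltac:(lra)) as (A & B & D). apply hint_exp_bound; auto.
      - apply ex_hint_cont. intros. apply Cf. now left.
      - intros u Hu. apply Bf; auto; lra. }
    assert (0 <= M * exp (- INR n)) by (apply Rmult_le_pos; auto; left; apply exp_pos).
    assert (Rabs (y - phi) * (M * exp (- INR n)) <= m * (M * exp (- INR n))) by (apply Rmult_le_compat_r; lra).
    assert (M * exp (- (INR n + / 2)) <= M * exp (- INR n)) by (now apply Rmult_le_compat_l).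
    lra. }
  set (T := fun n => sum_n (G := C_AbelianMonoid) (alt_term q) n).
  (* The difference is exactly the integral over the right side of the rectangle, where |sin(PI s)|
     >= 1. *)
  assert (Mid : forall n, Cmod (G ((INR (S n) + / 2)%R, phi2) - G ((INR (S n) + / 2)%R, phi1) - 2 * PI * Ci * T n) <=
     (phi2 - phi1) * (PI * K) * exp (- INR (S n))).
  { intros n. set (X := INR (S n) + / 2).
    pose proof (rect_sine_kernel q c phi1 phi2 n Hc Hphi Hq) as E. fold f X (T n) in E.
    assert (HX : 0 < X) by (unfold X; pose proof (pos_INR (S n)); lra).
    assert (EX : ex_vint f X phi1 phi2).
    { apply ex_vint_cont. rewrite Rmin_left, Rmax_right by lra. intros y Hy.
      destruct (sine_kernel_hol q Hq X y) as [l' Hl]; [right; lra | | eapply Cdiff_cont; eauto].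
      apply (not_integer_between (Z.of_nat (S n))). rewrite plus_IZR, <- INR_IZR_INZ. unfold X; lra. }
    assert (Ev : forall u v, ex_vint f c u v) by (intros; apply ex_vint_cont; intros; apply Cf; right; lra).
    replace (G (X, phi2) - G (X, phi1) - 2 * PI * Ci * T n)%C with (vint f X phi1 phi2).
    - eapply Rle_trans; [apply (vint_bound f X phi1 phi2 (PI / 1 * (K * exp (- INR (S n))))); auto|].
      + rewrite Rmin_left, Rmax_right by lra. intros. apply Bhalf. unfold Y; lra.
      + rewrite Rabs_pos_eq by lra. right. field.
    - unfold G, cross_primitive; cbn [Re Im fst snd].
      rewrite (vint_Chasles f c 0 phi1 phi2) by auto.
      transitivity (vint f c phi1 phi2 + hint f phi2 c X - hint f phi1 c X + rect f c X phi1 phi2)%C.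
      + unfold rect. ring.
      + rewrite E. ring. }
  intros P HP. apply (locally_Cmod (2 * PI * Ci * l)%C) in HP. destruct HP as (eps & He & HP).
  set (A := 2 * (M * (m + 1)) + (phi2 - phi1) * (PI * K) + 1).
  assert (HA : 0 < A).
  { unfold A. assert (0 <= M * (m + 1)) by (apply Rmult_le_pos; lra).
    assert (0 <= (phi2 - phi1) * (PI * K)) by (apply Rmult_le_pos; [lra | apply Rmult_le_pos; lra]). lra. }
  (* [n] is fixed before the parameters: the ends then only have to pass the abscissa n + 3/2 and
     come within [m] of their limiting heights. *)
  assert (HN : exists n, A * exp (- INR (S n)) < eps / 2 /\ Cmod (T n - l) < eps / 2 / (2 * PI)).
  { assert (He3 : 0 < eps / 2 / (2 * PI)) by (repeat apply Rdiv_lt_0_compat; lra).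
    destruct (proj1 (is_Clim_eps T l) HS _ He3) as [N1 HN1].
    destruct (INR_unbounded (A / (eps / 2))) as [N2 HN2].
    exists (max N1 N2). split; [|apply HN1; lia].
    assert (L : A / (eps / 2) < exp (INR (S (max N1 N2)))).
    { eapply Rlt_le_trans; [exact HN2|]. eapply Rle_trans; [|apply exp_ineq1_le].
      assert (INR N2 <= INR (S (max N1 N2))) by (apply le_INR; lia). lra. }
    rewrite exp_Ropp. apply (Rmult_lt_reg_r (exp (INR (S (max N1 N2))))); [apply exp_pos|].
    rewrite Rmult_assoc, Rinv_l by (apply Rgt_not_eq, exp_pos).
    apply Rmult_lt_compat_l with (r := eps / 2) in L; [|lra].
    replace (eps / 2 * (A / (eps / 2))) with A in L by (field; lra). lra. }
  destruct HN as (n & HN1 & HN2).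
  assert (Near : forall F phi, filterlim (fun t => Re (p t)) F (Rbar_locally p_infty) ->
    filterlim (fun t => Im (p t)) F (locally phi) -> Filter F ->
    F (fun t => INR (S n) + / 2 <= Re (p t) /\ Rabs (Im (p t) - phi) < m)).
  { intros F phi HR HI FF. apply filter_and.
    - apply (HR (fun x => INR (S n) + / 2 <= x)). exists (INR (S n) + / 2). intros; lra.
    - apply (HI (fun y => Rabs (y - phi) < m)). exists (mkposreal m Hm). intros y Hy. exact Hy. }
  apply (Filter_prod _ _ _ _ _ (Near _ _ Hr1 Hi1 _) (Near _ _ Hr2 Hi2 _)).
  intros T1 T2 [A1 B1] [A2 B2]. cbn [fst snd].
  exists (G (p T2) - G (p T1))%C. split.
  { now apply is_CInt_path. }
  apply HP.
  pose proof (Side phi1 (S n) (Re (p T1)) (Im (p T1)) (or_introl eq_refl) B1 A1) as S1.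
  pose proof (Side phi2 (S n) (Re (p T2)) (Im (p T2)) (or_intror eq_refl) B2 A2) as S2.
  specialize (Mid n).
  change (Re (p T1), Im (p T1)) with (fst (p T1), snd (p T1)) in S1. rewrite <- surjective_pairing in S1.
  change (Re (p T2), Im (p T2)) with (fst (p T2), snd (p T2)) in S2. rewrite <- surjective_pairing in S2.
  set (X := INR (S n) + / 2) in *.
  (* The error splits into the two ends, the right side of the rectangle and the tail of the
     series. *)
  replace (G (p T2) - G (p T1) - 2 * PI * Ci * l)%C with
    ((G (p T2) - G (X, phi2)) + (- (G (p T1) - G (X, phi1)) +
      ((G (X, phi2) - G (X, phi1) - 2 * PI * Ci * T n) + 2 * PI * Ci * (T n - l))))%C by ring.
  eapply Rle_lt_trans; [apply Cmod_triangle|].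
  eapply Rle_lt_trans; [apply Rplus_le_compat_l, Cmod_triangle|].
  eapply Rle_lt_trans; [apply Rplus_le_compat_l, Rplus_le_compat_l, Cmod_triangle|].
  rewrite Cmod_opp.
  assert (S4 : Cmod (2 * PI * Ci * (T n - l)) < eps / 2).
  { rewrite !Cmod_mult, Cmod_Ci, !Cmod_R, (Rabs_pos_eq 2), (Rabs_pos_eq PI), Rmult_1_r by lra.
    apply Rmult_lt_compat_l with (r := 2 * PI) in HN2; [|lra].
    replace (2 * PI * (eps / 2 / (2 * PI))) with (eps / 2) in HN2 by (field; lra). exact HN2. }
  pose proof (exp_pos (- INR (S n))). unfold A in HN1. nra.
Qed.

(** * The theorem *)

Lemma ex_derive_Cdiff (f : C -> C) (s : C) :
  ex_derive (K := C_AbsRing) (V := C_NormedModule) f s -> exists l, Cdiff f s l.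
Proof.
  intros [l [_ H]]. exists l. apply Cdiff_eps. intros eps He.
  specialize (H s (fun P HP => HP) (mkposreal eps He)).
  destruct H as [d Hd]. exists d. split; [apply cond_pos|].
  intros w Hw. specialize (Hd w Hw).
  assert (NC : forall u : C, norm (K := C_AbsRing) (V := C_NormedModule) u = Cmod u) by reflexivity.
  rewrite NC in Hd.
  change (Cmod (f w - f s - (w - s) * l) <= eps * Cmod (w - s)) in Hd.
  now rewrite (Cmult_comm (w - s)) in Hd.
Qed.

Theorem theorem2p2
  (a b g : R) (Ha : 0 < a) (Hb : 0 < b) (Hg : 0 < g)
  (* LG is a holomorphic logarithm of s |-> Gamma(a s + b) on C \ (-oo, -b/a],
     real on the real half-line s > -b/a; then [Gamma(a s + b)]^g := exp (g * LG s)
     is the branch, holomorphic on C \ (-oo,-b/a], positive for real s > -b/a. *)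
  (LG : C -> C)
  (HLG_hol : forall s : C, cut_plane (- b / a) s ->
       ex_derive (K := C_AbsRing) (V := C_NormedModule) LG s)
  (HLG_log : forall s : C, cut_plane (- b / a) s ->
       Cexp (LG s) = CGamma (Cplus (Cmult (RtoC a) s) (RtoC b)))
  (HLG_real : forall x : R, - b / a < x -> Im (LG (RtoC x)) = 0)
  (* z in C \ (-oo,0], theta a value of arg(-z) *)
  (z : C) (Hz : cut_plane 0 z)
  (theta : R) (Htheta : Copp z = Cmult (RtoC (Cmod z)) (cos theta, sin theta))
  (* the loop L_{+oo}, parametrized by a C^1 map p : R -> C with derivative p' *)
  (p p' : R -> C)
  (Hp_der : forall t : R, is_derive (K := R_AbsRing) (V := C_R_NormedModule) p t (p' t))
  (Hp'_cont : forall t : R, continuous (U := C_R_NormedModule) p' t)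
  (M : R) (Hstrip : forall t : R, Rabs (Im (p t)) <= M)
  (phi1 phi2 : R) (Hphi1 : phi1 < 0) (Hphi2 : 0 < phi2)
  (Hstart_re : filterlim (fun t => Re (p t)) (Rbar_locally m_infty) (Rbar_locally p_infty))
  (Hstart_im : filterlim (fun t => Im (p t)) (Rbar_locally m_infty) (locally phi1))
  (Hend_re : filterlim (fun t => Re (p t)) (Rbar_locally p_infty) (Rbar_locally p_infty))
  (Hend_im : filterlim (fun t => Im (p t)) (Rbar_locally p_infty) (locally phi2))
  (c : R) (Hc0 : 0 < c) (Hc1 : c < 1)
  (Hcross : forall t : R, Im (p t) = 0 -> Re (p t) = c) :
  let integrand (s : C) : C :=
    Cmult (Cdiv (Cmult (CGamma (Copp s)) (CGamma (Cplus (RtoC 1) s))) (Cexp (Cmult (RtoC g) (LG s))))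
          (Cexp (Cmult s (ln (Cmod z), theta))) in
  exists I : C,
    is_RInt_gen (V := C_R_NormedModule) (fun t => Cmult (integrand (p t)) (p' t))
      (Rbar_locally m_infty) (Rbar_locally p_infty) I /\
    is_series (K := C_AbsRing) (V := C_NormedModule) (LeRoy_term a b g z)
      (Cplus (Cdiv I (Cmult (RtoC (2 * PI)) Ci)) (RtoC (/ GammaPow b g))).
Proof.
  intros integrand.
  set (lz := (ln (Cmod z), theta) : C) in *.
  assert (Hz0 : 0 < Cmod z).
  { apply Cmod_gt_0. intros ->. apply Hz. cbn. split; [reflexivity | lra]. }
  assert (Hba : - b / a < 0).
  { unfold Rdiv. rewrite Ropp_mult_distr_l_reverse. apply Ropp_lt_gt_0_contravar, Rdiv_lt_0_compat; auto. }
  assert (Hcut : forall x y, y <> 0 \/ 0 <= x -> cut_plane (- b / a) (x, y)).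
  { intros x y Hxy [E1 E2]. cbn in E1, E2. destruct Hxy; [contradiction | lra]. }
  assert (HLG : forall x y, y <> 0 \/ 0 <= x -> exists l, Cdiff LG (x, y) l).
  { intros x y Hxy. apply ex_derive_Cdiff, HLG_hol. now apply Hcut. }
  set (q := fun s : C => (Cexp (lz * s) / Cexp (g * LG s))%C).
  assert (Hq : forall x y, y <> 0 \/ 0 < x -> exists l, Cdiff q (x, y) l).
  { intros x y Hxy. destruct (HLG x y) as [l Hl]; [destruct Hxy; [now left | right; lra]|].
    eexists. unfold q.
    apply (Cdiff_mult (fun s => Cexp (lz * s)) (fun s => / Cexp (g * LG s))%C).
    - apply Cdiff_exp_lin.
    - apply (Cdiff_comp Cinv (fun s => Cexp (g * LG s))); [apply Cdiff_inv, Cexp_neq0|].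
      apply (Cdiff_comp Cexp (fun s => g * LG s)%C); [apply Cdiff_Cexp | apply Cdiff_scal; exact Hl]. }
  assert (Hdec : forall Y, exists K, forall x y, 0 <= x -> - Y <= y <= Y -> Cmod (q (x, y)) <= K * exp (- x)).
  { intros Y. destruct (Rlt_le_dec Y 0) as [HY|HY]; [exists 0; intros; lra|].
    (* After multiplication by [g] this slope beats |z|^x and leaves exp(- x). *)
    destruct (Re_LG_growth a b LG ((ln (Cmod z) + 1) / g) Y Ha Hb HY) as [K HK].
    { intros x y Hx. destruct (HLG x y (or_intror Hx)) as [l Hl]. eapply Cdiff_cont; eauto. }
    { intros x y Hx. apply HLG_log. auto. }
    (* The argument of -z contributes exp(- theta y), at most exp(|theta| Y) in the strip. *)
    exists (exp (g * K + Y * Rabs theta)). intros x y Hx Hy. specialize (HK x y Hx Hy).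
    unfold q. rewrite Cmod_div, !Cmod_Cexp, re_scal_l by apply Cexp_neq0.
    unfold Rdiv. rewrite <- exp_Ropp, <- !exp_plus. apply exp_le_compat.
    unfold lz. rewrite re_mult. cbn [Re Im fst snd].
    assert (E : g * ((ln (Cmod z) + 1) / g * x - K) <= g * Re (LG (x, y))) by (apply Rmult_le_compat_l; lra).
    replace (g * ((ln (Cmod z) + 1) / g * x - K)) with (ln (Cmod z) * x + x - g * K) in E by (field; lra).
    assert (- (theta * y) <= Rabs theta * Y).
    { eapply Rle_trans; [apply Rle_abs|]. rewrite Rabs_Ropp, Rabs_mult.
      apply Rmult_le_compat_l; [apply Rabs_pos | now apply Rabs_le]. }
    cbn [Re fst] in E. lra. }
  destruct (sine_kernel_loop q c phi1 phi2 p p' (conj Hc0 Hc1) (conj Hphi1 Hphi2) Hq Hdec Hp_der Hp'_cont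
    Hcross Hstart_re Hstart_im Hend_re Hend_im) as (l & Hl & Hint).
  exists (2 * PI * Ci * l)%C. split.
  - refine (is_RInt_gen_ext _ _ _ _ Hint). apply filter_forall. intros _ t _. cbn beta. f_equal. unfold integrand, sine_kernel, q.
    (* The reflection formula applies all along the loop: a real point of it is c, strictly between
       0 and 1. *)
    assert (Hn : forall k : Z, p t <> RtoC (IZR k)).
    { intros k E. assert (Ei : Im (p t) = 0) by (rewrite E; reflexivity).
      pose proof (Hcross t Ei) as Er. rewrite E, re_RtoC in Er.
      assert (H0 : 0 < IZR k < 1) by lra. destruct H0 as [H0 H1].
      apply lt_IZR in H0. apply lt_IZR in H1. lia. }
    rewrite CGamma_reflection, (Cmult_comm lz); auto.
    + unfold Cdiv. ring.
    + intros Z. destruct (Csin_PI_eq0 _ Z) as [k E]. now apply (Hn k).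
  - assert (Hpi : RtoC PI <> 0) by (apply RtoC_neq0, PI_neq0).
    assert (Hci : Ci <> 0) by (apply Cmod_gt_0; rewrite Cmod_Ci; lra).
    assert (EI : (2 * PI * Ci * l / ((2 * PI)%R * Ci))%C = l) by (rewrite RtoC_mult; field; auto).
    (* At an integer the power (-z)^k depends only on -z and not on the choice of [theta], and its
       sign cancels that of the residue. Since [LG] is real there, the [ln] inside [Rpower] is taken
       of a real exponential. *)
    assert (ET : forall k, LeRoy_term a b g z (S k) = alt_term q k).
    { intros k. unfold LeRoy_term, alt_term, q, GammaPow.
      assert (Hk : - b / a < INR (S k)) by (pose proof (pos_INR (S k)); lra).
      replace (RtoC (a * INR (S k) + b)) with (a * INR (S k) + b)%C by now rewrite RtoC_plus, RtoC_mult.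
      rewrite <- HLG_log by (apply Hcut; right; apply pos_INR).
      assert (EL : LG (INR (S k)) = RtoC (Re (LG (INR (S k))))).
      { rewrite (surjective_pairing (LG (INR (S k)))) at 1. unfold RtoC. f_equal. now apply HLG_real. }
      rewrite EL, Cexp_real, re_RtoC. unfold Rpower. rewrite ln_exp, <- RtoC_mult, Cexp_real.
      rewrite (Cmult_comm lz), Cexp_nat.
      assert (Ez : Cexp lz = (- z)%C).
      { rewrite Htheta. unfold lz, Cexp; cbn [Re Im fst snd]. rewrite exp_ln by auto.
        unfold RtoC, Cmult; cbn [fst snd]. f_equal; ring. }
      rewrite Ez. unfold Cdiv. rewrite Cmult_assoc, <- Cpow_mult_l. f_equal. f_equal. ring. }
    rewrite EI. apply is_series_decr_1.
    apply (is_series_ext (alt_term q)); [intros; now rewrite ET|].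
    (* The term k = 0 belongs to the pole that the loop leaves outside; it is the constant added to
       the integral. *)
    assert (E0 : LeRoy_term a b g z 0 = RtoC (/ GammaPow b g)).
    { unfold LeRoy_term. cbn [INR Cpow]. rewrite Rmult_0_r, Rplus_0_l, RtoC_inv.
      - unfold Cdiv. apply Cmult_1_l.
      - unfold GammaPow, Rpower. apply Rgt_not_eq, exp_pos. }
    assert (A : forall u v : C, plus (u + v)%C (opp v) = u).
    { intros u v. change (u + v + - v = u)%C. ring. }
    rewrite E0. rewrite A. exact Hl.
Qed.
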